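(* Let $\mathbb{F}$ be an algebraically closed field of characteristic different from $2$. Up to isometric isomorphism, the indecomposable solvable quadratic Lie algebras over $\mathbb{F}$ of dimension at least $1$ and at most $7$ are those in the following list (each described by a basis, its nonzero brackets of basis elements up to skew-symmetry, and the form $q(v)=\varphi(v,v)$). (1) $\mathfrak{r}_1$: basis $x$; zero bracket; $q=X^2$. (2) $\mathfrak{r}_{4,1}$: basis $a,x,y,z$; $[a,x]=x$, $[a,y]=-y$, $[x,y]=z$; $q=2AZ+2XY$. (3) $\mathfrak{r}_5$: basis $x_1,x_2,y,z_1,z_2$; $[x_1,x_2]=y$, $[x_1,y]=z_1$, $[x_2,y]=z_2$; $q=2X_1Z_2-2X_2Z_1+Y^2$. And $\mathfrak{r}_{6,1}$: basis $a,x_1,x_2,y_1,y_2,z$; $[a,x_1]=x_2$, $[a,y_1]=-y_2$, $[x_1,y_1]=z$; $q=2AZ+2X_1Y_2+2X_2Y_1$. (4) $\mathfrak{r}_{6,2}^{\lambda}$ for $\lambda\in\mathbb{F}$, $\lambda\neq0$: basis $a,x_1,x_2,y_1,y_2,z$; $[a,x_1]=x_1$, $[a,x_2]=-x_2$, $[a,y_1]=\lambda y_1$, $[a,y_2]=-\lambda y_2$, $[x_1,x_2]=z$, $[y_1,y_2]=\lambda z$; $q=2AZ+2X_1X_2+2Y_1Y_2$. And $\mathfrak{r}_{6,3}$: basis $a,x_1,x_2,y_1,y_2,z$; $[a,x_1]=x_1+x_2$, $[a,x_2]=x_2$, $[a,y_1]=-y_1-y_2$, $[a,y_2]=-y_2$,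 $[x_1,y_1]=[x_1,y_2]=[x_2,y_1]=z$; $q=2AZ+2X_1Y_2+2X_2Y_1$. (5) $\mathfrak{r}_{7,1}$: basis $a,x_1,\dots,x_5,z$; $[a,x_i]=x_{i+1}$ for $i=1,2,3,4$, $[x_1,x_4]=z$, $[x_2,x_3]=-z$; $q=2AZ-2X_1X_5+2X_2X_4-X_3^2$. $\mathfrak{r}_{7,2}$: basis $a,x_1,x_2,y_1,y_2,y_3,z$; $[a,x_1]=x_1$, $[a,x_2]=-x_2$, $[a,y_1]=y_2$, $[a,y_2]=y_3$, $[x_1,x_2]=[y_1,y_2]=z$; $q=2AZ+2X_1X_2-2Y_1Y_3+Y_2^2$. And $\mathfrak{r}_{7,5}$: basis $a,x_1,x_2,y,w_1,w_2,z$; $[a,x_1]=x_1$, $[a,x_2]=-x_2$, $[a,w_1]=w_1$, $[a,w_2]=-w_2$, $[x_1,x_2]=y$, $[x_1,y]=w_1$, $[x_2,y]=w_2$, $[x_1,w_2]=[x_2,w_1]=-z$; $q=-2AZ+2X_1W_2-2X_2W_1+Y^2$. The algebras in the list are pairwise non-isometrically isomorphic, except within the one-parameter family $\mathfrak{r}_{6,2}^{\lambda}$: for $\lambda,\mu\in\mathbb{F}\setminus\{0\}$, $\mathfrak{r}_{6,2}^{\lambda}$ and $\mathfrak{r}_{6,2}^{\mu}$ are isometrically isomorphic if and only if $\mu\in\{\lambda,-\lambda,\lambda^{-1},-\lambda^{-1}\}$.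
   Context: All vector spaces are finite-dimensional. A quadratic Lie algebra is a pair $(L,\varphi)$ with $L$ a Lie algebra over $\mathbb{F}$ and $\varphi$ a nondegenerate symmetric bilinear form on $L$ that is invariant: $\varphi([x,y],z)=\varphi(x,[y,z])$. It is decomposable if it contains a proper nonzero ideal $I$ with $\varphi|_I$ nondegenerate, and indecomposable otherwise. $L$ is solvable if its derived series reaches $0$. An isometric isomorphism $(L_1,\varphi_1)\to(L_2,\varphi_2)$ is a Lie algebra isomorphism $f$ with $\varphi_2(f(x),f(y))=\varphi_1(x,y)$ for all $x,y$. In the forms $q$, a capital letter denotes the coordinate of the vector $v$ with respect to the basis element denoted by the corresponding lower-case letter (e.g. $A$ is the $a$-coordinate, $X_1$ the $x_1$-coordinate); since the characteristic is not $2$, $q$ determines the symmetric bilinear form $\varphi$. Brackets of basis elements not listed (and not obtained by skew-symmetry) are zero. ''The algebras in the list are, up to isometric isomorphism, the indecomposable solvable ones'' means: each listed algebra is an indecomposable solvable quadratic Lie algebra, and every indecomposable solvable quadratic Lie algebra of dimension between $1$ and $7$ is isometrically isomorphic to a listed one. *)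

(* Defs.v *)
From HB Require Import structures.
From mathcomp Require Import all_boot all_algebra.

Set Implicit Arguments.
Unset Strict Implicit.
Unset Printing Implicit Defensive.

Import GRing.Theory.
Local Open Scope ring_scope.

(* A finite-dimensional space with a binary operation and a form, subject to   *)
(* no axioms: the axioms are the predicates is_lie and is_quadratic_lie below. *)
Record quad_alg (F : fieldType) := QuadAlg {
  carrier :> vectType F;
  bracket : carrier -> carrier -> carrier;
  phi : carrier -> carrier -> F
}.

Section Theory.
Variable F : fieldType.
Implicit Type L : quad_alg F.

Definition is_lie L : Prop :=
  [/\ bilinear_for *:%R *:%R (@bracket F L),
      forall x : L, bracket x x = 0
    & forall x y z : L,
        bracket x (bracket y z) + bracket y (bracket z x)
          + bracket z (bracket x y) = 0].

(* The restriction of phi to a subspace U is nondegenerate. *)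
Definition nondeg_on L (U : {vspace L}) : Prop :=
  forall x, x \in U -> (forall y, y \in U -> phi x y = 0) -> x = 0.

Definition is_quadratic_lie L : Prop :=
  is_lie L /\
  [/\ bilinear_for *%R *%R (@phi F L),
      forall x y : L, phi x y = phi y x,
      nondeg_on (fullv : {vspace L})
    & forall x y z : L, phi (bracket x y) z = phi x (bracket y z)].

Definition is_ideal L (I : {vspace L}) : Prop :=
  forall x y, y \in I -> bracket x y \in I.

Definition decomposable L : Prop :=
  exists I : {vspace L},
    [/\ is_ideal I, I != 0%VS, I != fullv & nondeg_on I].

(* [U, U], the span of the brackets of all pairs of elements of U; it is       *)
(* spanned by the brackets of basis elements, see derived_algP.                *)
Definition derived_alg L (U : {vspace L}) : {vspace L} :=
  <<[seq bracket u v | u <- vbasis U, v <- vbasis U]>>%VS.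

Definition solvable_lie L : Prop :=
  exists n, iter n (@derived_alg L) fullv = 0%VS.

Definition isometric_iso L1 L2 : Prop :=
  exists f : {linear L1 -> L2},
    [/\ bijective f,
        forall x y, f (bracket x y) = bracket (f x) (f y)
      & forall x y, phi (f x) (f y) = phi x y].

Lemma derived_algP L (U W : {vspace L}) : is_lie L ->
  (forall u v, u \in U -> v \in U -> bracket u v \in W) <->
  (derived_alg U <= W)%VS.
Proof.
case=> -[brl brr] _ _; split=> [UW | /span_subvP UW u v].
  apply/span_subvP => _ /allpairsP[[u v] [/= uU vU ->]].
  by apply: UW; apply: vbasis_mem.
have sum_mem (g : L -> L) x : linear g -> x \in U ->
    (forall y, y \in vbasis U -> g y \in W) -> g x \in W.
  move=> g_lin /coord_vbasis-> gW.
  pose h : {linear L -> L} := HB.pack g (GRing.isLinear.Build _ _ _ _ g g_lin).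
  rewrite -[g]/(h : L -> L) linear_sum memv_suml // => i _.
  by rewrite linearZ memvZ // gW // mem_nth ?size_tuple.
move=> uU vU; apply: (sum_mem (fun x => bracket x v)) => // y yB.
apply: sum_mem => // z zB.
by apply: UW; apply/allpairsP; exists (y, z).
Qed.

(* The space F^n with basis e_0, ..., e_(n-1), the skew-symmetric bilinear     *)
(* bracket such that [e_i, e_j] = w for each entry (i, j, w) of tab, the       *)
(* brackets of basis elements not determined by tab being 0, and the symmetric *)
(* bilinear form obtained by polarizing the quadratic form q (a homogeneous    *)
(* function of degree 2 of the coordinates; the characteristic is not 2).      *)
(* Each pair {i, j} should be listed at most once in tab.                      *)
Definition table_alg n (tab : seq ('I_n * 'I_n * 'rV[F]_n))
    (q : ('I_n -> F) -> F) : quad_alg F :=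
  @QuadAlg F 'rV[F]_n
    (fun u v => \sum_(t <- tab)
       (u 0 t.1.1 * v 0 t.1.2 - u 0 t.1.2 * v 0 t.1.1) *: t.2)
    (fun u v => (q ((u + v) 0) - q (u 0) - q (v 0)) / 2).

Definition r1 : quad_alg F :=
  let x := @Ordinal 1 0 isT in
  table_alg [::] (fun V => V x ^+ 2).

Definition r41 : quad_alg F :=
  let a := @Ordinal 4 0 isT in let x := @Ordinal 4 1 isT in
  let y := @Ordinal 4 2 isT in let z := @Ordinal 4 3 isT in
  table_alg
    [:: (a, x, 'e_x); (a, y, - 'e_y); (x, y, 'e_z)]
    (fun V => 2 * V a * V z + 2 * V x * V y).

Definition r5 : quad_alg F :=
  let x1 := @Ordinal 5 0 isT in let x2 := @Ordinal 5 1 isT in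
  let y := @Ordinal 5 2 isT in let z1 := @Ordinal 5 3 isT in
  let z2 := @Ordinal 5 4 isT in
  table_alg
    [:: (x1, x2, 'e_y); (x1, y, 'e_z1); (x2, y, 'e_z2)]
    (fun V => 2 * V x1 * V z2 - 2 * V x2 * V z1 + V y ^+ 2).

Definition r61 : quad_alg F :=
  let a := @Ordinal 6 0 isT in let x1 := @Ordinal 6 1 isT in
  let x2 := @Ordinal 6 2 isT in let y1 := @Ordinal 6 3 isT in
  let y2 := @Ordinal 6 4 isT in let z := @Ordinal 6 5 isT in
  table_alg
    [:: (a, x1, 'e_x2); (a, y1, - 'e_y2); (x1, y1, 'e_z)]
    (fun V => 2 * V a * V z + 2 * V x1 * V y2 + 2 * V x2 * V y1).

Definition r62 (lam : F) : quad_alg F :=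
  let a := @Ordinal 6 0 isT in let x1 := @Ordinal 6 1 isT in
  let x2 := @Ordinal 6 2 isT in let y1 := @Ordinal 6 3 isT in
  let y2 := @Ordinal 6 4 isT in let z := @Ordinal 6 5 isT in
  table_alg
    [:: (a, x1, 'e_x1); (a, x2, - 'e_x2);
        (a, y1, lam *: 'e_y1); (a, y2, - lam *: 'e_y2);
        (x1, x2, 'e_z); (y1, y2, lam *: 'e_z)]
    (fun V => 2 * V a * V z + 2 * V x1 * V x2 + 2 * V y1 * V y2).

Definition r63 : quad_alg F :=
  let a := @Ordinal 6 0 isT in let x1 := @Ordinal 6 1 isT in
  let x2 := @Ordinal 6 2 isT in let y1 := @Ordinal 6 3 isT in
  let y2 := @Ordinal 6 4 isT in let z := @Ordinal 6 5 isT in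
  table_alg
    [:: (a, x1, 'e_x1 + 'e_x2); (a, x2, 'e_x2);
        (a, y1, - 'e_y1 - 'e_y2); (a, y2, - 'e_y2);
        (x1, y1, 'e_z); (x1, y2, 'e_z); (x2, y1, 'e_z)]
    (fun V => 2 * V a * V z + 2 * V x1 * V y2 + 2 * V x2 * V y1).

Definition r71 : quad_alg F :=
  let a := @Ordinal 7 0 isT in let x1 := @Ordinal 7 1 isT in
  let x2 := @Ordinal 7 2 isT in let x3 := @Ordinal 7 3 isT in
  let x4 := @Ordinal 7 4 isT in let x5 := @Ordinal 7 5 isT in
  let z := @Ordinal 7 6 isT in
  table_alg
    [:: (a, x1, 'e_x2); (a, x2, 'e_x3); (a, x3, 'e_x4); (a, x4, 'e_x5);
        (x1, x4, 'e_z); (x2, x3, - 'e_z)]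
    (fun V => 2 * V a * V z - 2 * V x1 * V x5 + 2 * V x2 * V x4 - V x3 ^+ 2).

Definition r72 : quad_alg F :=
  let a := @Ordinal 7 0 isT in let x1 := @Ordinal 7 1 isT in
  let x2 := @Ordinal 7 2 isT in let y1 := @Ordinal 7 3 isT in
  let y2 := @Ordinal 7 4 isT in let y3 := @Ordinal 7 5 isT in
  let z := @Ordinal 7 6 isT in
  table_alg
    [:: (a, x1, 'e_x1); (a, x2, - 'e_x2); (a, y1, 'e_y2); (a, y2, 'e_y3);
        (x1, x2, 'e_z); (y1, y2, 'e_z)]
    (fun V => 2 * V a * V z + 2 * V x1 * V x2 - 2 * V y1 * V y3 + V y2 ^+ 2).

Definition r75 : quad_alg F :=
  let a := @Ordinal 7 0 isT in let x1 := @Ordinal 7 1 isT in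
  let x2 := @Ordinal 7 2 isT in let y := @Ordinal 7 3 isT in
  let w1 := @Ordinal 7 4 isT in let w2 := @Ordinal 7 5 isT in
  let z := @Ordinal 7 6 isT in
  table_alg
    [:: (a, x1, 'e_x1); (a, x2, - 'e_x2); (a, w1, 'e_w1); (a, w2, - 'e_w2);
        (x1, x2, 'e_y); (x1, y, 'e_w1); (x2, y, 'e_w2);
        (x1, w2, - 'e_z); (x2, w1, - 'e_z)]
    (fun V => - (2 * V a * V z) + 2 * V x1 * V w2 - 2 * V x2 * V w1
              + V y ^+ 2).

End Theory.

Inductive label (F : fieldType) :=
  R1 | R41 | R5 | R61 | R62 of F | R63 | R71 | R72 | R75.
Arguments R1 {F}. Arguments R41 {F}. Arguments R5 {F}. Arguments R61 {F}.
Arguments R63 {F}. Arguments R71 {F}. Arguments R72 {F}. Arguments R75 {F}.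

Definition listed (F : fieldType) (k : label F) : Prop :=
  if k is R62 lam then lam != 0 else True.

Definition alg_of (F : fieldType) (k : label F) : quad_alg F :=
  match k with
  | R1 => r1 F
  | R41 => r41 F
  | R5 => r5 F
  | R61 => r61 F
  | R62 lam => r62 lam
  | R63 => r63 F
  | R71 => r71 F
  | R72 => r72 F
  | R75 => r75 F
  end.

(* Main.v *)
(* The trilinear form T(x, y, z) = phi([x, y], z) is alternating, and with phi
   it determines the bracket; so an isometric isomorphism with a listed algebra
   is a basis with the listed values of phi and T.  Let L be solvable and
   indecomposable with dim L > 1.  Its centre Z is nonzero, and totally
   isotropic because a nonisotropic central vector would split off.  Conversely
   a solvable L with dim L <= 7 and isotropic centre is indecomposable, since
   one of two orthogonal summands has dimension at most 3, hence is central.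
   Splitting off hyperbolic pairs (z_i, x_i) with the z_i a basis of Z, T lives
   on a space of dimension m = dim L - dim Z >= dim L / 2 on which it has no
   kernel, which excludes m = 1, 2, 4.  The case m = 3 gives r41, r5, r61.  For
   m = 5 the Jacobi identity makes L a double extension of an abelian algebra
   by a skew map, whose eigenvectors or kernel produce r62, r63, r71, r72.  For
   m = 6, L is the double extension of r5 by a traceless 2 x 2 matrix, which is
   r75.  The listed algebras are told apart by their dimension, their centre
   and the eigenvectors of ad; the eigenvalues of ad a, up to scaling, recover
   the parameter of r62. *)
From HB Require Import structures.
Require Import Defs.
From mathcomp Require Import all_boot all_algebra ring zify.

Set Implicit Arguments.
Unset Strict Implicit.
Unset Printing Implicit Defensive.

Import GRing.Theory.
Local Open Scope ring_scope.

(** * The alternating trilinear form *)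

Section Bilinear.
Variables (F : fieldType) (L : quad_alg F).

(** A 3-form in at most two variables is zero, and one in four variables is the contraction of the
    volume form with a vector, which lies in its kernel: this is why ranks 1, 2 and 4 cannot occur.
    When one hyperbolic pair (z, a) has been split off, the complement U stands for the Lie algebra
    z^perp / <z>, whose trilinear form is T restricted to U; the quotient itself is never formed.
    The obstacle is that T restricted to U may have a kernel although T has none: a vector of that
    kernel is central only if ad a kills it too, and the Jacobi identity, read as quadratic
    equations between values of T, is what controls ad a on it. Solvability enters through one
    principle, that a subspace perfect modulo a stable K lies in K; it gives a nonzero centre and
    forbids a copy of sl_2, that is, an orthonormal triple closed under brackets modulo K with T
    nonzero. Algebraic closedness supplies orthonormal bases and eigenvectors. Dividing a by s and
    multiplying z by s preserves phi and divides T(a, ., .) by s; such rescalings absorb every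
    nonzero constant except the ratio of two eigenvalues, which survives as the parameter of r62. *)

Definition tri (x y z : L) : F := phi (bracket x y) z.
Definition central (z : L) : Prop := forall x, bracket z x = 0.

Section Lie.
Hypothesis lieL : is_lie L.
Implicit Types x y z : L.

Lemma brDl x x' y : bracket (x + x') y = bracket x y + bracket x' y.
Proof.
by case: lieL => -[H _] _ _;
  rewrite -[X in bracket (X + _) _](scale1r x) H /= scale1r.
Qed.
Lemma brDr x y y' : bracket x (y + y') = bracket x y + bracket x y'.
Proof.
by case: lieL => -[_ H] _ _;
  rewrite -[X in bracket _ (X + _)](scale1r y) H /= scale1r.
Qed.
Lemma br0l y : bracket 0 y = 0.
Proof. by apply: (addrI (bracket 0 y)); rewrite -brDl !addr0. Qed.
Lemma br0r x : bracket x 0 = 0.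
Proof. by apply: (addrI (bracket x 0)); rewrite -brDr !addr0. Qed.
Lemma brZl c x y : bracket (c *: x) y = c *: bracket x y.
Proof.
by case: lieL => -[H _] _ _; rewrite -[c *: x]addr0 H /= br0l addr0.
Qed.
Lemma brZr c x y : bracket x (c *: y) = c *: bracket x y.
Proof.
by case: lieL => -[_ H] _ _; rewrite -[c *: y]addr0 H /= br0r addr0.
Qed.
Lemma brNl x y : bracket (- x) y = - bracket x y.
Proof. by rewrite -scaleN1r brZl scaleN1r. Qed.
Lemma brNr x y : bracket x (- y) = - bracket x y.
Proof. by rewrite -scaleN1r brZr scaleN1r. Qed.
Lemma brxx x : bracket x x = 0. Proof. by case: lieL. Qed.
Lemma brC x y : bracket x y = - bracket y x.
Proof.
apply/eqP; rewrite -addr_eq0 -(brxx (x + y)) brDl !brDr !brxx.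
by rewrite add0r addr0.
Qed.
Lemma jacobi x y z :
  bracket x (bracket y z) + bracket y (bracket z x)
    + bracket z (bracket x y) = 0.
Proof. by case: lieL. Qed.

Definition brE := (brDl, brDr, brZl, brZr, brNl, brNr, br0l, br0r).

Lemma centralr z x : central z -> bracket x z = 0.
Proof. by move=> cz; rewrite brC cz oppr0. Qed.

Lemma centralD z z' : central z -> central z' -> central (z + z').
Proof. by move=> cz cz' x; rewrite brDl cz cz' addr0. Qed.

Lemma centralZ c z : central z -> central (c *: z).
Proof. by move=> cz x; rewrite brZl cz scaler0. Qed.

End Lie.

Section Quadratic.
Hypothesis quadL : is_quadratic_lie L.
Implicit Types x y z : L.

Let lieL : is_lie L := proj1 quadL.

Lemma phiC x y : phi x y = phi y x.
Proof. by case: quadL => _ []. Qed.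
Lemma phiDl x x' y : phi (x + x') y = phi x y + phi x' y.
Proof.
by case: quadL => _ [[H _] _ _ _]; rewrite -[X in phi (X + _) _](scale1r x)
  (H y 1 x x') /= mul1r.
Qed.
Lemma phiDr x y y' : phi x (y + y') = phi x y + phi x y'.
Proof. by rewrite phiC phiDl !(phiC x). Qed.
Lemma phi0l y : phi 0 y = 0.
Proof. by apply: (addrI (phi 0 y)); rewrite -phiDl !addr0. Qed.
Lemma phi0r x : phi x 0 = 0.
Proof. by rewrite phiC phi0l. Qed.
Lemma phiZl c x y : phi (c *: x) y = c * phi x y.
Proof.
by case: quadL => _ [[H _] _ _ _]; rewrite -[c *: x]addr0 (H y c x 0) /= phi0l
  addr0.
Qed.
Lemma phiZr c x y : phi x (c *: y) = c * phi x y.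
Proof. by rewrite phiC phiZl phiC. Qed.
Lemma phiNl x y : phi (- x) y = - phi x y.
Proof. by rewrite -scaleN1r phiZl mulN1r. Qed.
Lemma phiNr x y : phi x (- y) = - phi x y.
Proof. by rewrite -scaleN1r phiZr mulN1r. Qed.

Definition phiE := (phiDl, phiDr, phiZl, phiZr, phiNl, phiNr, phi0l, phi0r).

Lemma phi_suml (I : Type) (r : seq I) (P : pred I) (f : I -> L) y :
  phi (\sum_(i <- r | P i) f i) y = \sum_(i <- r | P i) phi (f i) y.
Proof.
by elim/big_rec2: _ => [|i s t _ <-]; rewrite ?phi0l ?phiDl.
Qed.

Lemma phi_eq0 x : (forall y, phi x y = 0) -> x = 0.
Proof.
by case: quadL => _ [_ _ nd _] H; apply: nd; rewrite ?memvf.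
Qed.

Lemma phi_br x y z : phi (bracket x y) z = phi x (bracket y z).
Proof. by case: quadL => _ []. Qed.

Lemma triC12 x y z : tri y x z = - tri x y z.
Proof. by rewrite /tri brC // phiNl. Qed.
Lemma tri_cycle x y z : tri y z x = tri x y z.
Proof. by rewrite /tri phiC phi_br. Qed.
Lemma triC23 x y z : tri x z y = - tri x y z.
Proof. by rewrite -tri_cycle triC12 tri_cycle. Qed.
Lemma trixx x z : tri x x z = 0.
Proof. by rewrite /tri brxx // phi0l. Qed.
Lemma trixy x y : tri x y x = 0.
Proof. by rewrite triC23 trixx oppr0. Qed.
Lemma triyy x y : tri x y y = 0.
Proof. by rewrite -tri_cycle trixx. Qed.

Lemma triDl x x' y z : tri (x + x') y z = tri x y z + tri x' y z.
Proof. by rewrite /tri brDl ?phiDl. Qed.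
Lemma triDm x y y' z : tri x (y + y') z = tri x y z + tri x y' z.
Proof. by rewrite /tri brDr ?phiDl. Qed.
Lemma triDr x y z z' : tri x y (z + z') = tri x y z + tri x y z'.
Proof. by rewrite /tri phiDr. Qed.
Lemma triZl c x y z : tri (c *: x) y z = c * tri x y z.
Proof. by rewrite /tri brZl ?phiZl. Qed.
Lemma triZm c x y z : tri x (c *: y) z = c * tri x y z.
Proof. by rewrite /tri brZr ?phiZl. Qed.
Lemma triZr c x y z : tri x y (c *: z) = c * tri x y z.
Proof. by rewrite /tri phiZr. Qed.
Lemma triNl x y z : tri (- x) y z = - tri x y z.
Proof. by rewrite /tri brNl ?phiNl. Qed.
Lemma triNm x y z : tri x (- y) z = - tri x y z.
Proof. by rewrite /tri brNr ?phiNl. Qed.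
Lemma triNr x y z : tri x y (- z) = - tri x y z.
Proof. by rewrite /tri phiNr. Qed.
Lemma tri0l y z : tri 0 y z = 0.
Proof. by rewrite /tri br0l ?phi0l. Qed.
Lemma tri0m x z : tri x 0 z = 0.
Proof. by rewrite /tri br0r ?phi0l. Qed.
Lemma tri0r x y : tri x y 0 = 0.
Proof. by rewrite /tri phi0r. Qed.

Definition triE := (triDl, triDm, triDr, triZl, triZm, triZr,
  triNl, triNm, triNr, tri0l, tri0m, tri0r, trixx, trixy, triyy).

Lemma tri_sumr (I : Type) (r : seq I) (P : pred I) (f : I -> L) x y :
  tri x y (\sum_(i <- r | P i) f i) = \sum_(i <- r | P i) tri x y (f i).
Proof.
by elim/big_rec2: _ => [|i s t _ <-]; rewrite ?tri0r ?triDr.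
Qed.

Lemma tri_summ (I : Type) (r : seq I) (P : pred I) (f : I -> L) x z :
  tri x (\sum_(i <- r | P i) f i) z = \sum_(i <- r | P i) tri x (f i) z.
Proof.
by elim/big_rec2: _ => [|i s t _ <-]; rewrite ?tri0m ?triDm.
Qed.

(** One value of an alternating form determines six. The conclusion is a product of equations so
    that it can serve as a single rewrite rule. *)
Lemma tri_perm x y z d : tri x y z = d ->
  (tri x y z = d) * (tri y z x = d) * (tri z x y = d) *
  (tri y x z = - d) * (tri x z y = - d) * (tri z y x = - d).
Proof.
move=> <-; do !split => //.
- exact: tri_cycle.
- by rewrite -tri_cycle.
- exact: triC12.
- exact: triC23.
- by rewrite triC12 tri_cycle.
Qed.

Lemma phi_sym x y d : phi x y = d -> (phi x y = d) * (phi y x = d).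
Proof. by move=> <-; rewrite (phiC y). Qed.

Lemma centralP z : (forall x y, tri z x y = 0) -> central z.
Proof. by move=> cz x; apply: phi_eq0 => y; apply: cz. Qed.

Lemma tri_central z : central z ->
  (forall x y, tri z x y = 0) * (forall x y, tri x z y = 0) *
  (forall x y, tri x y z = 0).
Proof.
move=> cz; have H x y : tri z x y = 0 by rewrite /tri cz phi0l.
split; first split=> //; move=> x y; first by rewrite triC12 H oppr0.
by rewrite -tri_cycle -tri_cycle H.
Qed.

(** By invariance [phi [x,y] [z,w]] equals [phi [[x,y],z] w], so this is the Jacobi identity paired
    with [w]. In this form it becomes quadratic in the values of [tri] once brackets are expanded in
    a basis. *)
Lemma jacobi4 x y z w :
  phi (bracket x y) (bracket z w) + phi (bracket y z) (bracket x w)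
  + phi (bracket z x) (bracket y w) = 0.
Proof.
rewrite -!phi_br -!phiDl.
have -> : bracket (bracket x y) z + bracket (bracket y z) x
          + bracket (bracket z x) y = 0.
  rewrite ![bracket (bracket _ _) _]brC // -!opprD.
  by rewrite -addrA addrC jacobi // oppr0.
by rewrite phi0l.
Qed.

End Quadratic.
End Bilinear.

(** * Recognizing a listed algebra by the two forms on a basis *)

Section Criterion.
Variables (F : fieldType).

Lemma isometric_iso_trans (L1 L2 L3 : quad_alg F) :
  isometric_iso L1 L2 -> isometric_iso L2 L3 -> isometric_iso L1 L3.
Proof.
move=> [f [bij_f fbr fphi]] [g [bij_g gbr gphi]]; exists (g \o f : {linear _ -> _}).
by split=> [|x y|x y] /=; [exact: bij_comp | rewrite fbr gbr | rewrite gphi fphi].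
Qed.

Lemma isometric_iso_sym (L1 L2 : quad_alg F) :
  isometric_iso L1 L2 -> isometric_iso L2 L1.
Proof.
case=> f [[g fK gK] fbr fphi].
have g_lin : linear g.
  by move=> c x y; apply: (can_inj fK); rewrite linearP !gK.
pose h : {linear L2 -> L1} := HB.pack g (GRing.isLinear.Build _ _ _ _ g g_lin).
exists h; split; first by exists f.
- by move=> x y; apply: (can_inj fK); rewrite fbr !gK.
- by move=> x y; rewrite -fphi !gK.
Qed.

Lemma dim_table n (tab : seq ('I_n * 'I_n * 'rV[F]_n)) q :
  \dim (fullv : {vspace table_alg tab q}) = n.
Proof. by rewrite dimvf dim_matrix; apply: mul1n. Qed.

Variables (L : quad_alg F) (n : nat) (tab : seq ('I_n * 'I_n * 'rV[F]_n)).
Variable q : ('I_n -> F) -> F.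
Let M := table_alg tab q.
Hypotheses (quadL : is_quadratic_lie L) (quadM : is_quadratic_lie M).
Hypothesis dimL : \dim (fullv : {vspace L}) = n.
Variable u : 'I_n -> L.
Hypothesis phi_u : forall i j : 'I_n,
  phi (u i) (u j) = phi ('e_i : M) ('e_j : M).
Hypothesis tri_u : forall i j k : 'I_n,
  tri (u i) (u j) (u k) = tri ('e_i : M) ('e_j : M) ('e_k : M).

Let lieL : is_lie L := proj1 quadL.

(** The map sending each basis vector of [M] to [u i] preserves [phi], so nondegeneracy of [M] makes
    it injective and equality of dimensions bijective. It respects brackets because [phi] and [tri]
    determine them. The isomorphism sought is its inverse. *)
Lemma isometric_iso_table : isometric_iso L M.
Proof.
pose g (w : M) : L := \sum_i (w : 'rV_n) 0 i *: u i.
have g_lin : linear g.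
  move=> c v w; rewrite /g scaler_sumr -big_split; apply: eq_bigr => i _ /=.
  by rewrite !mxE scalerDl scalerA.
pose G : {linear M -> L} := HB.pack g (GRing.isLinear.Build _ _ _ _ g g_lin).
have expM (v : M) : v = \sum_i (v : 'rV_n) 0 i *: ('e_i : M).
  exact: row_sum_delta.
have phiG v w : phi (g v) (g w) = phi v w.
  rewrite [in RHS](expM v) [in RHS](expM w) !phi_suml //; apply: eq_bigr => i _.
  rewrite [LHS]phiC // [RHS]phiC // !phi_suml //; apply: eq_bigr => j _.
  by rewrite !phiE // phi_u.
have triG v w t : tri (g v) (g w) (g t) = tri v w t.
  rewrite [in RHS](expM v) [in RHS](expM w) [in RHS](expM t).
  rewrite !tri_sumr //; apply: eq_bigr => k _.
  rewrite -tri_cycle // -[RHS]tri_cycle // -tri_cycle // -[RHS]tri_cycle //.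
  rewrite !tri_sumr //; apply: eq_bigr => j _.
  rewrite -tri_cycle // -[RHS]tri_cycle // -tri_cycle // -[RHS]tri_cycle //.
  rewrite !tri_sumr //; apply: eq_bigr => i _.
  rewrite -tri_cycle // -[RHS]tri_cycle // -tri_cycle // -[RHS]tri_cycle //.
  rewrite !triZl // !triZm // !triZr //.
  by rewrite -tri_cycle // tri_u -[in RHS]tri_cycle.
have kerG : lker (linfun G) == 0%VS.
  apply/eqP/vspaceP => v; rewrite memv_ker lfunE memv0 /=.
  apply/eqP/eqP => [gv0 | ->]; last exact: (linear0 G).
  by apply: (phi_eq0 quadM) => w; rewrite -phiG gv0 phi0l.
have limG : limg (linfun G) = fullv.
  apply/eqP; rewrite eqEdim subvf limg_dim_eq ?dimL ?dim_table //=.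
  by rewrite (eqP kerG) capv0.
pose f := ((linfun G)^-1)%VF.
have fK : cancel g f by move=> v; rewrite -[g v](lfunE G) lker0_lfunK.
have gK : cancel f g.
  by move=> x; rewrite -[g _](lfunE G) limg_lfunVK // limG memvf.
have brG v w : g (bracket v w) = bracket (g v) (g w).
  apply/eqP; rewrite -subr_eq0; apply/eqP; apply: (phi_eq0 quadL) => y.
  rewrite -(gK y) phiDl // phiNl // phiG -[phi (bracket (g v) _) _]/(tri _ _ _) triG.
  by rewrite subrr.
exists f; split; first by exists g.
- by move=> x y; apply: (can_inj fK); rewrite brG !gK.
- by move=> x y; rewrite -phiG !gK.
Qed.

End Criterion.

(** Symmetry and alternation leave only increasing indices to check, which the tactics [check_phi]
    and [check_tri] enumerate. *)
Lemma isometric_iso_seq (F : fieldType) (L : quad_alg F) n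
    (tab : seq ('I_n * 'I_n * 'rV[F]_n)) q (s : seq L) :
  let M := table_alg tab q in
  is_quadratic_lie L -> is_quadratic_lie M -> \dim (fullv : {vspace L}) = n ->
  (forall i j : 'I_n, (i <= j)%N ->
     phi s`_i s`_j = phi ('e_i : M) ('e_j : M)) ->
  (forall i j k : 'I_n, (i < j)%N -> (j < k)%N ->
     tri s`_i s`_j s`_k = tri ('e_i : M) ('e_j : M) ('e_k : M)) ->
  isometric_iso L M.
Proof.
move=> M quadL quadM dimL phi_s tri_s.
apply: (isometric_iso_table quadL quadM dimL (u := fun i => s`_i)) => [i j|].
  by case: (leqP i j) => [/phi_s //|/ltnW/phi_s]; rewrite phiC // => ->; apply: phiC.
have cyc (i j k : 'I_n) : tri s`_i s`_j s`_k = tri ('e_i : M) ('e_j : M) ('e_k : M) ->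
    tri s`_j s`_k s`_i = tri ('e_j : M) ('e_k : M) ('e_i : M).
  by move=> H; rewrite [LHS]tri_cycle // [RHS]tri_cycle.
have swp (i j k : 'I_n) : tri s`_i s`_j s`_k = tri ('e_i : M) ('e_j : M) ('e_k : M) ->
    tri s`_j s`_i s`_k = tri ('e_j : M) ('e_i : M) ('e_k : M).
  by move=> H; rewrite [LHS]triC12 // H [RHS]triC12.
move=> i j k.
have [ij|ij|/val_inj->] := ltngtP i j; last by rewrite !trixx.
- have [jk|jk|/val_inj->] := ltngtP j k; last by rewrite !triyy.
  + exact: tri_s.
  + have [ik|ik|/val_inj->] := ltngtP i k; last by rewrite !trixy.
    * by apply/cyc/swp/tri_s.
    * by apply/cyc/tri_s.
- have [ik|ik|/val_inj->] := ltngtP i k; last by rewrite !trixy.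
  + by apply/swp/tri_s.
  + have [jk|jk|/val_inj->] := ltngtP j k; last by rewrite !triyy.
    * by apply/cyc/cyc/tri_s.
    * by apply/swp/cyc/tri_s.
Qed.

(** * Orthogonality and bases *)

Section Orthogonality.
Variables (F : fieldType) (L : quad_alg F).
Hypothesis quadL : is_quadratic_lie L.
Implicit Types (x y z u v : L) (U W : {vspace L}).

Let lieL : is_lie L := proj1 quadL.

Definition orthv v : {vspace L} := lker (linfun (phi v : L -> F^o)).
Definition perp W : {vspace L} := (\bigcap_(w <- vbasis W) orthv w)%VS.

Lemma linfun_phi v x : linfun (phi v : L -> F^o) x = phi v x.
Proof.
have lin : linear (phi v : L -> F^o).
  by move=> c y z; rewrite phiDr ?phiZr.
pose f : {linear L -> F^o} := HB.pack (phi v : L -> F^o)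
  (GRing.isLinear.Build _ _ _ _ (phi v : L -> F^o) lin).
exact: (lfunE f).
Qed.

Lemma mem_orthv v x : (x \in orthv v) = (phi v x == 0).
Proof. by rewrite memv_ker linfun_phi. Qed.

Lemma leq_dim_cap_orthv U v : (\dim U <= (\dim (U :&: orthv v)).+1)%N.
Proof.
rewrite -(limg_ker_dim (linfun (phi v : L -> F^o)) U) -addn1 leq_add2l.
have sub1 : (linfun (phi v : L -> F^o) @: U <= <[1 : F^o]>)%VS.
  by apply/subvP => c _; apply/vlineP; exists c; apply/esym; apply: mulr1.
by rewrite (leq_trans (dimvS sub1)) // dim_vline oner_eq0.
Qed.

Lemma dim_cap_orthv U v u : u \in U -> phi v u != 0 ->
  \dim U = (\dim (U :&: orthv v)).+1.
Proof.
move=> uU vu; apply/eqP; rewrite eqn_leq leq_dim_cap_orthv ltnNge.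
apply: contra vu => le_dim.
have /eqP capU : (U :&: orthv v == U)%VS by rewrite eqEdim capvSl.
by rewrite -mem_orthv; move: uU; rewrite -{1}capU memv_cap => /andP[].
Qed.

Lemma mem_span_vbasis (P : L -> Prop) W : P 0 ->
  (forall c x y, P x -> P y -> P (c *: x + y)) ->
  (forall w, w \in (vbasis W : seq L) -> P w) -> forall w, w \in W -> P w.
Proof.
move=> P0 PD PW w /coord_vbasis ->.
elim/big_rec: _ => // i x _ Px; apply: PD => //; apply: PW.
by rewrite mem_nth ?size_tuple.
Qed.

Lemma mem_perpP W x :
  reflect (forall w, w \in W -> phi w x = 0) (x \in perp W).
Proof.
have -> : (x \in perp W) = all (fun w => phi w x == 0) (vbasis W).
  rewrite /perp; elim: (tval _) => [|w s IHs]; first by rewrite big_nil memvf.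
  by rewrite big_cons memv_cap mem_orthv IHs.
apply: (iffP allP) => [H | H w /vbasis_mem /H ->//].
apply: mem_span_vbasis => [|c y z Hy Hz|w /H/eqP//].
  exact: phi0l.
by rewrite phiDl ?phiZl // Hy Hz mulr0 addr0.
Qed.

Lemma leq_dim_perp W : (\dim (fullv : {vspace L}) <= \dim W + \dim (perp W))%N.
Proof.
rewrite -{1}(size_tuple (vbasis W)) /perp; elim: (tval _) => [|w s IHs].
  by rewrite big_nil.
rewrite big_cons capvC (leq_trans IHs) //= addSnnS leq_add2l.
exact: leq_dim_cap_orthv.
Qed.

Lemma perp_exists W : W != fullv ->
  exists2 v, v != 0 & forall w, w \in W -> phi v w = 0.
Proof.
move=> Wf; have : perp W != 0%VS.
  apply: contra Wf => /eqP pW; have := leq_dim_perp W.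
  by rewrite pW dimv0 addn0 eqEdim subvf.
rewrite -vpick0 => ?; exists (vpick (perp W)) => // w wW; rewrite phiC //.
exact: (mem_perpP _ _ (memv_pick _)).
Qed.

Lemma nondeg_full : nondeg_on (fullv : {vspace L}).
Proof. by case: quadL => _ []. Qed.

Lemma nondeg_exists U x : nondeg_on U -> x \in U -> x != 0 ->
  exists2 y, y \in U & phi x y != 0.
Proof.
move=> nU xU x0.
have /hasP[y yU xy]: has (fun y => phi x y != 0) (vbasis U).
  apply: contraR x0; rewrite -all_predC => /allP xU0.
  apply/eqP/nU => //; apply: mem_span_vbasis => [|c y z Hy Hz|y /xU0 /=].
  - exact: phi0r.
  - by rewrite phiDr ?phiZr // Hy Hz mulr0 addr0.
  - by rewrite negbK => /eqP.
by exists y => //; apply: vbasis_mem.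
Qed.

Lemma nondeg_cap1 U v : nondeg_on U -> v \in U -> phi v v != 0 ->
  nondeg_on (U :&: orthv v).
Proof.
move=> nU vU vv x; rewrite memv_cap mem_orthv => /andP[xU /eqP vx] x0.
apply: nU => // y yU.
rewrite -(subrK ((phi v y / phi v v) *: v) y) phiDr // phiZr // [phi x v]phiC //.
rewrite vx mulr0 addr0 x0 // memv_cap mem_orthv memvB ?memvZ //=.
by rewrite phiDr // phiNr // phiZr // divfK // subrr.
Qed.

Lemma nondeg_cap2 U z x : nondeg_on U -> z \in U -> x \in U ->
    phi z z = 0 -> phi x x = 0 -> phi x z = 1 ->
  nondeg_on ((U :&: orthv z) :&: orthv x).
Proof.
move=> nU zU xU zz xx xz v; rewrite !memv_cap !mem_orthv.
case/andP=> /andP[vU /eqP zv] /eqP xv v0; apply: nU => // y yU.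
pose y' := phi x y *: z + phi z y *: x.
rewrite -(subrK y' y) phiDr // [X in _ + X]phiC // /y' phiDl // !phiZl //.
rewrite zv xv !mulr0 !addr0 v0 // !memv_cap !mem_orthv.
rewrite memvB ?memvD ?memvZ //=.
rewrite !phiE // zz xx xz [phi z x]phiC // xz !mulr0 !mulr1 addr0 add0r.
by rewrite !subrr eqxx.
Qed.

End Orthogonality.

(** * Splittings and skew maps over an algebraically closed field *)

Section ClosedField.
Variable F : closedFieldType.

Lemma closed_sqrt (a : F) : exists s : F, s ^+ 2 = a.
Proof.
have /closed_rootP[s]: size ('X^2 - a%:P : {poly F}) != 1%N.
  by rewrite size_XnsubC.
by rewrite /root hornerD hornerN hornerXn hornerC subr_eq0 => /eqP; exists s.
Qed.

Hypothesis char2 : (2 : F) != 0.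
Variables (L : quad_alg F).
Hypothesis quadL : is_quadratic_lie L.
Implicit Types (x y z u v : L) (U W : {vspace L}).

Let lieL : is_lie L := proj1 quadL.

Lemma unit_vector_of v : phi v v != 0 ->
  exists c : F, phi (c *: v) (c *: v) = 1.
Proof.
move=> vv; have [c c2] := closed_sqrt (phi v v)^-1.
by exists c; rewrite !phiE // mulrA -expr2 c2 mulVf.
Qed.

(** If [x] and [y] are isotropic, then [x + y] has norm [2 * phi x y], and 2 is invertible. *)
Lemma nondeg_anisotropic U : nondeg_on U -> U != 0%VS ->
  exists2 v, v \in U & phi v v != 0.
Proof.
move=> nU; rewrite -vpick0; set x := vpick U => x0.
have xU : x \in U := memv_pick U.
have [y yU xy] := nondeg_exists quadL nU xU x0.
have [xx|xx] := eqVneq (phi x x) 0; last by exists x.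
have [yy|yy] := eqVneq (phi y y) 0; last by exists y.
exists (x + y); first exact: memvD.
rewrite !phiE // xx yy add0r addr0 [phi y x]phiC // -mulr2n -mulr_natl.
by rewrite mulf_neq0.
Qed.

Lemma unit_split U (r : nat) : nondeg_on U -> \dim U = r.+1 ->
  exists e U', [/\ e \in U, phi e e = 1, nondeg_on U', \dim U' = r &
    (U' <= U)%VS /\ (forall u, u \in U' -> phi e u = 0) /\
    forall u, u \in U -> u - phi e u *: e \in U'].
Proof.
move=> nU dU; have [|v vU vv] := nondeg_anisotropic nU.
  by rewrite -dimv_eq0 dU.
have [c ee] := unit_vector_of vv; set e := c *: v in ee.
have eU : e \in U by rewrite memvZ.
have ee0 : phi e e != 0 by rewrite ee oner_neq0.
clearbody e.
exists e, (U :&: orthv e)%VS; split=> //.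
- by apply: nondeg_cap1.
- by apply/eq_add_S; rewrite -dU -(dim_cap_orthv quadL eU ee0).
split; first exact: capvSl.
split=> u; first by rewrite memv_cap mem_orthv // => /andP[_ /eqP].
move=> uU; rewrite memv_cap mem_orthv // memvB ?memvZ //=.
by rewrite !phiE // ee mulr1 subrr.
Qed.

Lemma hyper_split U (r : nat) z : nondeg_on U -> \dim U = r ->
    z \in U -> z != 0 -> phi z z = 0 ->
  exists x U', [/\ x \in U, phi x z = 1, phi x x = 0, nondeg_on U' &
    [/\ r = (\dim U').+2, (U' <= U)%VS,
        forall u, u \in U' -> phi x u = 0 /\ phi z u = 0 &
        forall u, u \in U -> u - (phi x u *: z + phi z u *: x) \in U']].
Proof.
move=> nU dU zU z0 zz; have [y yU zy] := nondeg_exists quadL nU zU z0.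
pose y1 := (phi z y)^-1 *: y.
have y1z : phi y1 z = 1 by rewrite phiZl // [phi y z]phiC // mulVf.
have y1U : y1 \in U by rewrite memvZ.
(* The multiple of the isotropic [z] makes the partner isotropic without changing its product with
   [z]. *)
clearbody y1; pose x := y1 - (phi y1 y1 / 2) *: z.
have xU : x \in U by rewrite memvB ?memvZ.
have xz : phi x z = 1 by rewrite !phiE // zz y1z; ring.
have xx : phi x x = 0.
  rewrite /x phiDl // phiNl // !phiDr // !phiNr // !phiZr // !phiZl //.
  by rewrite zz [phi z y1]phiC // y1z; field.
clearbody x.
exists x, ((U :&: orthv z) :&: orthv x)%VS; split=> //.
  exact: nondeg_cap2.
split=> [|||u uU].
- rewrite -dU (dim_cap_orthv quadL (v := z) xU).
    rewrite -(dim_cap_orthv quadL (v := x) (u := z)) ?xz ?oner_neq0 //.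
    by rewrite memv_cap zU mem_orthv // zz eqxx.
  by rewrite phiC // xz oner_neq0.
- by rewrite (subv_trans (capvSl _ _)) // capvSl.
- move=> u; rewrite !memv_cap !mem_orthv //.
  by case/andP=> /andP[_ /eqP-> /eqP->].
- rewrite !memv_cap !mem_orthv // memvB ?memvD ?memvZ //=.
  rewrite !phiE // zz xx xz [phi z x]phiC // xz.
  by rewrite !mulr0 !mulr1 addr0 add0r !subrr eqxx.
Qed.

Lemma ortho_basis (r : nat) U : nondeg_on U -> \dim U = r ->
  exists e : 'I_r -> L, [/\ forall i, e i \in U,
    forall i j, phi (e i) (e j) = (i == j)%:R &
    forall u, u \in U -> u = \sum_i phi (e i) u *: e i].
Proof.
elim: r U => [|r IHr] U nU dU.
  exists (fun _ => 0); split=> [||u]; [by case|by case|].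
  move/eqP: dU; rewrite dimv_eq0 => /eqP->; rewrite memv0 => /eqP->.
  by rewrite big_ord0.
have [e0 [U' [e0U e00 nU' dU' [U'U [orth dec]]]]] := unit_split nU dU.
have [e [eU' ee ex]] := IHr _ nU' dU'.
exists (fun i => if unlift ord0 i is Some j then e j else e0); split.
- by move=> i; case: unliftP => // j _; apply: subvP (eU' j).
- move=> i j /=; case: unliftP => [i'|] ->; case: unliftP => [j'|] -> //.
  + by rewrite phiC // orth.
  + by rewrite orth.
- move=> u uU; rewrite big_ord_recl unlift_none.
  rewrite -[LHS](subrK (phi e0 u *: e0)) addrC; congr (_ + _).
  rewrite [LHS]ex ?dec //; apply: eq_bigr => i _; rewrite liftK; congr (_ *: _).
  rewrite phiDr // phiNr // phiZr // [phi (e i) e0]phiC // (orth (e i)) //.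
  by rewrite mulr0 subr0.
Qed.

(** In an orthonormal basis the matrix of the form [tri a] on [U] is also the matrix of the map that
    represents it through [phi], namely ad a projected to [U]; an eigenvector of that matrix is what
    is wanted. *)
Lemma skew_eigenvector a U : nondeg_on U -> U != 0%VS ->
  exists mu x, [/\ x \in U, x != 0 & forall u, u \in U -> tri a x u = mu * phi x u].
Proof.
move=> nU; rewrite -dimv_eq0; case dU: (\dim U) => [//|r] _.
have [e [eU ee ex]] := ortho_basis nU dU.
pose A := \matrix_(i, j) tri a (e i) (e j).
have /closed_rootP[mu]: size (char_poly A) != 1%N by rewrite size_char_poly.
rewrite -eigenvalue_root_char => /eigenvalueP[w wA w0].
pose x := \sum_i w 0 i *: e i.
have xe j : phi x (e j) = w 0 j.
  rewrite phi_suml // (bigD1 j) //= phiZl // ee eqxx mulr1 big1 ?addr0 // => i.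
  by move=> /negPf ij; rewrite phiZl // ee ij mulr0.
exists mu, x; split.
- by apply: memv_suml => i _; rewrite memvZ.
- apply: contraNneq w0 => x0; apply/eqP/rowP => j.
  by rewrite -xe x0 phi0l // mxE.
- move=> u uU; rewrite (ex u uU) tri_sumr // [in RHS]phiC // phi_suml //.
  rewrite mulr_sumr; apply: eq_bigr => j _; rewrite triZr // phiZl //.
  rewrite [phi (e j) x]phiC // xe mulrCA; congr (_ * _).
  suff -> : tri a x (e j) = (w *m A) 0 j by rewrite wA mxE.
  by rewrite mxE tri_summ //; apply: eq_bigr => i _; rewrite mxE triZm.
Qed.

(** A skew-symmetric matrix of odd size equals minus its transpose, so its determinant is its own
    opposite and vanishes outside characteristic 2. *)
Lemma skew_odd_kernel a U : nondeg_on U -> odd (\dim U) ->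
  exists x, [/\ x \in U, x != 0 & forall u, u \in U -> tri a x u = 0].
Proof.
move=> nU; move dU: (\dim U) => r odd_r.
have [e [eU ee ex]] := ortho_basis nU dU.
pose A := \matrix_(i, j) tri a (e i) (e j).
have detA : \det A = 0.
  have trA : A^T = (-1) *: A.
    by apply/matrixP => i j; rewrite !mxE mulN1r triC23.
  have := det_tr A; rewrite trA detZ -signr_odd odd_r expr1 mulN1r.
  move/eqP; rewrite eq_sym -addr_eq0 -mulr2n -mulr_natl mulf_eq0 (negPf char2).
  by move/eqP.
have /det0P[w w0 wA] : \det A == 0 by rewrite detA.
pose x := \sum_i w 0 i *: e i.
have xe j : phi x (e j) = w 0 j.
  rewrite phi_suml // (bigD1 j) //= phiZl // ee eqxx mulr1 big1 ?addr0 // => i.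
  by move=> /negPf ij; rewrite phiZl // ee ij mulr0.
exists x; split.
- by apply: memv_suml => i _; rewrite memvZ.
- apply: contraNneq w0 => x0; apply/eqP/rowP => j.
  by rewrite -xe x0 phi0l // mxE.
- move=> u uU; rewrite (ex u uU) tri_sumr // big1 // => j _; rewrite triZr //.
  suff -> : tri a x (e j) = (w *m A) 0 j by rewrite wA mxE mulr0.
  by rewrite mxE tri_summ //; apply: eq_bigr => i _; rewrite mxE triZm.
Qed.

End ClosedField.

(** * Solvability and indecomposability *)

Section Solvable.
Variables (F : fieldType) (L : quad_alg F).
Hypothesis lieL : is_lie L.
Implicit Types (x y z u v : L) (U W K : {vspace L}).

Lemma mem_derived U u v : u \in U -> v \in U -> bracket u v \in derived_alg U.
Proof. by apply: (derived_algP U (derived_alg U) lieL).2; apply: subvv. Qed.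

(* If U <= D^n + K for the n-th derived algebra D^n, then                     *)
(* [U, U] <= [D^n, D^n] + K, so U <= D^(n+1) + K.                             *)
Lemma solvable_absorb U K : solvable_lie L ->
    (forall u k, u \in U -> k \in K -> bracket u k \in K) ->
    (forall k k', k \in K -> k' \in K -> bracket k k' \in K) ->
    (U <= derived_alg U + K)%VS ->
  (U <= K)%VS.
Proof.
case=> N solN UK KK UUK.
suff le_n n : (U <= iter n (@derived_alg F L) fullv + K)%VS.
  by rewrite -(add0v K) -solN.
elim: n => [|n IHn]; first by rewrite (subv_trans (subvf U)) //= addvSl.
rewrite (subv_trans UUK) // -[X in (_ <= _ + X)%VS]addvv addvA addvS ?subvv //=.
apply/(derived_algP _ _ lieL).1 => u v uU vU.
have /memv_addP[p pP [k kK eu]] := subvP IHn u uU.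
have /memv_addP[p' pP' [k' kK' ev]] := subvP IHn v vU.
have -> : bracket u v = bracket p p' + (bracket u k' - bracket k k' - bracket v k).
  have -> : bracket v k = bracket p' k + bracket k' k by rewrite ev brDl.
  rewrite [bracket p' k]brC // [bracket k' k]brC // eu ev !(brDl, brDr) //.
  by rewrite opprD !opprK addrK !addrA.
apply: memv_add; first exact: mem_derived.
apply: memvB; last exact: UK.
by apply: memvB; [apply: UK | apply: KK].
Qed.

Lemma mem_span3 (P : L -> Prop) x y z :
  (forall u v, P u -> P v -> P (u + v)) -> (forall c u, P u -> P (c *: u)) ->
  P x -> P y -> P z -> forall u, u \in <<[:: x; y; z]>>%VS -> P u.
Proof.
move=> PD PZ Px Py Pz u; rewrite !span_cons span_nil addv0.
case/memv_addP=> _ /vlineP[a ->] [v /memv_addP[_ /vlineP[b ->]]].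
by case=> _ /vlineP[c ->] -> ->; do ![apply: PZ => // | apply: (PD)].
Qed.

(** Modulo [K] the three vectors span a copy of sl_2, which is perfect since each of them is a
    bracket divided by [c]; [solvable_absorb] then pushes their span into [K]. *)
Lemma solvable_no_sl2 K x y z (c : F) : solvable_lie L -> c != 0 ->
    (forall k k', k \in K -> k' \in K -> bracket k k' \in K) ->
    (forall k, k \in K ->
      [/\ bracket x k \in K, bracket y k \in K & bracket z k \in K]) ->
    bracket x y - c *: z \in K -> bracket y z - c *: x \in K ->
    bracket z x - c *: y \in K ->
  x \in K.
Proof.
move=> solL c0 KK UK xy yz zx; set U := <<[:: x; y; z]>>%VS.
have xU : x \in U by rewrite memv_span ?inE ?eqxx.
have yU : y \in U by rewrite memv_span ?inE ?eqxx ?orbT.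
have zU : z \in U by rewrite memv_span ?inE ?eqxx ?orbT.
suff /subvP : (U <= K)%VS by apply.
apply: solvable_absorb => // [u k uU kK | ].
  move: u uU; have [? ? ?] := UK k kK.
  apply: mem_span3 => // [u v uK vK|a u uK]; rewrite ?brDl ?brZl //.
    exact: memvD.
  exact: memvZ.
have mem w u v : u \in U -> v \in U -> bracket u v - c *: w \in K ->
    w \in (derived_alg U + K)%VS.
  move=> uU vU uvw; rewrite -(scalerK c0 w) memvZ //.
  rewrite -[c *: w](subKr (bracket u v)).
  apply: memvB; first exact/(subvP (addvSl _ _))/mem_derived.
  exact: (subvP (addvSr _ _)).
apply/subvP; apply: (mem_span3 (P := fun u => u \in (derived_alg U + K)%VS)).
- exact: memvD.
- by move=> a u; apply: memvZ.
- exact: (mem x y z).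
- exact: (mem y z x).
- exact: (mem z x y).
Qed.

End Solvable.

(** * The centre and the form modulo the centre *)

Section Center.
Variables (F : fieldType) (L : quad_alg F).
Hypothesis quadL : is_quadratic_lie L.
Implicit Types (x y z u v : L) (U W K : {vspace L}).

Let lieL : is_lie L := proj1 quadL.

(** By invariance the centre is the orthogonal of [L, L]; this description makes it a subspace by
    construction. *)
Definition centerv : {vspace L} := perp (derived_alg fullv).

Lemma mem_centerP z : reflect (central z) (z \in centerv).
Proof.
apply: (iffP (mem_perpP quadL _ _)) => [H | cz w].
  apply: (centralP quadL) => x y; rewrite -tri_cycle // /tri.
  by rewrite H // mem_derived ?memvf.
suff /subvP sub : (derived_alg fullv <= orthv z)%VS.
  by move=> /sub; rewrite mem_orthv // phiC // => /eqP.
apply/(derived_algP _ _ lieL).1 => u v _ _; rewrite mem_orthv //.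
by rewrite -phi_br // cz phi0l.
Qed.

(** Absorption with [K] = 0 shows that [L, L] is proper, and a vector orthogonal to it is
    central. *)
Lemma center_neq0 : solvable_lie L -> (0 < \dim (fullv : {vspace L}))%N ->
  exists2 z : L, z != 0 & central z.
Proof.
move=> solL dim_gt0; have [|z z0 H] := @perp_exists _ _ quadL (derived_alg fullv).
  apply: contraTneq dim_gt0 => fullD; rewrite -eqn0Ngt dimv_eq0 -subv0.
  apply: (solvable_absorb lieL solL) => [u k _|k k'|].
  - by rewrite !memv0 => /eqP->; rewrite br0r.
  - by rewrite !memv0 => /eqP-> _; rewrite br0l.
  - by rewrite addv0 fullD.
exists z => //; apply: (centralP quadL) => x y.
by rewrite /tri phi_br // H // mem_derived ?memvf.
Qed.

Lemma central_isotropic z : ~ decomposable L ->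
  (1 < \dim (fullv : {vspace L}))%N -> central z -> phi z z = 0.
Proof.
move=> indL dim_gt1 cz; have [//|zz] := eqVneq (phi z z) 0; case: indL.
have z0 : z != 0 by apply: contraNneq zz => ->; rewrite phi0l.
exists <[z]>%VS; split.
- by move=> x _ /vlineP[c ->]; rewrite brZr // centralr // scaler0 mem0v.
- by rewrite -dimv_eq0 dim_vline z0.
- by apply: contraTneq dim_gt1 => <-; rewrite dim_vline z0.
- move=> _ /vlineP[c ->] /(_ z (memv_line _)); rewrite phiZl // => /eqP.
  by rewrite mulf_eq0 (negPf zz) orbF => /eqP->; rewrite scale0r.
Qed.

Lemma phi_central z z' : (2 : F) != 0 -> (forall v : L, central v -> phi v v = 0) ->
  central z -> central z' -> phi z z' = 0.
Proof.
move=> char2 iso cz cz'; have := iso _ (centralD lieL cz cz').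
rewrite !phiE // !iso // add0r addr0 [phi z' z]phiC // -mulr2n -mulr_natl.
by move/eqP; rewrite mulf_eq0 (negPf char2) => /eqP.
Qed.

(** On an explicit list this unfolds to the separate equations [phi e e = 1] and [phi e f = 0],
    ready for destructuring; lists suit the case analyses, whereas [ortho_basis] is indexed by
    ordinals for use with matrices. *)
Fixpoint orthonormal_seq (s : seq L) : Prop :=
  if s is e :: s' then
    [/\ phi e e = 1, foldr (fun f Q => phi e f = 0 /\ Q) True s' &
        orthonormal_seq s']
  else True.

Lemma mem_span_seq (P : L -> Prop) (s : seq L) : P 0 ->
  (forall u v, P u -> P v -> P (u + v)) -> (forall c u, P u -> P (c *: u)) ->
  (forall p, p \in s -> P p) -> forall w, w \in <<s>>%VS -> P w.
Proof.
move=> P0 PD PZ; elim: s => [|p s IHs] Ps w.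
  by rewrite span_nil memv0 => /eqP->.
rewrite span_cons => /memv_addP[_ /vlineP[c ->] [v vs ->]].
apply: PD; first by apply: PZ; apply: Ps; rewrite inE eqxx.
by apply: IHs vs => q qs; apply: Ps; rewrite inE qs orbT.
Qed.

Definition spans_mod_center (s : seq L) := (fullv <= centerv + <<s>>)%VS.

(** A central argument makes [tri] vanish, so [tri] lives on the quotient by the centre, which [s]
    spans. *)
Lemma tri_span (s : seq L) v : spans_mod_center s ->
  (forall p q, p \in s -> q \in s -> tri v p q = 0) -> central v.
Proof.
move=> /subvP full_s vs; apply: (centralP quadL).
have step (P : L -> Prop) : (forall u w, P u -> P w -> P (u + w)) ->
    (forall c u, P u -> P (c *: u)) -> (forall u, central u -> P u) ->
    (forall p, p \in s -> P p) -> forall u, P u.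
  move=> PD PZ Pc Ps u; have /memv_addP[z /mem_centerP cz [w ws ->]] :=
    full_s u (memvf u).
  apply: (PD); first exact: Pc.
  apply: (mem_span_seq (P := P)) ws => //.
  by apply: (Pc) => y; apply: br0l lieL _.
have vsL p : p \in s -> forall y, tri v p y = 0.
  move=> ps; apply: step => [u w Pu Pw|c u Pu|u cu|q qs].
  - by rewrite triDr // Pu Pw addr0.
  - by rewrite triZr // Pu mulr0.
  - by rewrite (tri_central quadL cu).
  - exact: vs.
apply: step => [u w Pu Pw y|c u Pu y|u cu y|q qs].
- by rewrite triDm // Pu Pw addr0.
- by rewrite triZm // Pu mulr0.
- by rewrite (tri_central quadL cu).
- exact: vsL.
Qed.

End Center.

(** * Orthonormal and hyperbolic bases, nondegenerate ideals of small dimension *)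

Section Splitting.
Variable F : closedFieldType.
Hypothesis char2 : (2 : F) != 0.
Variables (L : quad_alg F).
Hypothesis quadL : is_quadratic_lie L.
Implicit Types (x y z u v : L) (U W K : {vspace L}).

Let lieL : is_lie L := proj1 quadL.

Lemma orthonormal_basis (r : nat) U : nondeg_on U -> \dim U = r ->
  exists s : seq L, [/\ size s = r, orthonormal_seq s & U = <<s>>%VS].
Proof.
elim: r U => [|r IHr] U nU dU.
  by exists [::]; split=> //; apply/eqP; rewrite span_nil -dimv_eq0 dU.
have [e [U' [eU ee nU' dU' [U'U [orth dec]]]]] := unit_split char2 quadL nU dU.
have [s [ss os eU']] := IHr _ nU' dU'; exists (e :: s); split => /=.
- by rewrite ss.
- split=> //; have : {subset s <= U'} by move=> f; rewrite eU'; apply: memv_span.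
  elim: s {ss os eU'} => //= f s IHs sU'; split.
    by apply: orth; apply: sU'; rewrite inE eqxx.
  by apply: IHs => g gs; apply: sU'; rewrite inE gs orbT.
- apply/vspaceP => u; rewrite span_cons -eU'; apply/idP/idP => [uU|].
    rewrite -(subrK (phi e u *: e) u) addrC memv_add ?dec //.
    by rewrite memvZ ?memv_line.
  case/memv_addP=> _ /vlineP[c ->] [w wU' ->].
  by rewrite memvD ?memvZ // (subvP U'U).
Qed.

Lemma hyperbolic_basis U : nondeg_on U -> \dim U = 2%N ->
  exists p q, [/\ phi p p = 0, phi q q = 0, phi p q = 1 & U = <<[:: p; q]>>%VS].
Proof.
move=> nU dU; have [s [ss os ->]] := orthonormal_basis nU dU.
case: s ss os => [|e1 [|e2 []]] //= _ [e11 [e12 _] [e22 _ _]].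
have [i i2] := closed_sqrt (-1 : F).
(* With [i ^+ 2 = -1] both vectors are isotropic, and their product is (1 - i^2) / 2 = 1. *)
exists (e1 + i *: e2), (2^-1 *: (e1 - i *: e2)).
pose g := (phi_sym quadL e11, phi_sym quadL e12, phi_sym quadL e22).
split.
- by rewrite !phiE // !g mulr1 mulr0 add0r addr0 -expr2 i2 subrr.
- rewrite !phiE // !g; transitivity ((2^-1) ^+ 2 * (1 + i ^+ 2)); first by ring.
  by rewrite i2 subrr mulr0.
- rewrite !phiE // !g; transitivity ((2^-1) * (1 - i ^+ 2)); first by ring.
  by rewrite i2 opprK mulVf.
have i0 : i != 0.
  apply/eqP => i0; move/eqP: i2.
  by rewrite i0 expr0n eq_sym oppr_eq0 oner_eq0.
set p := e1 + _; set q := 2^-1 *: _.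
have e1E : e1 = 2^-1 *: p + q.
  by rewrite /p /q -scalerDr addrACA subrr addr0 -mulr2n -scaler_nat scalerA
       mulVf ?scale1r.
have e2E : e2 = i^-1 *: (2^-1 *: p - q).
  rewrite /p /q -scalerBr opprD opprK addrACA subrr add0r -mulr2n -scaler_nat.
  by rewrite scalerA mulVf ?scale1r // scalerA mulVf ?scale1r.
have mem2 u v : (u \in <<[:: u; v]>>%VS) && (v \in <<[:: u; v]>>%VS).
  by rewrite !memv_span ?inE ?eqxx ?orbT.
have /andP[e1S e2S] := mem2 e1 e2; have /andP[pS qS] := mem2 p q.
apply/eqP; rewrite eqEsubv; apply/andP; split; apply/span_subvP => v;
  rewrite !inE => /orP[] /eqP ->.
- by rewrite e1E; apply: memvD => //; apply: memvZ.
- by rewrite e2E; apply: memvZ; apply: memvB => //; apply: memvZ.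
- by apply: memvD => //; apply: memvZ.
- by apply: memvZ; apply: memvB => //; apply: memvZ.
Qed.

Lemma span_expand (s : seq L) U : U = <<s>>%VS -> orthonormal_seq s ->
  forall u, u \in U -> u = \sum_(e <- s) phi e u *: e.
Proof.
move=> -> {U}; elim: s => [_ u|e s IHs /= [ee es os] u].
  by rewrite span_nil memv0 big_nil => /eqP.
rewrite span_cons big_cons => /memv_addP[_ /vlineP[c ->] [v vs ->]].
have ev : phi e v = 0.
  apply: (mem_span_seq (P := fun v => phi e v = 0)) vs.
  - exact: phi0r.
  - by move=> x y Hx Hy; rewrite phiDr // Hx Hy addr0.
  - by move=> a x Hx; rewrite phiZr // Hx mulr0.
  elim: s es {IHs os} => //= f s IHs [ef es] p; rewrite inE.
  by case/orP=> [/eqP->|/(IHs es)].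
rewrite phiDr // phiZr // ee ev mulr1 addr0; congr (_ + _).
rewrite {1}(IHs os v vs); apply: eq_big_seq => f fs; congr (_ *: _).
rewrite phiDr // phiZr // phiC // [X in _ = X + _](_ : _ = 0) ?add0r ?[phi v f]phiC //.
suff fe : phi e f = 0 by rewrite phiC // fe mulr0.
elim: s es fs {IHs os vs} => //= g s IHs [eg es]; rewrite inE.
by case/orP=> [/eqP->|/(IHs es)].
Qed.

Hypothesis solL : solvable_lie L.
Hypothesis iso : forall z : L, central z -> phi z z = 0.

(** On at most two vectors [tri] vanishes, and on three a nonzero value would make them span sl_2;
    so the ideal is abelian. An abelian nondegenerate ideal is central, and then an orthonormal
    vector in it would contradict the isotropy of the centre. *)
Lemma small_ideal (I : {vspace L}) : is_ideal I -> nondeg_on I -> (\dim I <= 3)%N -> I = 0%VS.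
Proof.
move=> idI nI dI; have [s [ss os eI]] := orthonormal_basis nI erefl.
have commute : (forall u v, u \in s -> v \in s -> bracket u v = 0) -> I = 0%VS.
  move=> comm; suff IZ e : e \in s -> central e.
    case: s ss os eI {comm} IZ => [_ _ ->|e s _ /= [ee _ _] _ IZ].
      by rewrite span_nil.
    have := iso (IZ e _); rewrite inE eqxx ee => /(_ isT) /eqP.
    by rewrite oner_eq0.
  move=> es; have eeI v : v \in I -> bracket e v = 0.
    rewrite eI; apply: (mem_span_seq (P := fun v => bracket e v = 0)) => [|u w Hu Hw|c u Hu|f fs].
    - exact: br0r.
    - by rewrite brDr // Hu Hw addr0.
    - by rewrite brZr // Hu scaler0.
    - exact: comm.
  move=> x; rewrite brC //; have eInI : e \in I by rewrite eI memv_span.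
  (* The bracket lies in the ideal and, by invariance, is orthogonal to it because [e] commutes with
     the ideal. *)
  suff -> : bracket x e = 0 by rewrite oppr0.
  apply: nI => [|v vI]; first exact: idI.
  by rewrite phi_br // eeI // phi0r.
have sI e : e \in s -> e \in I by rewrite eI; apply: memv_span.
have ex u v : u \in s -> v \in s ->
    bracket u v = \sum_(e <- s) tri u v e *: e.
  move=> us vs; rewrite (span_expand eI os (idI u v (sI v vs))).
  by apply: eq_bigr => e _; rewrite phiC.
case: s ss os eI commute sI ex => [|e1 [|e2 [|e3 [|e4 s]]]] /= ss.
- by move=> _ -> *; apply: span_nil.
- move=> _ _ comm _ ex; apply: comm => u v us vs; rewrite ex // big_seq1.
  by move: us vs; rewrite !inE => /eqP-> /eqP->; rewrite trixx // scale0r.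
- move=> _ _ comm _ ex; apply: comm => u v us vs; rewrite ex // !big_cons big_nil.
  move: us vs; rewrite !inE => /orP[] /eqP-> /orP[] /eqP->;
    by rewrite ?trixx ?trixy ?triyy // !scale0r !addr0.
- move=> [e11 [e12 [e13 _]] _] eI comm sI ex.
  have b12 := ex e1 e2; have b23 := ex e2 e3; have b31 := ex e3 e1.
  rewrite !inE !eqxx !orbT in b12 b23 b31.
  move: (b12 isT isT) (b23 isT isT) (b31 isT isT) => {b12 b23 b31}.
  rewrite !big_cons !big_nil !addr0.
  rewrite !(trixx, trixy, triyy) // !scale0r !add0r !addr0.
  move ec: (tri e1 e2 e3) => c; have c6 := tri_perm quadL ec.
  rewrite !c6 => b12 b23 b31.
  have [c0 | c0] := eqVneq c 0.
    apply: comm => u v us vs; rewrite ex // !big_cons !big_nil.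
    move: us vs; rewrite !inE => /or3P[] /eqP-> /or3P[] /eqP->;
    by rewrite ?(trixx, trixy, triyy) // ?c6 ?c0 ?oppr0 !scale0r ?addr0.
  have : e1 \in (0 : {vspace L})%VS.
    apply: (solvable_no_sl2 (x := e1) (y := e2) (z := e3) lieL solL c0).
    - by move=> k k'; rewrite !memv0 => /eqP-> _; rewrite br0l.
    - by move=> k; rewrite memv0 => /eqP->; rewrite !br0r ?memv0.
    - by rewrite b12 subrr mem0v.
    - by rewrite b23 subrr mem0v.
    - by rewrite b31 subrr mem0v.
  rewrite memv0 => /eqP e10; move: e11; rewrite e10 phi0l // => /eqP.
  by rewrite eq_sym oner_eq0.
- by move: dI; rewrite -ss.
Qed.

(* In dimension at most 7, one of I and its orthogonal has dimension at most 3. *)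
Lemma indecomposable_of_isotropic_center :
  (\dim (fullv : {vspace L}) <= 7)%N -> ~ decomposable L.
Proof.
move=> dL [I [idI I0 If nI]].
have capI : (I :&: perp I = 0)%VS.
  apply/eqP; rewrite -subv0; apply/subvP => x; rewrite memv_cap => /andP[xI].
  move=> /(mem_perpP quadL) H; rewrite memv0; apply/eqP; apply: nI => // y yI.
  by rewrite phiC // H.
have dimI := dimv_disjoint_sum capI.
have fullI : (I + perp I)%VS = fullv.
  by apply/eqP; rewrite eqEdim subvf dimI leq_dim_perp.
rewrite fullI in dimI.
have [dI|dI] := leqP (\dim I) 3; first by rewrite (small_ideal idI nI dI) eqxx in I0.
suff pI0 : perp I = 0%VS by rewrite -fullI pI0 addv0 eqxx in If.
apply: small_ideal; last by lia.
- move=> x y /(mem_perpP quadL) yI; apply/(mem_perpP quadL) => w wI.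
  rewrite -phi_br // [bracket w x]brC // phiNl // phiC // -phiNr //.
  by rewrite phiC // yI // memvN idI.
- move=> x xpI x0; apply: (phi_eq0 quadL) => y.
  have /memv_addP[u uI [w wpI ->]] : y \in (I + perp I)%VS by rewrite fullI memvf.
  by rewrite phiDr // (x0 w wpI) addr0 phiC //; apply: (mem_perpP quadL _ _ xpI).
Qed.

End Splitting.

(** * The listed algebras *)

Arguments bracket : simpl never.
Arguments phi : simpl never.

Section TableAlgebra.
Variables (F : fieldType) (n : nat) (tab : seq ('I_n * 'I_n * 'rV[F]_n)).
Variable q : ('I_n -> F) -> F.
Let M := table_alg tab q.

Lemma table_is_lie :
  (forall x y z : M, bracket x (bracket y z) + bracket y (bracket z x)
                     + bracket z (bracket x y) = 0) ->
  is_lie M.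
Proof.
split=> //; last first.
  by move=> x; apply: big1 => t _; rewrite mulrC subrr scale0r.
split=> u c x y; rewrite /bracket /= scaler_sumr -big_split;
  by apply: eq_bigr => t _; rewrite /= !mxE scalerA -scalerDl; congr (_ *: _); ring.
Qed.

(** [s] is the basis dual to the standard one with respect to [phi]. *)
Lemma table_nondeg (s : seq 'rV[F]_n) :
  (forall (x : M) (i : 'I_n), phi x (s`_i : M) = (x : 'rV_n) 0 i) ->
  nondeg_on (fullv : {vspace M}).
Proof.
move=> dual x _ x0; apply/rowP => i.
by rewrite -dual x0 ?memvf // mxE.
Qed.

Definition vanish (S : seq 'I_n) (u : 'rV[F]_n) : Prop :=
  foldr (fun k P => u 0 k = 0 /\ P) True S.

Lemma vanish_lin S c (u v : 'rV[F]_n) :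
  vanish S u -> vanish S v -> vanish S (c *: u + v).
Proof.
elim: S => //= k S IHS [uk uS] [vk vS]; split; last exact: IHS.
by rewrite !mxE uk vk mulr0 addr0.
Qed.

Lemma vanish0 S : vanish S 0.
Proof. by elim: S => //= k S IHS; rewrite mxE. Qed.

(** The first and second derived algebras are bounded by coordinate subspaces, given by the
    coordinates [S1] and [S2] that vanish on them; the third derived algebra is then zero, a length
    that suffices for the whole list. *)
Lemma table_solvable (S1 S2 : seq 'I_n) :
    (forall u v : M, vanish S1 (bracket u v)) ->
    (forall u v : M, vanish S1 u -> vanish S1 v -> vanish S2 (bracket u v)) ->
    (forall u v : M, vanish S2 u -> vanish S2 v -> bracket u v = 0) ->
  solvable_lie M.
Proof.
have derived_ind (S : seq 'I_n) (U : {vspace M}) :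
    (forall u v, u \in U -> v \in U -> vanish S (bracket u v)) ->
    forall w, w \in derived_alg U -> vanish S w.
  move=> Sbr; apply: mem_span_seq => [|u v Su Sv|c u Su|p].
  - exact: vanish0.
  - by rewrite -[u]scale1r; apply: vanish_lin.
  - by rewrite -[_ *: _]addr0; apply: vanish_lin; last apply: vanish0.
  - case/allpairsP => -[u v] [/= uU vU ->].
    by apply: Sbr; apply: vbasis_mem.
move=> H1 H2 H3; exists 3%N; apply/eqP; rewrite -subv0; apply/span_subvP => p.
case/allpairsP => -[u v] [/= uU vU ->]; rewrite memv0; apply/eqP.
have D1 := derived_ind S1 fullv (fun u v _ _ => H1 u v).
have D2 := derived_ind S2 _ (fun u v uU vU => H2 u v (D1 u uU) (D1 v vU)).
by apply: H3; apply: D2; apply: vbasis_mem.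
Qed.

End TableAlgebra.

Ltac ord_cases i :=
  let H := fresh "H" in
  case: i => [[|[|[|[|[|[|[|i]]]]]]] H] //=; rewrite ?(bool_irrelevance H isT).

Ltac prove_bracket i :=
  rewrite /bracket /= ?big_cons ?big_nil !mxE /=; ord_cases i; ring.

Ltac prove_quadratic brE phE dual :=
  let x := fresh "x" in let y := fresh "y" in let z := fresh "z" in
  let i := fresh "i" in let c := fresh "c" in let u := fresh "u" in
  split;
  [ apply: table_is_lie => x y z; apply/rowP => i; rewrite mxE mxE [RHS]mxE;
    rewrite (brE x (bracket y z)) (brE y (bracket z x)) (brE z (bracket x y));
    ord_cases i; rewrite ?(brE x y) ?(brE y z) ?(brE z x) /=; ring
  | split;
    [ split=> u c x y; rewrite /= !phE // !mxE; ring
    | move=> x y; rewrite !phE //; ring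
    | apply: (table_nondeg (s := dual)) => x i; rewrite phE //;
      ord_cases i; rewrite !mxE /=; ring
    | move=> x y z; rewrite !phE // ?(brE x y) ?(brE y z) /=; ring ] ].


(** The 3 x 3 minor in columns i, j, k, that is, the wedge of three coordinate forms. The trilinear
    form of each listed algebra of dimension at least 4 is a combination of at most three of
    them. *)
Definition minor3 (F : fieldType) n (u v w : 'rV[F]_n) (i j k : 'I_n) : F :=
  u 0 i * (v 0 j * w 0 k - v 0 k * w 0 j)
  - u 0 j * (v 0 i * w 0 k - v 0 k * w 0 i)
  + u 0 k * (v 0 i * w 0 j - v 0 j * w 0 i).

Lemma minor3_delta (F : fieldType) n (i j k a b c : 'I_n) :
  (i < j)%N -> (j < k)%N -> (a < b)%N -> (b < c)%N ->
  minor3 'e_i 'e_j 'e_k a b c = ([&& a == i, b == j & c == k])%:R :> F.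
Proof.
move=> ij jk ab bc; have neq (x y : 'I_n) : (x < y)%N -> (x == y) = false.
  by move=> xy; apply/eqP => e; rewrite e ltnn in xy.
rewrite /minor3 !mxE !eqxx /=; have [ai|ai] := eqVneq a i.
  subst a; rewrite (neq i j) // (neq i k) ?(ltn_trans ij) // ![_ == i]eq_sym.
  rewrite (neq i b) // (neq i c) ?(ltn_trans ab) //.
  have [bk|_] := eqVneq b k; last by case: (b == j); case: (c == k); rewrite /=; ring.
  subst b; rewrite [c == j]eq_sym [c == k]eq_sym (neq k c) // (neq j c) ?(ltn_trans jk) //.
  by rewrite andbF /=; ring.
have [bi|bi] := eqVneq b i.
  subst b; rewrite (neq a j) ?(ltn_trans ab) // (neq a k) ?(ltn_trans ab) ?(ltn_trans ij) //.
  by rewrite /=; ring.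
have [ci|ci] := eqVneq c i; last by rewrite /=; ring.
subst c; have ai' := ltn_trans ab bc.
rewrite (neq a j) ?(ltn_trans ai') // (neq a k) ?(ltn_trans ai') ?(ltn_trans ij) //.
by rewrite /=; ring.
Qed.

Ltac rewrite_zeros :=
  repeat match goal with
  | H : _ /\ _ |- _ => destruct H
  | H : _ = 0 |- _ => rewrite ?H; clear H
  end.

Ltac prove_solvable br S1 S2 :=
  let u := fresh "u" in let v := fresh "v" in
  let hu := fresh "hu" in let hv := fresh "hv" in let i := fresh "i" in
  apply: (table_solvable (S1 := S1) (S2 := S2)) => u v;
  [ by rewrite /= ?(br u v) /=; do !split; ring
  | by move=> /= hu hv; rewrite ?(br u v) /=; rewrite_zeros; do !split; ring
  | by move=> /= hu hv; apply/rowP => i; rewrite (br u v) mxE; ord_cases i;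
      rewrite_zeros; ring ].

(* A coordinate of a central x is read off as c [x, v]_k. *)
Ltac central_coord br cx c v k :=
  let E := fresh "E" in
  move: (congr1 (fun w => fun_of_matrix w 0 k) (cx v)); rewrite (br _ v) !mxE /= => E;
  match type of E with ?l = _ =>
    transitivity (c * l); [ by field | by rewrite E mulr0 ] end.

(** * Axioms, solvability and centres of the algebras of dimension 4 to 7 *)

Section Dim4.
Variable F : fieldType.
Hypothesis char2 : (2 : F) != 0.

Local Notation o k := (@Ordinal 4 k isT).
Local Notation "u .| k" := (u 0 (o k)) (at level 2, format "u .| k").
Local Notation e k := ('e_(o k)).

Lemma br_r41 (u v : 'rV[F]_4) i :
  (@bracket F (r41 F) u v : 'rV_4) 0 i = nth 0 [::
    0; (u.|0 * v.|1 - u.|1 * v.|0); -(u.|0 * v.|2 - u.|2 * v.|0);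
    (u.|1 * v.|2 - u.|2 * v.|1)] i.
Proof. prove_bracket i. Qed.

Lemma phi_r41 (u v : 'rV[F]_4) : @phi F (r41 F) u v =
  (u.|0 * v.|3 + u.|3 * v.|0) + (u.|1 * v.|2 + u.|2 * v.|1).
Proof. by rewrite /phi /= !mxE; field. Qed.

Lemma tri_r41 (u v w : 'rV[F]_4) : @tri F (r41 F) u v w =
  minor3 u v w (o 0) (o 1) (o 2).
Proof.
by rewrite /minor3 /tri phi_r41 !(br_r41 u v) /=; ring.
Qed.

Lemma quad_r41 : is_quadratic_lie (r41 F).
Proof.
prove_quadratic br_r41 phi_r41
  [:: e 3; e 2; e 1; e 0 : 'rV[F]_4].
Qed.

Lemma solvable_r41 : solvable_lie (r41 F).
Proof.
prove_solvable br_r41 [:: o 0]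
  [:: o 0; o 1; o 2].
Qed.

Lemma central_r41 (x : 'rV[F]_4) :
  @central F (r41 F) x -> vanish [:: o 0; o 1; o 2] x.
Proof.
move=> cx; repeat split.
- central_coord br_r41 cx (1 : F) (e 1 : r41 F) (o 1).
- central_coord br_r41 cx (-1 : F) (e 0 : r41 F) (o 1).
- central_coord br_r41 cx (1 : F) (e 0 : r41 F) (o 2).
Qed.

Lemma isotropic_r41 (x : r41 F) : central x -> phi x x = 0.
Proof.
move/central_r41; rewrite /vanish phi_r41 //= => H.
by rewrite_zeros; ring.
Qed.

End Dim4.

Section Dim5.
Variable F : fieldType.
Hypothesis char2 : (2 : F) != 0.

Local Notation o k := (@Ordinal 5 k isT).
Local Notation "u .| k" := (u 0 (o k)) (at level 2, format "u .| k").
Local Notation e k := ('e_(o k)).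

Lemma br_r5 (u v : 'rV[F]_5) i :
  (@bracket F (r5 F) u v : 'rV_5) 0 i = nth 0 [::
    0; 0; (u.|0 * v.|1 - u.|1 * v.|0); (u.|0 * v.|2 - u.|2 * v.|0);
    (u.|1 * v.|2 - u.|2 * v.|1)] i.
Proof. prove_bracket i. Qed.

Lemma phi_r5 (u v : 'rV[F]_5) : @phi F (r5 F) u v =
  (u.|0 * v.|4 + u.|4 * v.|0) - (u.|1 * v.|3 + u.|3 * v.|1) + u.|2 * v.|2.
Proof. by rewrite /phi /= !mxE; field. Qed.

Lemma tri_r5 (u v w : 'rV[F]_5) : @tri F (r5 F) u v w =
  minor3 u v w (o 0) (o 1) (o 2).
Proof.
by rewrite /minor3 /tri phi_r5 !(br_r5 u v) /=; ring.
Qed.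

Lemma quad_r5 : is_quadratic_lie (r5 F).
Proof.
prove_quadratic br_r5 phi_r5
  [:: e 4; - e 3; e 2; - e 1; e 0 : 'rV[F]_5].
Qed.

Lemma solvable_r5 : solvable_lie (r5 F).
Proof.
prove_solvable br_r5 [:: o 0; o 1]
  [:: o 0; o 1].
Qed.

Lemma central_r5 (x : 'rV[F]_5) :
  @central F (r5 F) x -> vanish [:: o 0; o 1; o 2] x.
Proof.
move=> cx; repeat split.
- central_coord br_r5 cx (1 : F) (e 1 : r5 F) (o 2).
- central_coord br_r5 cx (-1 : F) (e 0 : r5 F) (o 2).
- central_coord br_r5 cx (-1 : F) (e 0 : r5 F) (o 3).
Qed.

Lemma isotropic_r5 (x : r5 F) : central x -> phi x x = 0.
Proof.
move/central_r5; rewrite /vanish phi_r5 //= => H.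
by rewrite_zeros; ring.
Qed.

End Dim5.

Section Dim6.
Variable F : fieldType.
Hypothesis char2 : (2 : F) != 0.

Local Notation o k := (@Ordinal 6 k isT).
Local Notation "u .| k" := (u 0 (o k)) (at level 2, format "u .| k").
Local Notation e k := ('e_(o k)).

Lemma br_r61 (u v : 'rV[F]_6) i :
  (@bracket F (r61 F) u v : 'rV_6) 0 i = nth 0 [::
    0; 0; (u.|0 * v.|1 - u.|1 * v.|0); 0; - (u.|0 * v.|3 - u.|3 * v.|0);
    (u.|1 * v.|3 - u.|3 * v.|1)] i.
Proof. prove_bracket i. Qed.

Lemma phi_r61 (u v : 'rV[F]_6) : @phi F (r61 F) u v =
  (u.|0 * v.|5 + u.|5 * v.|0) + (u.|1 * v.|4 + u.|4 * v.|1) + (u.|2 * v.|3 +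
  u.|3 * v.|2).
Proof. by rewrite /phi /= !mxE; field. Qed.

Lemma tri_r61 (u v w : 'rV[F]_6) : @tri F (r61 F) u v w =
  minor3 u v w (o 0) (o 1) (o 3).
Proof.
by rewrite /minor3 /tri phi_r61 !(br_r61 u v) /=; ring.
Qed.

Lemma quad_r61 : is_quadratic_lie (r61 F).
Proof.
prove_quadratic br_r61 phi_r61
  [:: e 5; e 4; e 3; e 2; e 1; e 0 : 'rV[F]_6].
Qed.

Lemma solvable_r61 : solvable_lie (r61 F).
Proof.
prove_solvable br_r61 [:: o 0]
  [:: o 0; o 1; o 2; o 3; o 4].
Qed.

Lemma central_r61 (x : 'rV[F]_6) :
  @central F (r61 F) x -> vanish [:: o 0; o 1; o 3] x.
Proof.
move=> cx; repeat split.
- central_coord br_r61 cx (1 : F) (e 1 : r61 F) (o 2).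
- central_coord br_r61 cx (-1 : F) (e 0 : r61 F) (o 2).
- central_coord br_r61 cx (1 : F) (e 0 : r61 F) (o 4).
Qed.

Lemma isotropic_r61 (x : r61 F) : central x -> phi x x = 0.
Proof.
move/central_r61; rewrite /vanish phi_r61 //= => H.
by rewrite_zeros; ring.
Qed.

Lemma br_r62 (lam : F) (u v : 'rV[F]_6) i :
  (@bracket F (r62 lam) u v : 'rV_6) 0 i = nth 0 [::
    0; (u.|0 * v.|1 - u.|1 * v.|0); - (u.|0 * v.|2 - u.|2 * v.|0);
    lam * (u.|0 * v.|3 - u.|3 * v.|0);
    - (lam * (u.|0 * v.|4 - u.|4 * v.|0));
    (u.|1 * v.|2 - u.|2 * v.|1) + lam * (u.|3 * v.|4 - u.|4 * v.|3)] i.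
Proof. prove_bracket i. Qed.

Lemma phi_r62 (lam : F) (u v : 'rV[F]_6) : @phi F (r62 lam) u v =
  (u.|0 * v.|5 + u.|5 * v.|0) + (u.|1 * v.|2 + u.|2 * v.|1) + (u.|3 * v.|4 +
  u.|4 * v.|3).
Proof. by rewrite /phi /= !mxE; field. Qed.

Lemma tri_r62 (lam : F) (u v w : 'rV[F]_6) : @tri F (r62 lam) u v w =
  minor3 u v w (o 0) (o 1) (o 2) + lam * minor3 u v w (o 0) (o 3) (o 4).
Proof.
by rewrite /minor3 /tri phi_r62 !(br_r62 lam u v) /=; ring.
Qed.

Lemma quad_r62 (lam : F): is_quadratic_lie (r62 lam).
Proof.
prove_quadratic (br_r62 lam) (phi_r62 lam)
  [:: e 5; e 2; e 1; e 4; e 3; e 0 : 'rV[F]_6].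
Qed.

Lemma solvable_r62 (lam : F): solvable_lie (r62 lam).
Proof.
prove_solvable (br_r62 lam) [:: o 0]
  [:: o 0; o 1; o 2; o 3; o 4].
Qed.

Lemma central_r62 (lam : F) (x : 'rV[F]_6) : lam != 0 ->
  @central F (r62 lam) x -> vanish [:: o 0; o 1; o 2; o 3; o 4] x.
Proof.
move=> lam0; move=> cx; repeat split.
- central_coord (br_r62 lam) cx (1 : F) (e 1 : r62 lam) (o 1).
- central_coord (br_r62 lam) cx (-1 : F) (e 0 : r62 lam) (o 1).
- central_coord (br_r62 lam) cx (1 : F) (e 0 : r62 lam) (o 2).
- central_coord (br_r62 lam) cx (- lam^-1 : F) (e 0 : r62 lam) (o 3).
- central_coord (br_r62 lam) cx (lam^-1 : F) (e 0 : r62 lam) (o 4).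
Qed.

Lemma isotropic_r62 (lam : F) (x : r62 lam) : lam != 0 -> central x -> phi x x = 0.
Proof.
move=> lam0; move/central_r62; rewrite /vanish phi_r62 //= => /(_ lam0) => H.
by rewrite_zeros; ring.
Qed.

Lemma br_r63 (u v : 'rV[F]_6) i :
  (@bracket F (r63 F) u v : 'rV_6) 0 i = nth 0 [::
    0; (u.|0 * v.|1 - u.|1 * v.|0);
    (u.|0 * v.|1 - u.|1 * v.|0) + (u.|0 * v.|2 - u.|2 * v.|0);
    - (u.|0 * v.|3 - u.|3 * v.|0);
    - (u.|0 * v.|3 - u.|3 * v.|0) - (u.|0 * v.|4 - u.|4 * v.|0);
    (u.|1 * v.|3 - u.|3 * v.|1) + (u.|1 * v.|4 - u.|4 * v.|1) + (u.|2 * v.|3 - u.|3 * v.|2)] i.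
Proof. prove_bracket i. Qed.

Lemma phi_r63 (u v : 'rV[F]_6) : @phi F (r63 F) u v =
  (u.|0 * v.|5 + u.|5 * v.|0) + (u.|1 * v.|4 + u.|4 * v.|1) + (u.|2 * v.|3 +
  u.|3 * v.|2).
Proof. by rewrite /phi /= !mxE; field. Qed.

Lemma tri_r63 (u v w : 'rV[F]_6) : @tri F (r63 F) u v w =
  minor3 u v w (o 0) (o 1) (o 3) + minor3 u v w (o 0) (o 1) (o 4)
  + minor3 u v w (o 0) (o 2) (o 3).
Proof.
by rewrite /minor3 /tri phi_r63 !(br_r63 u v) /=; ring.
Qed.

Lemma quad_r63 : is_quadratic_lie (r63 F).
Proof.
prove_quadratic br_r63 phi_r63
  [:: e 5; e 4; e 3; e 2; e 1; e 0 : 'rV[F]_6].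
Qed.

Lemma solvable_r63 : solvable_lie (r63 F).
Proof.
prove_solvable br_r63 [:: o 0]
  [:: o 0; o 1; o 2; o 3; o 4].
Qed.

Lemma central_r63 (x : 'rV[F]_6) :
  @central F (r63 F) x -> vanish [:: o 0; o 1; o 2; o 3; o 4] x.
Proof.
move=> cx; repeat split.
- central_coord br_r63 cx (1 : F) (e 1 : r63 F) (o 1).
- central_coord br_r63 cx (-1 : F) (e 0 : r63 F) (o 1).
(* Bracketing with [e 3] alone gives the sum of coordinates 1 and 2 of [x]; subtracting [e 4]
   cancels coordinate 1. The vector [e 1 - e 2] below plays the same role for coordinate 4. *)
- central_coord br_r63 cx (1 : F) (e 3 - e 4 : r63 F) (o 5).
- central_coord br_r63 cx (1 : F) (e 0 : r63 F) (o 3).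
- central_coord br_r63 cx (-1 : F) (e 1 - e 2 : r63 F) (o 5).
Qed.

Lemma isotropic_r63 (x : r63 F) : central x -> phi x x = 0.
Proof.
move/central_r63; rewrite /vanish phi_r63 //= => H.
by rewrite_zeros; ring.
Qed.

End Dim6.

Section Dim7.
Variable F : fieldType.
Hypothesis char2 : (2 : F) != 0.

Local Notation o k := (@Ordinal 7 k isT).
Local Notation "u .| k" := (u 0 (o k)) (at level 2, format "u .| k").
Local Notation e k := ('e_(o k)).

Lemma br_r71 (u v : 'rV[F]_7) i :
  (@bracket F (r71 F) u v : 'rV_7) 0 i = nth 0 [::
    0; 0; (u.|0 * v.|1 - u.|1 * v.|0); (u.|0 * v.|2 - u.|2 * v.|0);
    (u.|0 * v.|3 - u.|3 * v.|0); (u.|0 * v.|4 - u.|4 * v.|0);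
    (u.|1 * v.|4 - u.|4 * v.|1) - (u.|2 * v.|3 - u.|3 * v.|2)] i.
Proof. prove_bracket i. Qed.

Lemma phi_r71 (u v : 'rV[F]_7) : @phi F (r71 F) u v =
  (u.|0 * v.|6 + u.|6 * v.|0) - (u.|1 * v.|5 + u.|5 * v.|1) + (u.|2 * v.|4 +
  u.|4 * v.|2) - u.|3 * v.|3.
Proof. by rewrite /phi /= !mxE; field. Qed.

Lemma tri_r71 (u v w : 'rV[F]_7) : @tri F (r71 F) u v w =
  minor3 u v w (o 0) (o 1) (o 4) - minor3 u v w (o 0) (o 2) (o 3).
Proof.
by rewrite /minor3 /tri phi_r71 !(br_r71 u v) /=; ring.
Qed.

Lemma quad_r71 : is_quadratic_lie (r71 F).
Proof.
prove_quadratic br_r71 phi_r71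
  [:: e 6; - e 5; e 4; - e 3; e 2; - e 1; e 0 : 'rV[F]_7].
Qed.

Lemma solvable_r71 : solvable_lie (r71 F).
Proof.
prove_solvable br_r71 [:: o 0]
  [:: o 0; o 1; o 2; o 3; o 4; o 5].
Qed.

Lemma central_r71 (x : 'rV[F]_7) :
  @central F (r71 F) x -> vanish [:: o 0; o 1; o 2; o 3; o 4] x.
Proof.
move=> cx; repeat split.
- central_coord br_r71 cx (1 : F) (e 1 : r71 F) (o 2).
- central_coord br_r71 cx (-1 : F) (e 0 : r71 F) (o 2).
- central_coord br_r71 cx (-1 : F) (e 0 : r71 F) (o 3).
- central_coord br_r71 cx (-1 : F) (e 0 : r71 F) (o 4).
- central_coord br_r71 cx (-1 : F) (e 0 : r71 F) (o 5).
Qed.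

Lemma isotropic_r71 (x : r71 F) : central x -> phi x x = 0.
Proof.
move/central_r71; rewrite /vanish phi_r71 //= => H.
by rewrite_zeros; ring.
Qed.

Lemma br_r72 (u v : 'rV[F]_7) i :
  (@bracket F (r72 F) u v : 'rV_7) 0 i = nth 0 [::
    0; (u.|0 * v.|1 - u.|1 * v.|0); - (u.|0 * v.|2 - u.|2 * v.|0); 0;
    (u.|0 * v.|3 - u.|3 * v.|0); (u.|0 * v.|4 - u.|4 * v.|0);
    (u.|1 * v.|2 - u.|2 * v.|1) + (u.|3 * v.|4 - u.|4 * v.|3)] i.
Proof. prove_bracket i. Qed.

Lemma phi_r72 (u v : 'rV[F]_7) : @phi F (r72 F) u v =
  (u.|0 * v.|6 + u.|6 * v.|0) + (u.|1 * v.|2 + u.|2 * v.|1) - (u.|3 * v.|5 +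
  u.|5 * v.|3) + u.|4 * v.|4.
Proof. by rewrite /phi /= !mxE; field. Qed.

Lemma tri_r72 (u v w : 'rV[F]_7) : @tri F (r72 F) u v w =
  minor3 u v w (o 0) (o 1) (o 2) + minor3 u v w (o 0) (o 3) (o 4).
Proof.
by rewrite /minor3 /tri phi_r72 !(br_r72 u v) /=; ring.
Qed.

Lemma quad_r72 : is_quadratic_lie (r72 F).
Proof.
prove_quadratic br_r72 phi_r72
  [:: e 6; e 2; e 1; - e 5; e 4; - e 3; e 0 : 'rV[F]_7].
Qed.

Lemma solvable_r72 : solvable_lie (r72 F).
Proof.
prove_solvable br_r72 [:: o 0]
  [:: o 0; o 1; o 2; o 3; o 4; o 5].
Qed.

Lemma central_r72 (x : 'rV[F]_7) :
  @central F (r72 F) x -> vanish [:: o 0; o 1; o 2; o 3; o 4] x.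
Proof.
move=> cx; repeat split.
- central_coord br_r72 cx (1 : F) (e 1 : r72 F) (o 1).
- central_coord br_r72 cx (-1 : F) (e 0 : r72 F) (o 1).
- central_coord br_r72 cx (1 : F) (e 0 : r72 F) (o 2).
- central_coord br_r72 cx (-1 : F) (e 0 : r72 F) (o 4).
- central_coord br_r72 cx (-1 : F) (e 0 : r72 F) (o 5).
Qed.

Lemma isotropic_r72 (x : r72 F) : central x -> phi x x = 0.
Proof.
move/central_r72; rewrite /vanish phi_r72 //= => H.
by rewrite_zeros; ring.
Qed.

Lemma br_r75 (u v : 'rV[F]_7) i :
  (@bracket F (r75 F) u v : 'rV_7) 0 i = nth 0 [::
    0; (u.|0 * v.|1 - u.|1 * v.|0); - (u.|0 * v.|2 - u.|2 * v.|0);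
    (u.|1 * v.|2 - u.|2 * v.|1);
    (u.|0 * v.|4 - u.|4 * v.|0) + (u.|1 * v.|3 - u.|3 * v.|1);
    - (u.|0 * v.|5 - u.|5 * v.|0) + (u.|2 * v.|3 - u.|3 * v.|2);
    - (u.|1 * v.|5 - u.|5 * v.|1) - (u.|2 * v.|4 - u.|4 * v.|2)] i.
Proof. prove_bracket i. Qed.

Lemma phi_r75 (u v : 'rV[F]_7) : @phi F (r75 F) u v =
  - (u.|0 * v.|6 + u.|6 * v.|0) + (u.|1 * v.|5 + u.|5 * v.|1) - (u.|2 * v.|4
  + u.|4 * v.|2) + u.|3 * v.|3.
Proof. by rewrite /phi /= !mxE; field. Qed.

Lemma tri_r75 (u v w : 'rV[F]_7) : @tri F (r75 F) u v w =
  minor3 u v w (o 0) (o 1) (o 5) + minor3 u v w (o 0) (o 2) (o 4)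
  + minor3 u v w (o 1) (o 2) (o 3).
Proof.
by rewrite /minor3 /tri phi_r75 !(br_r75 u v) /=; ring.
Qed.

Lemma quad_r75 : is_quadratic_lie (r75 F).
Proof.
prove_quadratic br_r75 phi_r75
  [:: - e 6; e 5; - e 4; e 3; - e 2; e 1; - e 0 : 'rV[F]_7].
Qed.

Lemma solvable_r75 : solvable_lie (r75 F).
Proof.
prove_solvable br_r75 [:: o 0]
  [:: o 0; o 1; o 2].
Qed.

Lemma central_r75 (x : 'rV[F]_7) :
  @central F (r75 F) x -> vanish [:: o 0; o 1; o 2; o 3; o 4; o 5] x.
Proof.
move=> cx; repeat split.
- central_coord br_r75 cx (1 : F) (e 1 : r75 F) (o 1).
- central_coord br_r75 cx (-1 : F) (e 0 : r75 F) (o 1).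
- central_coord br_r75 cx (1 : F) (e 0 : r75 F) (o 2).
- central_coord br_r75 cx (-1 : F) (e 1 : r75 F) (o 4).
- central_coord br_r75 cx (-1 : F) (e 0 : r75 F) (o 4).
- central_coord br_r75 cx (1 : F) (e 0 : r75 F) (o 5).
Qed.

Lemma isotropic_r75 (x : r75 F) : central x -> phi x x = 0.
Proof.
move/central_r75; rewrite /vanish phi_r75 //= => H.
by rewrite_zeros; ring.
Qed.

End Dim7.

(** * Non-isomorphism *)

Section Invariants.
Variable F : fieldType.
Implicit Types A B : quad_alg F.

(** The centre has dimension at most 1. This singles out r75 in dimension 7 and separates r61 from
    r62 and r63. The next two invariants separate r72 from the nilpotent r71, and r62 from r63. *)
Definition central_line A := forall x y : A,
  central x -> central y -> x != 0 -> exists c, y = c *: x.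
Definition has_eigenvalue1 A := exists u v : A, v != 0 /\ bracket u v = v.
Definition noncommuting_eigenvectors A := exists (u v w : A) (b c : F),
  [/\ b != 0, c != 0, bracket u v = b *: v, bracket u w = c *: w
    & bracket v w != 0].

Lemma iso_dim A B : isometric_iso A B ->
  \dim (fullv : {vspace A}) = \dim (fullv : {vspace B}).
Proof.
case=> f [[g fK gK] _ _].
have kerf : (fullv :&: lker (linfun f))%VS = 0%VS.
  apply/eqP; rewrite capfv; apply/lker0P => x y; rewrite !lfunE.
  exact: (can_inj fK).
rewrite -(limg_dim_eq kerf); congr (\dim _); apply/vspaceP => y.
by rewrite memvf; apply/memv_imgP; exists (g y); rewrite ?memvf // lfunE /= gK.
Qed.

Lemma iso_central A B (f : A -> B) (z : A) : bijective f ->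
  (forall x y, f (bracket x y) = bracket (f x) (f y)) -> f 0 = 0 ->
  central z -> central (f z).
Proof. by case=> g fK gK fbr f0 cz y; rewrite -[y]gK -fbr cz. Qed.

Lemma central_line_iso A B : isometric_iso A B ->
  central_line B -> central_line A.
Proof.
case=> f [bij_f fbr _] lineB x y cx cy x0; have f0 := linear0 f.
have [|||c fy] := lineB (f x) (f y); try exact: iso_central.
  by apply: contraNneq x0 => fx0; apply/eqP/(bij_inj bij_f); rewrite fx0 f0.
by exists c; apply: (bij_inj bij_f); rewrite fy linearZ.
Qed.

Lemma has_eigenvalue1_iso A B : isometric_iso A B ->
  has_eigenvalue1 A -> has_eigenvalue1 B.
Proof.
case=> f [bij_f fbr _] [u [v [v0 uv]]]; exists (f u), (f v); rewrite -fbr uv.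
split=> //; apply: contraNneq v0 => fv0; apply/eqP/(bij_inj bij_f).
by rewrite fv0 linear0.
Qed.

Lemma noncommuting_eigenvectors_iso A B : isometric_iso A B ->
  noncommuting_eigenvectors A -> noncommuting_eigenvectors B.
Proof.
case=> f [bij_f fbr _] [u [v [w [b [c [b0 c0 uv uw vw]]]]]].
exists (f u), (f v), (f w), b, c; split=> //; rewrite -fbr ?uv ?uw ?linearZ //.
apply: contraNneq vw => fvw0; apply/eqP/(bij_inj bij_f).
by rewrite fvw0 linear0.
Qed.

End Invariants.

(** * Telling the algebras of dimension 6 apart *)

Section Dim6Invariants.
Variable F : fieldType.
Hypothesis char2 : (2 : F) != 0.

Local Notation o k := (@Ordinal 6 k isT).
Local Notation "u .| k" := (u 0 (o k)) (at level 2, format "u .| k").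
Local Notation e k := ('e_(o k) : 'rV[F]_6).

Lemma vanish_line6 (u : 'rV[F]_6) : vanish [:: o 0; o 1; o 2; o 3; o 4] u ->
  u = u.|5 *: e 5.
Proof.
rewrite /vanish /= => H; apply/rowP => i; rewrite !mxE.
by ord_cases i; rewrite_zeros; ring.
Qed.

Lemma central_line_r62 (lam : F) : lam != 0 -> central_line (r62 lam).
Proof.
move=> lam0 x y /(central_r62 lam0) /vanish_line6 ex.
move=> /(central_r62 lam0) /vanish_line6 ey x0.
have x5 : x.|5 != 0 by apply: contraNneq x0 => x5; rewrite ex x5 scale0r.
by exists (y.|5 / x.|5); rewrite [LHS]ey {2}ex scalerA divfK.
Qed.

Lemma central_line_r63 : central_line (r63 F).
Proof.
move=> x y /central_r63 /vanish_line6 ex /central_r63 /vanish_line6 ey x0.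
have x5 : x.|5 != 0 by apply: contraNneq x0 => x5; rewrite ex x5 scale0r.
by exists (y.|5 / x.|5); rewrite [LHS]ey {2}ex scalerA divfK.
Qed.

Lemma not_central_line_r61 : ~ central_line (r61 F).
Proof.
move=> /(_ (e 2) (e 4)) [x|x||c].
- by apply/rowP => i; rewrite (br_r61 (e 2) x); ord_cases i; rewrite !mxE /=; ring.
- by apply/rowP => i; rewrite (br_r61 (e 4) x); ord_cases i; rewrite !mxE /=; ring.
- by apply/eqP => /rowP /(_ (o 2)) /eqP; rewrite !mxE /= oner_eq0.
- by move=> /rowP /(_ (o 4)) /eqP; rewrite !mxE /= mulr0 oner_eq0.
Qed.

Lemma noncommuting_eigenvectors_r62 (lam : F) :
  noncommuting_eigenvectors (r62 lam).
Proof.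
exists (e 0 : r62 lam), (e 1 : r62 lam), (e 2 : r62 lam), 1, (-1).
rewrite oppr_eq0 oner_neq0; split=> //.
- by apply/rowP => i; rewrite (br_r62 lam (e 0) (e 1)); ord_cases i; rewrite !mxE /=; ring.
- by apply/rowP => i; rewrite (br_r62 lam (e 0) (e 2)); ord_cases i; rewrite !mxE /=; ring.
apply/eqP => /rowP /(_ (o 5)); rewrite (br_r62 lam (e 1) (e 2)) !mxE /= => /eqP.
rewrite !(mulr0, mulr1, subr0, addr0); exact/negP/oner_neq0.
Qed.

(** The nonzero eigenvalues of ad a are 1 and -1, each with one Jordan block of size 2. An
    eigenvector therefore lies in the span of x_2, y_2 and z, on which all brackets vanish. *)
Lemma eigenvector_r63 (u v : 'rV[F]_6) (b : F) : b != 0 ->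
  @bracket F (r63 F) u v = b *: v -> [/\ v.|0 = 0, v.|1 = 0 & v.|3 = 0].
Proof.
move=> b0 /rowP uv; have eig k := uv k.
have v0 : v.|0 = 0.
  have := eig (o 0); rewrite (br_r63 u v) !mxE /= => /esym/eqP.
  by rewrite mulf_eq0 (negPf b0) => /eqP.
have [u0|u0] := eqVneq u.|0 b.
  have := eig (o 2); rewrite (br_r63 u v) !mxE /= v0 u0 => E.
  have v1 : v.|1 = 0.
    apply: (mulfI b0); rewrite mulr0.
    transitivity (b * v.|1 - u.|1 * 0 + (b * v.|2 - u.|2 * 0) - b * v.|2).
      by ring.
    by rewrite E subrr.
  have := eig (o 3); rewrite (br_r63 u v) !mxE /= v0 u0 => E3; split=> //.
  apply: (mulfI (mulf_neq0 char2 b0)).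
  transitivity (b * v.|3 - - (b * v.|3 - u.|3 * 0)); first by ring.
  by rewrite E3 subrr mulr0.
have v1 : v.|1 = 0.
  have := eig (o 1); rewrite (br_r63 u v) !mxE /= v0 => E.
  have : (u.|0 - b) * v.|1 = 0.
    transitivity (u.|0 * v.|1 - u.|1 * 0 - b * v.|1); first by ring.
    by rewrite E subrr.
  by move/eqP; rewrite mulf_eq0 subr_eq0 (negPf u0) => /eqP.
split=> //; have := eig (o 3); rewrite (br_r63 u v) !mxE /= v0 => E3.
have := eig (o 4); rewrite (br_r63 u v) !mxE /= v0 => E4.
have : (u.|0 + b) * v.|3 = 0.
  transitivity (b * v.|3 - - (u.|0 * v.|3 - u.|3 * 0)); first by ring.
  by rewrite E3 subrr.
move/eqP; rewrite mulf_eq0 addr_eq0 => /orP[/eqP u0b|/eqP //].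
apply: (mulfI b0); rewrite mulr0.
transitivity (- (u.|0 * v.|3 - u.|3 * 0) - (u.|0 * v.|4 - u.|4 * 0) - b * v.|4).
  by rewrite u0b; ring.
by rewrite E4 subrr.
Qed.

Lemma not_noncommuting_eigenvectors_r63 :
  ~ noncommuting_eigenvectors (r63 F).
Proof.
case=> [u [v [w [b [c [b0 c0 uv uw /eqP[]]]]]]].
have [v0 v1 v3] := eigenvector_r63 b0 uv.
have [w0 w1 w3] := eigenvector_r63 c0 uw.
apply/rowP => i; rewrite (br_r63 v w) mxE; ord_cases i;
  by rewrite ?v0 ?v1 ?v3 ?w0 ?w1 ?w3; ring.
Qed.

(* The eigenvalues of ad u on r62, up to sign, are multiples of the           *)
(* a-coordinate of u, and an isomorphism rescales that coordinate by a        *)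
(* constant because it is phi(u, z) for the central z.                        *)
Lemma eigenvalue_r62 (lam : F) (u v : 'rV[F]_6) b : b != 0 -> v != 0 ->
  @bracket F (r62 lam) u v = b *: v ->
  b ^+ 2 = u.|0 ^+ 2 \/ b ^+ 2 = lam ^+ 2 * u.|0 ^+ 2.
Proof.
move=> b0 v_neq0 /rowP eig; have := (eig (o 0), eig (o 1), eig (o 2)).
have := (eig (o 3), eig (o 4), eig (o 5)).
rewrite !(br_r62 lam u v) !mxE /= => -[[E3 E4] E5] [[E0 E1] E2].
have v0 : v.|0 = 0.
  by move/esym/eqP: E0; rewrite mulf_eq0 (negPf b0) => /eqP.
rewrite v0 !mulr0 !subr0 in E1 E2 E3 E4.
have [v1|/mulIf inj] := eqVneq v.|1 0; last by left; rewrite (inj _ _ E1).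
have [v2|/mulIf inj] := eqVneq v.|2 0; last first.
  by left; rewrite -(inj (- u.|0) b) ?sqrrN // mulNr.
have [v3|/mulIf inj] := eqVneq v.|3 0; last first.
  by right; rewrite -(inj (lam * u.|0) b) ?exprMn // -mulrA.
have [v4|/mulIf inj] := eqVneq v.|4 0; last first.
  by right; rewrite -(inj (- (lam * u.|0)) b) ?sqrrN ?exprMn // mulNr -mulrA.
case/eqP: v_neq0; apply/rowP => i; rewrite mxE.
have v5 : v.|5 = 0.
  by apply: (mulfI b0); rewrite -E5 v1 v2 v3 v4; ring.
by ord_cases i.
Qed.

Lemma iso_r62_scale (lam mu : F) (f : {linear r62 lam -> r62 mu}) :
    lam != 0 -> mu != 0 -> bijective f ->
    (forall x y, f (bracket x y) = bracket (f x) (f y)) ->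
    (forall x y, phi (f x) (f y) = phi x y) ->
  exists c, forall v : r62 lam, (v : 'rV_6).|0 = c * (f v : 'rV_6).|0.
Proof.
move=> lam0 mu0 bij_f fbr fphi.
have phi5 (nu : F) (v : 'rV[F]_6) : v.|0 = @phi F (r62 nu) v (e 5).
  by rewrite phi_r62 // !mxE /=; ring.
have cz : central (e 5 : r62 lam).
  move=> x; apply/rowP => i; rewrite (br_r62 lam (e 5) x) !mxE.
  by ord_cases i; ring.
have := iso_central bij_f fbr (linear0 f) cz.
move=> /(central_r62 mu0) /vanish_line6 ez; exists ((f (e 5) : 'rV_6).|5) => v.
rewrite (phi5 lam) -fphi ez phi_r62 // (phi5 mu) phi_r62 // !mxE /=; ring.
Qed.

Lemma iso_r62_cond (lam mu : F) : lam != 0 -> mu != 0 ->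
  isometric_iso (r62 lam) (r62 mu) -> mu \in [:: lam; - lam; lam^-1; - lam^-1].
Proof.
move=> lam0 mu0 [f [bij_f fbr fphi]].
have [c fc] := iso_r62_scale lam0 mu0 bij_f fbr fphi.
have [g fK gK] := bij_f.
have eig1 (nu : F) : @bracket F (r62 nu) (e 0) (e 1) = 1 *: e 1.
  by apply/rowP => i; rewrite (br_r62 nu (e 0) (e 1)) !mxE; ord_cases i; ring.
have eig3 (nu : F) : @bracket F (r62 nu) (e 0) (e 3) = nu *: e 3.
  by apply/rowP => i; rewrite (br_r62 nu (e 0) (e 3)) !mxE; ord_cases i; ring.
have e1_neq0 : e 1 != 0 by apply/eqP => /rowP /(_ (o 1)) /eqP; rewrite !mxE /= oner_eq0.
have e3_neq0 : e 3 != 0 by apply/eqP => /rowP /(_ (o 3)) /eqP; rewrite !mxE /= oner_eq0.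
have f_neq0 (v : r62 lam) : v != 0 -> f v != 0.
  by apply: contraNneq => fv0; apply/eqP/(bij_inj bij_f); rewrite fv0 linear0.
have g_neq0 (v : r62 mu) : v != 0 -> g v != 0.
  by apply: contraNneq => gv0; rewrite -(gK v) gv0 linear0.
pose d := (f (e 0 : r62 lam) : 'rV_6).|0.
have cd : c * d = 1 by rewrite /d -fc mxE.
have gbr x y : g (bracket x y) = bracket (g x) (g y).
  by apply: (can_inj fK); rewrite fbr !gK.
have gZ a x : g (a *: x) = a *: g x by apply: (can_inj fK); rewrite linearZ /= !gK.
have ge0 : (g (e 0 : r62 mu) : 'rV_6).|0 = c by rewrite fc gK mxE mulr1.
(* Transporting eigenvectors both ways compares {1, lam^2} with {1, mu^2} up to the factors d^2 and
   c^2 = 1 / d^2. The inverse [g] matters when lam^2 = 1, where the two conditions obtained from [f]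
   coincide and do not determine mu^2. *)
have H1 := @eigenvalue_r62 mu (f (e 0 : r62 lam)) (f (e 1 : r62 lam)) 1
  (oner_neq0 _) (f_neq0 _ e1_neq0).
have H2 := @eigenvalue_r62 mu (f (e 0 : r62 lam)) (f (e 3 : r62 lam)) lam
  lam0 (f_neq0 _ e3_neq0).
have H3 := @eigenvalue_r62 lam (g (e 0 : r62 mu)) (g (e 1 : r62 mu)) 1
  (oner_neq0 _) (g_neq0 _ e1_neq0).
have H4 := @eigenvalue_r62 lam (g (e 0 : r62 mu)) (g (e 3 : r62 mu)) mu
  mu0 (g_neq0 _ e3_neq0).
rewrite -!fbr eig1 eig3 -/d in H1 H2; rewrite -!gbr eig1 eig3 ge0 !gZ in H3 H4.
move: (H1 (linearZ _ _)) (H2 (linearZ _ _)) (H3 erefl) (H4 erefl).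
rewrite expr1n => {H1 H2 H3 H4} H1 H2 H3 H4.
have cd2 : c ^+ 2 * d ^+ 2 = 1 by rewrite -exprMn cd expr1n.
suff : mu ^+ 2 = lam ^+ 2 \/ mu ^+ 2 * lam ^+ 2 = 1.
  case=> /eqP; first by rewrite eqf_sqr !inE => /orP[]->; rewrite ?orbT.
  rewrite -exprMn sqrf_eq1 !inE => /orP[] /eqP ml.
    by rewrite (canRL (mulfK lam0) ml) mul1r eqxx !orbT.
  by rewrite (canRL (mulfK lam0) ml) mulN1r eqxx !orbT.
case: H1 => [d1 | H1].
  have c1 : c ^+ 2 = 1 by rewrite -cd2 -d1 mulr1.
  case: H4; rewrite c1 ?mulr1 => H4; last by left.
  by left; case: H2; rewrite -d1 ?mulr1 H4.
have cm : c ^+ 2 = mu ^+ 2.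
  by rewrite -[LHS]mulr1 H1 mulrCA cd2 mulr1.
case: H2 => H2; first by right; rewrite H2 -H1.
left; rewrite H2 -H1 -cm; case: H3 => // ->.
by rewrite H2 -H1 mul1r.
Qed.

(** Exchanging y_1 and y_2 changes the sign of the parameter. *)
Lemma iso_r62_opp (lam : F) : lam != 0 -> isometric_iso (r62 lam) (r62 (- lam)).
Proof.
move=> lam0; apply: (isometric_iso_seq (L := r62 lam) (s := [:: e 0; e 1; e 2; e 4; e 3; e 5]));
  [exact: quad_r62 | exact: quad_r62 | exact: dim_table |..] => i j => [|k].
- by ord_cases i; ord_cases j; move=> _; rewrite !phi_r62 // !mxE /=; ring.
- ord_cases i; ord_cases j; ord_cases k; move=> _ _;
  by rewrite [RHS]tri_r62 // !minor3_delta // tri_r62 // /minor3 !mxE /=; ring.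
Qed.

(** Dividing a by lam turns the eigenvalue lam into 1 and 1 into its inverse; the two hyperbolic
    planes then exchange roles, and z is rescaled to keep [phi]. *)
Lemma iso_r62_inv (lam : F) : lam != 0 -> isometric_iso (r62 lam) (r62 lam^-1).
Proof.
move=> lam0; apply: (isometric_iso_seq (L := r62 lam) (s :=
    [:: lam^-1 *: e 0; e 3; e 4; e 1; e 2; lam *: e 5]));
  [exact: quad_r62 | exact: quad_r62 | exact: dim_table |..] => i j => [|k].
- by ord_cases i; ord_cases j; move=> _; rewrite !phi_r62 // !mxE /=; field.
- ord_cases i; ord_cases j; ord_cases k; move=> _ _;
  by rewrite [RHS]tri_r62 // !minor3_delta // tri_r62 // /minor3 !mxE /=; field.
Qed.

Lemma iso_r62 (lam mu : F) : lam != 0 ->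
  mu \in [:: lam; - lam; lam^-1; - lam^-1] -> isometric_iso (r62 lam) (r62 mu).
Proof.
move=> lam0; have inv0 : lam^-1 != 0 by rewrite invr_eq0.
have opp := iso_r62_opp; have inv := iso_r62_inv lam0.
rewrite !inE => /or4P[] /eqP-> //; [|exact: opp|exact: isometric_iso_trans inv (opp _ _)].
exact: isometric_iso_trans inv (isometric_iso_sym inv).
Qed.

End Dim6Invariants.

(** * Telling the algebras of dimension 7 apart *)

Section Dim7Invariants.
Variable F : fieldType.
Hypothesis char2 : (2 : F) != 0.

Local Notation o k := (@Ordinal 7 k isT).
Local Notation "u .| k" := (u 0 (o k)) (at level 2, format "u .| k").
Local Notation e k := ('e_(o k) : 'rV[F]_7).

Lemma central_line_r75 : central_line (r75 F).
Proof.
have line (u : 'rV[F]_7) : @central F (r75 F) u -> u = u.|6 *: e 6.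
  move/central_r75; rewrite /vanish /= => H; apply/rowP => i; rewrite !mxE.
  by ord_cases i; rewrite_zeros; ring.
move=> x y /line ex /line ey x0.
have x6 : x.|6 != 0 by apply: contraNneq x0 => x6; rewrite ex x6 scale0r.
by exists (y.|6 / x.|6); rewrite [LHS]ey {2}ex scalerA divfK.
Qed.

Lemma not_central_line_r71 : ~ central_line (r71 F).
Proof.
move=> /(_ (e 5) (e 6)) [x|x||c].
- by apply/rowP => i; rewrite (br_r71 (e 5) x); ord_cases i; rewrite !mxE /=; ring.
- by apply/rowP => i; rewrite (br_r71 (e 6) x); ord_cases i; rewrite !mxE /=; ring.
- by apply/eqP => /rowP /(_ (o 5)) /eqP; rewrite !mxE /= oner_eq0.
- by move=> /rowP /(_ (o 6)) /eqP; rewrite !mxE /= mulr0 oner_eq0.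
Qed.

Lemma not_central_line_r72 : ~ central_line (r72 F).
Proof.
move=> /(_ (e 5) (e 6)) [x|x||c].
- by apply/rowP => i; rewrite (br_r72 (e 5) x); ord_cases i; rewrite !mxE /=; ring.
- by apply/rowP => i; rewrite (br_r72 (e 6) x); ord_cases i; rewrite !mxE /=; ring.
- by apply/eqP => /rowP /(_ (o 5)) /eqP; rewrite !mxE /= oner_eq0.
- by move=> /rowP /(_ (o 6)) /eqP; rewrite !mxE /= mulr0 oner_eq0.
Qed.

Lemma has_eigenvalue1_r72 : has_eigenvalue1 (r72 F).
Proof.
exists (e 0 : r72 F), (e 1 : r72 F); split.
  by apply/eqP => /rowP /(_ (o 1)) /eqP; rewrite !mxE /= oner_eq0.
by apply/rowP => i; rewrite (br_r72 (e 0) (e 1)); ord_cases i; rewrite !mxE /=; ring.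
Qed.

(** Each coordinate of [u, v] involves only earlier coordinates of [v], so [v = [u, v]] makes them
    vanish one after the other. *)
Lemma not_has_eigenvalue1_r71 : ~ has_eigenvalue1 (r71 F).
Proof.
case=> u [v [v_neq0 /(congr1 (fun w : 'rV_7 => w 0)) uv]].
have v0 : v.|0 = 0 by rewrite -uv (br_r71 u v).
have v1 : v.|1 = 0 by rewrite -uv (br_r71 u v).
have v2 : v.|2 = 0 by rewrite -uv (br_r71 u v) /= v0 v1; ring.
have v3 : v.|3 = 0 by rewrite -uv (br_r71 u v) /= v0 v2; ring.
have v4 : v.|4 = 0 by rewrite -uv (br_r71 u v) /= v0 v3; ring.
have v5 : v.|5 = 0 by rewrite -uv (br_r71 u v) /= v0 v4; ring.
have v6 : v.|6 = 0 by rewrite -uv (br_r71 u v) /= v1 v2 v3 v4; ring.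
by case/eqP: v_neq0; apply/rowP => i; rewrite mxE; ord_cases i.
Qed.

End Dim7Invariants.

(** * The one-dimensional algebra *)

Section Dim1.
Variable F : fieldType.
Hypothesis char2 : (2 : F) != 0.

Lemma phi_r1 (u v : 'rV[F]_1) : @phi F (r1 F) u v = u 0 0 * v 0 0.
Proof.
rewrite /phi /= !mxE; have -> : 0 = @Ordinal 1 0 isT by apply: val_inj.
by field.
Qed.

Lemma br_r1 (u v : r1 F) : bracket u v = 0.
Proof. exact: big_nil. Qed.

Lemma quad_r1 : is_quadratic_lie (r1 F).
Proof.
split; first by apply: table_is_lie => x y z; rewrite !br_r1 !addr0.
split.
- by split=> u c x y; rewrite /= !phi_r1 !mxE; ring.
- by move=> x y; rewrite !phi_r1 mulrC.
- apply: (table_nondeg (s := [:: 'e_0 : 'rV[F]_1])) => x i.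
  by rewrite (ord1 i) phi_r1 mxE mulr1.
- by move=> x y z; rewrite !br_r1 !phi_r1 !mxE mulr0 mul0r.
Qed.

Lemma solvable_r1 : solvable_lie (r1 F).
Proof.
apply: (table_solvable (S1 := [::]) (S2 := [::])) => // u v _ _.
exact: br_r1.
Qed.

Lemma indecomposable_r1 : ~ decomposable (r1 F).
Proof.
case=> I [_ I0 If _]; case/negP: If; rewrite eqEdim subvf dim_table lt0n.
by rewrite dimv_eq0.
Qed.

End Dim1.

(** * Properties of the whole list *)

Section Listed.
Variable F : closedFieldType.
Hypothesis char2 : (2 : F) != 0.

Definition dim_label (k : label F) : nat :=
  match k with
  | R1 => 1 | R41 => 4 | R5 => 5 | R61 | R62 _ | R63 => 6 | R71 | R72 | R75 => 7
  end.

Lemma dim_alg_of (k : label F) :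
  \dim (fullv : {vspace alg_of k}) = dim_label k.
Proof. by case: k => *; apply: dim_table. Qed.

Lemma quad_alg_of (k : label F) : is_quadratic_lie (alg_of k).
Proof.
case: k => [||||lam|||| ].
- exact: quad_r1.
- exact: quad_r41.
- exact: quad_r5.
- exact: quad_r61.
- exact: quad_r62.
- exact: quad_r63.
- exact: quad_r71.
- exact: quad_r72.
- exact: quad_r75.
Qed.

Lemma solvable_alg_of (k : label F) : solvable_lie (alg_of k).
Proof.
case: k => [||||lam|||| ].
- exact: solvable_r1.
- exact: solvable_r41.
- exact: solvable_r5.
- exact: solvable_r61.
- exact: solvable_r62.
- exact: solvable_r63.
- exact: solvable_r71.
- exact: solvable_r72.
- exact: solvable_r75.
Qed.

Lemma indecomposable_alg_of (k : label F) :
  listed k -> ~ decomposable (alg_of k).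
Proof.
have dim7 : (\dim (fullv : {vspace alg_of k}) <= 7)%N.
  by rewrite dim_alg_of; case: k.
move=> lk.
(* r1 is the one listed algebra whose centre is not isotropic. *)
suff: k = R1 \/ forall z : alg_of k, central z -> phi z z = 0.
  case=> [-> | iso]; first exact: indecomposable_r1.
  apply: indecomposable_of_isotropic_center => //; first exact: quad_alg_of.
  exact: solvable_alg_of.
case: k lk {dim7} => [||||lam|||| ] lk; [by left|right..] => z.
- exact: isotropic_r41.
- exact: isotropic_r5.
- exact: isotropic_r61.
- exact: isotropic_r62.
- exact: isotropic_r63.
- exact: isotropic_r71.
- exact: isotropic_r72.
- exact: isotropic_r75.
Qed.

Lemma iso_label (k k' : label F) : listed k -> listed k' ->
  isometric_iso (alg_of k) (alg_of k') ->
  k = k' \/ exists lam mu : F, k = R62 lam /\ k' = R62 mu.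
Proof.
move=> lk lk' iso; have := iso_dim iso; rewrite !dim_alg_of.
have iso' := isometric_iso_sym iso.
have C := central_line_iso iso; have C' := central_line_iso iso'.
have E := has_eigenvalue1_iso iso; have E' := has_eigenvalue1_iso iso'.
have N := noncommuting_eigenvectors_iso iso.
have N' := noncommuting_eigenvectors_iso iso'.
(* Equality of dimensions, still in the goal, discharges the pairs of different dimension; the
   remaining pairs of distinct labels are in dimensions 6 and 7. *)
case: k lk C C' E E' N N' {iso iso'} => [||||lam|||| ] lk;
  case: k' lk' => [||||mu|||| ] lk' /= C C' E E' N N' //= _;
  try (by left); try (by right; exists lam, mu); exfalso.
- by apply/not_central_line_r61/C/central_line_r62.
- by apply/not_central_line_r61/C/central_line_r63.
- by apply/not_central_line_r61/C'/central_line_r62.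
- by apply/not_noncommuting_eigenvectors_r63/N/noncommuting_eigenvectors_r62.
- by apply/not_central_line_r61/C'/central_line_r63.
- by apply/not_noncommuting_eigenvectors_r63/N'/noncommuting_eigenvectors_r62.
- by apply/not_has_eigenvalue1_r71/E'/has_eigenvalue1_r72.
- by apply/not_central_line_r71/C/central_line_r75.
- by apply/not_has_eigenvalue1_r71/E/has_eigenvalue1_r72.
- by apply/not_central_line_r72/C/central_line_r75.
- by apply/not_central_line_r71/C'/central_line_r75.
- by apply/not_central_line_r72/C'/central_line_r75.
Qed.

End Listed.

(** * Quotient by the centre of dimension at most 4 *)

Ltac check_phi phiX phiE g :=
  let i := fresh "i" in let j := fresh "j" in
  move=> i j; ord_cases i; ord_cases j;
  move=> _; rewrite phiX !mxE /= ?phiE ?g; field; do ?[apply/andP; split].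

Ltac check_tri triX triE t :=
  let i := fresh "i" in let j := fresh "j" in let k := fresh "k" in
  move=> i j k; ord_cases i; ord_cases j; ord_cases k;
  move=> _ _; rewrite triX !minor3_delta //= ?triE ?t; field;
  do ?[apply/andP; split].

(** * Splitting off hyperbolic pairs *)

Section HyperbolicPairs.
Variable F : closedFieldType.
Hypothesis char2 : (2 : F) != 0.
Variables (L : quad_alg F).
Hypothesis quadL : is_quadratic_lie L.
Hypothesis iso : forall z : L, central z -> phi z z = 0.
Implicit Types (x y z u v : L) (U W K : {vspace L}).

Let lieL : is_lie L := proj1 quadL.
Let sym := phi_sym quadL.

(* W is the orthogonal sum of a hyperbolic plane <z, x>, z central, and U     *)
Definition hpair W z x U : Prop :=
  [/\ central z, phi x x = 0, phi x z = 1, phi z z = 0 &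
  [/\ x \in W, nondeg_on U, \dim W = (\dim U).+2,
      [/\ (U <= W)%VS, forall u, u \in U -> phi x u = 0
        & forall u, u \in U -> phi z u = 0] &
      forall u, u \in W -> u - (phi x u *: z + phi z u *: x) \in U]].

Lemma hpair_exists W z : nondeg_on W -> z \in W -> z != 0 -> central z ->
  exists x U, hpair W z x U.
Proof.
move=> nW zW z0 cz.
have [x [U [xW xz xx nU [dU UW orth dec]]]] :=
  hyper_split char2 quadL nW erefl zW z0 (iso cz).
exists x, U; split=> //; first exact: iso.
by split=> //; split=> // u /orth[].
Qed.

Lemma hpair_span W z x U : hpair W z x U ->
  (W <= centerv L + (<[x]> + U))%VS.
Proof.
case=> cz _ _ _ [_ _ _ _ dec]; apply/subvP => u uW.
rewrite -(subrK (phi x u *: z + phi z u *: x) u) addrC -addrA.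
apply: memv_add; first by rewrite memvZ //; apply/(mem_centerP quadL).
by apply: memv_add; [rewrite memvZ ?memv_line | apply: dec].
Qed.

Lemma span_step C W U V x : (W <= C + (<[x]> + U))%VS -> (U <= C + V)%VS ->
  (W <= C + (<[x]> + V))%VS.
Proof.
move=> WU UV; apply: subv_trans WU _; rewrite !subv_add addvSl /=.
apply/andP; split; first exact: subv_trans (addvSl _ _) (addvSr _ _).
exact: subv_trans UV (addvS (subvv _) (addvSr _ _)).
Qed.

Lemma hpair_spans1 z x (s : seq L) : hpair fullv z x <<s>>%VS ->
  spans_mod_center (x :: s).
Proof. by move/hpair_span; rewrite /spans_mod_center span_cons. Qed.

Lemma hpair_spans2 z1 x1 U z2 x2 (s : seq L) : hpair fullv z1 x1 U ->
  hpair U z2 x2 <<s>>%VS -> spans_mod_center [:: x1, x2 & s].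
Proof.
move=> /hpair_span H1 /hpair_span H2; rewrite /spans_mod_center !span_cons.
exact: span_step H1 H2.
Qed.

Lemma hpair_spans3 z1 x1 U z2 x2 U' z3 x3 (s : seq L) : hpair fullv z1 x1 U ->
  hpair U z2 x2 U' -> hpair U' z3 x3 <<s>>%VS ->
  spans_mod_center [:: x1, x2, x3 & s].
Proof.
move=> /hpair_span H1 /hpair_span H2 /hpair_span H3.
rewrite /spans_mod_center !span_cons.
exact: span_step H1 (span_step H2 H3).
Qed.

Definition centerless U := forall u, u \in U -> central u -> u = 0.

(** Orthogonality to [z] is automatic, because the centre is totally isotropic. *)
Lemma hpair_centerless W z x U v : hpair W z x U -> v \in W -> central v ->
  phi x v = 0 -> v \in U.
Proof.
case=> cz _ _ _ [_ _ _ _ dec] vW cv xv; have := dec v vW.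
by rewrite xv (phi_central quadL char2 iso cz cv) !scale0r addr0 subr0.
Qed.

Lemma hpair_not_central W z x U : hpair W z x U -> ~ central x.
Proof.
case=> cz _ xz _ _ cx; have := phi_central quadL char2 iso cx cz.
by rewrite xz => /eqP; rewrite oner_eq0.
Qed.

Lemma hyperbolic_r41 z a U : hpair fullv z a U -> \dim U = 2%N ->
  isometric_iso L (r41 F).
Proof.
move=> hz; have [cz aa az zz [_ nU dU [_ aU zU] _]] := hz => dU2.
have [p [q [pp qq pq eU]]] := hyperbolic_basis char2 quadL nU dU2.
have pU : p \in U by rewrite eU memv_span ?inE ?eqxx.
have qU : q \in U by rewrite eU memv_span ?inE ?eqxx ?orbT.
have ap := aU _ pU; have aq := aU _ qU; have zp := zU _ pU; have zq := zU _ qU.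
move es: (tri a p q) => s.
(* This is the only value of [tri] modulo the centre; if it vanished, [a] would be central. *)
have s0 : s != 0.
  apply/negP => /eqP s0; rewrite s0 in es; apply: (hpair_not_central hz).
  rewrite eU in hz; apply: (tri_span quadL (hpair_spans1 hz)) => u v.
  by rewrite !inE => /or3P[] /eqP-> /or3P[] /eqP->;
    rewrite ?(triE quadL) ?(tri_perm quadL es) ?oppr0.
(* Opposite scalings of [a] and [z] keep [phi a z = 1] and bring the value of [tri] to 1. *)
apply: (isometric_iso_seq (s := [:: s^-1 *: a; p; q; s *: z])) => //.
- exact: quad_r41.
- by rewrite dU dU2.
- have g := (sym aa, sym az, sym zz, sym pp, sym qq, sym pq, sym ap, sym aq,
    sym zp, sym zq).
  by check_phi (phi_r41 char2) (phiE quadL) g.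
- have t := (tri_central quadL cz, tri_perm quadL es).
  by check_tri (tri_r41 char2) (triE quadL) t.
Qed.

End HyperbolicPairs.

(** * Trilinear forms of rank at most 4 *)

Section LowRank.
Variable F : closedFieldType.
Hypothesis char2 : (2 : F) != 0.
Variables (L : quad_alg F).
Hypothesis quadL : is_quadratic_lie L.
Hypothesis iso : forall z : L, central z -> phi z z = 0.
Implicit Types (x y z u v : L) (U W K : {vspace L}).

Let lieL : is_lie L := proj1 quadL.
Let sym := phi_sym quadL.

Lemma central_of_rank2 (s : seq L) v : spans_mod_center s -> (size s <= 2)%N ->
  v \in s -> central v.
Proof.
move=> sp ss vs; apply: (tri_span quadL sp) => p q.
case: s ss vs {sp} => [|x [|y []]] // _; rewrite !inE.
  by move=> /eqP-> /eqP-> /eqP->; rewrite (trixx quadL).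
by move=> /orP[] /eqP-> /orP[] /eqP-> /orP[] /eqP->; rewrite (triE quadL).
Qed.

(* A 3-form in 4 variables has a kernel.                                      *)
Lemma tri_kernel4 u1 u2 u3 u4 p q (s := [:: u1; u2; u3; u4]) :
  p \in s -> q \in s ->
  tri (tri u2 u3 u4 *: u1 - tri u1 u3 u4 *: u2 + tri u1 u2 u4 *: u3
       - tri u1 u2 u3 *: u4) p q = 0.
Proof.
move ea: (tri u2 u3 u4) => a; move eb: (tri u1 u3 u4) => b.
move ec: (tri u1 u2 u4) => c; move ed: (tri u1 u2 u3) => d.
have t := (tri_perm quadL ea, tri_perm quadL eb, tri_perm quadL ec,
  tri_perm quadL ed).
by rewrite !inE => /or4P[] /eqP-> /or4P[] /eqP->;
  rewrite !(triE quadL) ?t; ring.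
Qed.

(** The kernel vector given by [tri_kernel4] is central, and its coefficients are, up to sign, the
    values of [tri]; independence modulo the centre makes them all vanish. *)
Lemma central_of_rank4 u1 u2 u3 u4 : spans_mod_center [:: u1; u2; u3; u4] ->
  (forall a b c d, central (a *: u1 + b *: u2 + c *: u3 + d *: u4) ->
     [/\ a = 0, b = 0, c = 0 & d = 0]) ->
  central u1.
Proof.
move=> sp indep.
have [|a0 b0 c0 d0] := indep (tri u2 u3 u4) (- tri u1 u3 u4) (tri u1 u2 u4)
    (- tri u1 u2 u3).
  apply: (tri_span quadL sp) => p q ps qs.
  by rewrite !scaleNr (tri_kernel4 ps qs).
move/eqP: b0; move/eqP: d0; rewrite !oppr_eq0 => /eqP d0 /eqP b0.
have t := (tri_perm quadL a0, tri_perm quadL b0, tri_perm quadL c0,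
  tri_perm quadL d0).
apply: (tri_span quadL sp) => p q; rewrite !inE.
by move=> /or4P[] /eqP-> /or4P[] /eqP->; rewrite ?(triE quadL) ?t ?oppr0.
Qed.

(** Rank 4 with a centre of dimension 1, so that dim L = 5; the two lemmas that follow treat centres
    of dimension 2 and 3, with dim L = 6 and 7. *)
Lemma rank4_k1 z a U : hpair fullv z a U -> centerless U -> \dim U = 3%N ->
  False.
Proof.
move=> hz clU dU3; apply: (hpair_not_central char2 quadL iso hz).
have [cz aa az zz [_ nU dU [_ aU zU] _]] := hz.
have [s [ss os eU]] := orthonormal_basis char2 quadL nU dU3.
case: s ss os eU => [|e1 [|e2 [|e3 []]]] //= _ + eU.
move=> [e11 [e12 [e13 _]] [e22 [e23 _] [e33 _ _]]].
have e1U : e1 \in U by rewrite eU memv_span ?inE ?eqxx.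
have e2U : e2 \in U by rewrite eU memv_span ?inE ?eqxx ?orbT.
have e3U : e3 \in U by rewrite eU memv_span ?inE ?eqxx ?orbT.
have g := (sym aa, sym az, sym (aU _ e1U), sym (aU _ e2U), sym (aU _ e3U),
  sym (zU _ e1U), sym (zU _ e2U), sym (zU _ e3U), sym e11, sym e12, sym e13,
  sym e22, sym e23, sym e33).
rewrite eU in hz.
(* A central combination of these vectors lies in [U], hence is zero; pairing it with [z] and the
   [e_i] reads off its coefficients. *)
apply: (@central_of_rank4 _ e1 e2 e3 (hpair_spans1 quadL hz)) => i j k l.
set v := _ + l *: e3 => cv.
have v0 : v = 0.
  apply: clU => //; rewrite eU; apply: (hpair_centerless _ _ _ hz) => //.
    exact: memvf.
  by rewrite /v !(phiE quadL) !g; ring.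
have c w : phi w v = 0 by rewrite v0 (phi0r quadL).
by split; [have := c z | have := c e1 | have := c e2 | have := c e3];
  rewrite /v !(phiE quadL) ?g !(mulr0, mulr1, addr0, add0r).
Qed.

Lemma rank4_k2 z1 x1 U1 z2 x2 U : hpair fullv z1 x1 U1 -> hpair U1 z2 x2 U ->
  centerless U -> z2 \in U1 -> \dim U = 2%N -> False.
Proof.
move=> h1 h2 clU z2U1 dU2; apply: (hpair_not_central char2 quadL iso h1).
have [cz1 x11 xz1 z11 [_ nU1 dU1 [_ x1U z1U] _]] := h1.
have [cz2 x22 xz2 z22 [x2U1 nU dU [/subvP UU1 x2U z2U] _]] := h2.
have [s [ss os eU]] := orthonormal_basis char2 quadL nU dU2.
case: s ss os eU => [|e1 [|e2 []]] //= _ + eU.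
move=> [e11 [e12 _] [e22 _ _]].
have e1U : e1 \in U by rewrite eU memv_span ?inE ?eqxx.
have e2U : e2 \in U by rewrite eU memv_span ?inE ?eqxx ?orbT.
have g := (sym x11, sym xz1, sym x22, sym xz2, sym e11, sym e12, sym e22,
  sym (x1U _ x2U1), sym (x1U _ z2U1), sym (z1U _ x2U1), sym (z1U _ z2U1),
  sym (x1U _ (UU1 _ e1U)), sym (x1U _ (UU1 _ e2U)),
  sym (z1U _ (UU1 _ e1U)), sym (z1U _ (UU1 _ e2U)),
  sym (x2U _ e1U), sym (x2U _ e2U), sym (z2U _ e1U), sym (z2U _ e2U)).
rewrite eU in h2.
apply: (@central_of_rank4 _ x2 e1 e2 (hpair_spans2 quadL h1 h2)) => i j k l.
set v := _ + l *: e2 => cv.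
have v0 : v = 0.
  apply: clU => //; rewrite eU; apply: (hpair_centerless _ _ _ h2) => //.
    apply: (hpair_centerless _ _ _ h1) => //; first exact: memvf.
    by rewrite /v !(phiE quadL) !g; ring.
  by rewrite /v !(phiE quadL) !g; ring.
have c w : phi w v = 0 by rewrite v0 (phi0r quadL).
by split; [have := c z1 | have := c z2 | have := c e1 | have := c e2];
  rewrite /v !(phiE quadL) ?g !(mulr0, mulr1, addr0, add0r).
Qed.

Lemma rank4_k3 z1 x1 U1 z2 x2 U2 z3 x3 U : hpair fullv z1 x1 U1 ->
  hpair U1 z2 x2 U2 -> hpair U2 z3 x3 U ->
  centerless U -> z2 \in U1 -> z3 \in U2 -> \dim U = 1%N -> False.
Proof.
move=> h1 h2 h3 clU z2U1 z3U2 dU1'.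
apply: (hpair_not_central char2 quadL iso h1).
have [cz1 x11 xz1 z11 [_ nU1 dU1 [_ x1U z1U] _]] := h1.
have [cz2 x22 xz2 z22 [x2U1 nU2 dU2 [/subvP U21 x2U z2U] _]] := h2.
have [cz3 x33 xz3 z33 [x3U2 nU dU [/subvP UU2 x3U z3U] _]] := h3.
have [s [ss os eU]] := orthonormal_basis char2 quadL nU dU1'.
case: s ss os eU => [|e []] //= _ [ee _ _] eU.
have eU' : e \in U by rewrite eU memv_span ?inE ?eqxx.
have eU2 := UU2 _ eU'; have eU1 := U21 _ eU2.
have x3U1 := U21 _ x3U2; have z3U1 := U21 _ z3U2.
have g := (sym x11, sym xz1, sym x22, sym xz2, sym x33, sym xz3, sym ee,
  (sym (x1U _ x2U1), sym (x1U _ z2U1), sym (z1U _ x2U1), sym (z1U _ z2U1),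
  sym (x1U _ x3U1), sym (x1U _ z3U1), sym (z1U _ x3U1), sym (z1U _ z3U1),
  sym (x1U _ eU1), sym (z1U _ eU1)),
  (sym (x2U _ x3U2), sym (x2U _ z3U2), sym (z2U _ x3U2), sym (z2U _ z3U2),
  sym (x2U _ eU2), sym (z2U _ eU2)), sym (x3U _ eU'), sym (z3U _ eU')).
rewrite eU in h3.
apply: (@central_of_rank4 _ x2 x3 e (hpair_spans3 quadL h1 h2 h3)) => i j k l.
set v := _ + l *: e => cv.
have v0 : v = 0.
  apply: clU => //; rewrite eU; apply: (hpair_centerless _ _ _ h3) => //.
    apply: (hpair_centerless _ _ _ h2) => //.
      apply: (hpair_centerless _ _ _ h1) => //; first exact: memvf.
      by rewrite /v !(phiE quadL) !g; ring.
    by rewrite /v !(phiE quadL) !g; ring.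
  by rewrite /v !(phiE quadL) !g; ring.
have c w : phi w v = 0 by rewrite v0 (phi0r quadL).
by split; [have := c z1 | have := c z2 | have := c z3 | have := c e];
  rewrite /v !(phiE quadL) ?g !(mulr0, mulr1, addr0, add0r).
Qed.

Lemma rank3_r5 z1 x1 U1 z2 x2 U : hpair fullv z1 x1 U1 -> hpair U1 z2 x2 U ->
  z2 \in U1 -> \dim U = 1%N -> isometric_iso L (r5 F).
Proof.
move=> h1 h2 z2U1 dU1'.
have [cz1 x11 xz1 z11 [_ nU1 dU1 [_ x1U z1U] _]] := h1.
have [cz2 x22 xz2 z22 [x2U1 nU dU [/subvP UU1 x2U z2U] _]] := h2.
have [s [ss os eU]] := orthonormal_basis char2 quadL nU dU1'.
case: s ss os eU => [|e []] //= _ [ee _ _] eU.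
have eU' : e \in U by rewrite eU memv_span ?inE ?eqxx.
have eU1 := UU1 _ eU'.
move es: (tri x1 x2 e) => c.
have c0 : c != 0.
  apply/negP => /eqP c0; rewrite c0 in es.
  apply: (hpair_not_central char2 quadL iso h1).
  rewrite eU in h2; apply: (tri_span quadL (hpair_spans2 quadL h1 h2)) => u v.
  by rewrite !inE => /or3P[] /eqP-> /or3P[] /eqP->;
    rewrite ?(triE quadL) ?(tri_perm quadL es) ?oppr0.
(* In r5 the listed form pairs x_1 with z_2 and x_2 with - z_1, whence the order and the sign of the
   last two vectors. *)
apply: (isometric_iso_seq (s := [:: c^-1 *: x1; x2; e; - z2; c *: z1])) => //.
- exact: quad_r5.
- by rewrite dU1 dU dU1'.
- have g := (sym x11, sym xz1, sym z11, sym x22, sym xz2, sym z22, sym ee,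
    sym (x1U _ x2U1), sym (x1U _ z2U1), sym (z1U _ x2U1), sym (z1U _ z2U1),
    sym (x1U _ eU1), sym (z1U _ eU1), sym (x2U _ eU'), sym (z2U _ eU')).
  by check_phi (phi_r5 char2) (phiE quadL) g.
- have t := (tri_central quadL cz1, tri_central quadL cz2, tri_perm quadL es).
  by check_tri (tri_r5 char2) (triE quadL) t.
Qed.

Lemma rank3_r61 z1 x1 U1 z2 x2 U2 z3 x3 U : hpair fullv z1 x1 U1 ->
  hpair U1 z2 x2 U2 -> hpair U2 z3 x3 U ->
  z2 \in U1 -> z3 \in U2 -> \dim U = 0%N -> isometric_iso L (r61 F).
Proof.
move=> h1 h2 h3 z2U1 z3U2 dU0.
have [cz1 x11 xz1 z11 [_ nU1 dU1 [_ x1U z1U] _]] := h1.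
have [cz2 x22 xz2 z22 [x2U1 nU2 dU2 [/subvP U21 x2U z2U] _]] := h2.
have [cz3 x33 xz3 z33 [x3U2 nU dU _ _]] := h3.
have x3U1 := U21 _ x3U2; have z3U1 := U21 _ z3U2.
have eU : U = <<[::]>>%VS by apply/eqP; rewrite span_nil -dimv_eq0 dU0.
move es: (tri x1 x2 x3) => c.
have c0 : c != 0.
  apply/negP => /eqP c0; rewrite c0 in es.
  apply: (hpair_not_central char2 quadL iso h1).
  rewrite eU in h3; apply: (tri_span quadL (hpair_spans3 quadL h1 h2 h3)) => u v.
  by rewrite !inE => /or3P[] /eqP-> /or3P[] /eqP->;
    rewrite ?(triE quadL) ?(tri_perm quadL es) ?oppr0.
apply: (isometric_iso_seq (s := [:: c^-1 *: x1; x2; z3; x3; z2; c *: z1])) => //.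
- exact: quad_r61.
- by rewrite dU1 dU2 dU dU0.
- have g := (sym x11, sym xz1, sym z11, sym x22, sym xz2, sym z22, sym x33,
    sym xz3, sym z33,
    (sym (x1U _ x2U1), sym (x1U _ z2U1), sym (z1U _ x2U1), sym (z1U _ z2U1),
    sym (x1U _ x3U1), sym (x1U _ z3U1), sym (z1U _ x3U1), sym (z1U _ z3U1)),
    (sym (x2U _ x3U2), sym (x2U _ z3U2), sym (z2U _ x3U2), sym (z2U _ z3U2))).
  by check_phi (phi_r61 char2) (phiE quadL) g.
- have t := (tri_central quadL cz1, tri_central quadL cz2, tri_central quadL cz3,
    tri_perm quadL es).
  by check_tri (tri_r61 char2) (triE quadL) t.
Qed.

End LowRank.

(** * Quotient by the centre of dimension 5 or 6 *)

Section Dim6.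
Variable F : closedFieldType.
Hypothesis char2 : (2 : F) != 0.
Variables (L : quad_alg F).
Hypothesis quadL : is_quadratic_lie L.
Hypothesis iso : forall z : L, central z -> phi z z = 0.
Implicit Types (x y z u v : L) (U W K : {vspace L}).

Let lieL : is_lie L := proj1 quadL.
Let sym := phi_sym quadL.

(* Brackets are orthogonal to the centre, hence have no component along the   *)
(* noncentral vectors of the hyperbolic pairs.                                *)
Definition bracket_expands (s : seq L) := forall r t,
  bracket r t - \sum_(e <- s) tri r t e *: e \in centerv L.

Lemma bracket_perp_center z x y : central z -> phi z (bracket x y) = 0.
Proof. by move=> cz; rewrite (phiC quadL) -/(tri _ _ _) (tri_central quadL cz). Qed.

Lemma hpair_bracket W z x U u : hpair W z x U -> u \in W -> phi z u = 0 ->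
  exists2 c, central c & [/\ u - c \in U & forall e, e \in U -> phi c e = 0].
Proof.
case=> cz _ _ _ [_ _ _ [_ _ zU] dec] uW zu; exists (phi x u *: z).
  exact: (centralZ lieL).
split; first by have := dec u uW; rewrite zu scale0r addr0.
by move=> e eU; rewrite (phiZl quadL) zU // mulr0.
Qed.

Lemma bracket_expands1 z a (s : seq L) : hpair fullv z a <<s>>%VS ->
  orthonormal_seq s -> bracket_expands s.
Proof.
move=> hz os r t; have [cz _ _ _ _] := hz.
have [c cc [mem orth]] :=
  hpair_bracket hz (memvf _) (bracket_perp_center r t cz).
have := span_expand quadL erefl os mem => eq; apply/(mem_centerP quadL).
suff -> : bracket r t - \sum_(e <- s) tri r t e *: e = c by [].
rewrite -{1}(subrK c (bracket r t)) {1}eq addrAC.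
suff -> : \sum_(e <- s) phi e (bracket r t - c) *: e = \sum_(e <- s) tri r t e *: e.
  by rewrite subrr add0r.
apply: eq_big_seq => e es; congr (_ *: _).
by rewrite (phiC quadL) !(phiE quadL) orth ?oppr0 ?addr0 ?memv_span.
Qed.

Lemma bracket_expands2 z1 x1 U1 z2 x2 (s : seq L) : hpair fullv z1 x1 U1 ->
  hpair U1 z2 x2 <<s>>%VS -> orthonormal_seq s -> bracket_expands s.
Proof.
move=> h1 h2 os r t; have [cz1 _ _ _ [_ _ _ _ _]] := h1.
have [cz2 _ _ _ [_ _ _ [/subvP sU1 _ _] _]] := h2.
have [c cc [mem orth]] :=
  hpair_bracket h1 (memvf _) (bracket_perp_center r t cz1).
have z2w : phi z2 (bracket r t - c) = 0.
  rewrite !(phiE quadL) bracket_perp_center //.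
  by rewrite (phi_central quadL char2 iso cz2 cc) subrr.
have [c' cc' [mem' orth']] := hpair_bracket h2 mem z2w.
have := span_expand quadL erefl os mem' => eq; apply/(mem_centerP quadL).
suff -> : bracket r t - \sum_(e <- s) tri r t e *: e = c' + c.
  exact: (centralD lieL).
rewrite -{1}(subrK c (bracket r t)) -{1}(subrK c' (bracket r t - c)) {1}eq.
suff -> : \sum_(e <- s) phi e (bracket r t - c - c') *: e = \sum_(e <- s) tri r t e *: e.
  by rewrite -(addrA _ c' c) addrAC subrr add0r.
apply: eq_big_seq => e es; congr (_ *: _).
rewrite (phiC quadL) !(phiE quadL) orth ?orth' ?oppr0 ?addr0 ?memv_span //.
by apply: sU1; rewrite memv_span.
Qed.

(** Parseval's identity: the central remainder in the expansion of one bracket is orthogonal to the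
    other bracket. *)
Lemma jacobi_expand (s : seq L) p q r t : bracket_expands s ->
  phi (bracket p q) (bracket r t) = \sum_(e <- s) tri p q e * tri r t e.
Proof.
move=> ex; have /(mem_centerP quadL) cc := ex r t.
rewrite -[X in phi _ X](subrK (\sum_(e <- s) tri r t e *: e)) (phiDr quadL).
rewrite [X in X + _](phiC quadL) (bracket_perp_center _ _ cc) add0r.
rewrite (phiC quadL) (phi_suml quadL); apply: eq_bigr => e _.
by rewrite (phiZl quadL) (phiC quadL) mulrC.
Qed.

Lemma hpair_central z a U v : hpair fullv z a U ->
  (forall u w, u \in U -> w \in U -> tri v u w = 0) ->
  (forall u, u \in U -> tri a v u = 0) -> central v.
Proof.
move=> hz vU av; have eU := span_basis (vbasisP U).
rewrite -eU in hz; apply: (tri_span quadL (hpair_spans1 quadL hz)) => p q.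
rewrite !inE => /orP[/eqP-> | /vbasis_mem ps] /orP[/eqP-> | /vbasis_mem qs].
- exact: (triyy quadL).
- by rewrite (triC12 quadL) av ?oppr0.
- by rewrite -(tri_cycle quadL) -(tri_cycle quadL) av.
- exact: vU.
Qed.

Lemma tri_zero_on_span (s : seq L) :
  (forall p q r, p \in s -> q \in s -> r \in s -> tri p q r = 0) ->
  forall u v w, u \in <<s>>%VS -> v \in <<s>>%VS -> w \in <<s>>%VS ->
  tri u v w = 0.
Proof.
move=> s0 u v w us vs ws.
apply: (mem_span_seq (P := fun u => tri u v w = 0)) us => [|x y Hx Hy|c x Hx|p ps].
- exact: (tri0l quadL).
- by rewrite (triDl quadL) Hx Hy addr0.
- by rewrite (triZl quadL) Hx mulr0.
apply: (mem_span_seq (P := fun v => tri p v w = 0)) vs => [|x y Hx Hy|c x Hx|q qs].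
- exact: (tri0m quadL).
- by rewrite (triDm quadL) Hx Hy addr0.
- by rewrite (triZm quadL) Hx mulr0.
apply: (mem_span_seq (P := fun w => tri p q w = 0)) ws => [|x y Hx Hy|c x Hx|r rs].
- exact: (tri0r quadL).
- by rewrite (triDr quadL) Hx Hy addr0.
- by rewrite (triZr quadL) Hx mulr0.
exact: s0.
Qed.

(* A 3-form on a 4-space is the contraction of the volume form with b. As ad a *)
(* is trace free, invariance of the 3-form under it says [a, b] = 0.          *)
Lemma jacobi_kernel4 (e1 e2 e3 e4 a : L) (s := [:: e1; e2; e3; e4])
  (b := tri e2 e3 e4 *: e1 - tri e1 e3 e4 *: e2 + tri e1 e2 e4 *: e3
        - tri e1 e2 e3 *: e4) :
  (forall p q r, p \in s -> q \in s -> r \in s ->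
    phi (bracket p q) (bracket r a) = \sum_(e <- s) tri p q e * tri r a e) ->
  forall p, p \in s -> tri a b p = 0.
Proof.
have [e1s e2s e3s e4s] : [/\ e1 \in s, e2 \in s, e3 \in s & e4 \in s].
  by rewrite !inE !eqxx !orbT.
have b_def : b = tri e2 e3 e4 *: e1 - tri e1 e3 e4 *: e2 + tri e1 e2 e4 *: e3
  - tri e1 e2 e3 *: e4 by [].
move=> ex; have := (jacobi4 quadL e1 e2 e3 a, jacobi4 quadL e1 e2 e4 a).
have := (jacobi4 quadL e1 e3 e4 a, jacobi4 quadL e2 e3 e4 a).
rewrite !ex // !big_cons !big_nil.
clearbody b; move: b_def.
move E234: (tri e2 e3 e4) => t234; move E134: (tri e1 e3 e4) => t134.
move E124: (tri e1 e2 e4) => t124; move E123: (tri e1 e2 e3) => t123 b_def.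
move E12: (tri a e1 e2) => d12; move E13: (tri a e1 e3) => d13.
move E14: (tri a e1 e4) => d14; move E23: (tri a e2 e3) => d23.
move E24: (tri a e2 e4) => d24; move E34: (tri a e3 e4) => d34.
have t := (tri_perm quadL E12, tri_perm quadL E13, tri_perm quadL E14,
  tri_perm quadL E23, tri_perm quadL E24, tri_perm quadL E34,
  tri_perm quadL E123, tri_perm quadL E124, tri_perm quadL E134,
  tri_perm quadL E234).
rewrite ?(triE quadL) ?t b_def => -[J1 J2] [J3 J4] p.
rewrite !inE => /or4P[] /eqP->; rewrite !(triE quadL) ?t.
- by apply: etrans J2; ring.
- by apply: oppr_inj; rewrite oppr0; apply: etrans J1; ring.
- by apply: etrans J4; ring.
- by apply: oppr_inj; rewrite oppr0; apply: etrans J3; ring.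
Qed.

(** The kernel vector [b] of [tri] on [U] is also killed by ad a, by the Jacobi identity. It is
    therefore central, hence zero, and its coordinates are the values of [tri] on [U] up to sign. *)
Lemma rank5_abelian z a U : hpair fullv z a U -> centerless U ->
  \dim U = 4%N -> forall u v w, u \in U -> v \in U -> w \in U -> tri u v w = 0.
Proof.
move=> hz clU dU4; have [cz aa az zz [_ nU dU [_ aU zU] _]] := hz.
have [s [ss os eU]] := orthonormal_basis char2 quadL nU dU4.
case: s ss os eU => [|e1 [|e2 [|e3 [|e4 []]]]] //= _ os eU.
have [e11 [e12 [e13 [e14 _]]] [e22 [e23 [e24 _]] [e33 [e34 _] [e44 _ _]]]] := os.
have e1U : e1 \in U by rewrite eU memv_span ?inE ?eqxx.
have e2U : e2 \in U by rewrite eU memv_span ?inE ?eqxx ?orbT.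
have e3U : e3 \in U by rewrite eU memv_span ?inE ?eqxx ?orbT.
have e4U : e4 \in U by rewrite eU memv_span ?inE ?eqxx ?orbT.
rewrite eU in hz; have ex := bracket_expands1 hz os.
have ab := @jacobi_kernel4 e1 e2 e3 e4 a
  (fun p q r _ _ _ => jacobi_expand p q r a ex).
have k4 := @tri_kernel4 _ _ quadL e1 e2 e3 e4.
move: ab k4; set b := _ - tri e1 e2 e3 *: e4 => ab k4.
have b0 : b = 0.
  apply: clU.
    by apply: memvB; [apply: memvD; [apply: memvB|]|]; apply: memvZ.
  apply: (tri_span quadL (hpair_spans1 quadL hz)) => p q; rewrite ![_ \in a :: _]inE.
  move=> /orP[/eqP-> | ps] /orP[/eqP-> | qs].
  - exact: (triyy quadL).
  - by rewrite (triC12 quadL) ab ?oppr0.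
  - by rewrite -(tri_cycle quadL) -(tri_cycle quadL) ab.
  - exact: k4.
have c w : phi w b = 0 by rewrite b0 (phi0r quadL).
have g := (sym e11, sym e12, sym e13, sym e14, sym e22, sym e23, sym e24,
  sym e33, sym e34, sym e44).
move: (c e1) (c e2) (c e3) (c e4); rewrite /b !(phiE quadL) !g.
rewrite ?(mulr0, mulr1, addr0, add0r, oppr0).
move=> t1 /eqP + t3 /eqP; rewrite !oppr_eq0 => /eqP t2 /eqP t4.
have t := (tri_perm quadL t1, tri_perm quadL t2, tri_perm quadL t3,
  tri_perm quadL t4).
rewrite eU; apply: tri_zero_on_span => p q r; rewrite !inE.
by move=> /or4P[] /eqP-> /or4P[] /eqP-> /or4P[] /eqP->;
  rewrite ?(triE quadL) ?t ?oppr0.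
Qed.

End Dim6.

(** * Dimension 6 with a centre of dimension 1 *)

Section Dim6.
Variable F : closedFieldType.
Hypothesis char2 : (2 : F) != 0.
Variables (L : quad_alg F).
Hypothesis quadL : is_quadratic_lie L.
Hypothesis iso : forall z : L, central z -> phi z z = 0.
Implicit Types (x y z u v : L) (U W K : {vspace L}).

Let lieL : is_lie L := proj1 quadL.
Let sym := phi_sym quadL.

Lemma central_in_abelian z a U v : hpair fullv z a U ->
  (forall u v w, u \in U -> v \in U -> w \in U -> tri u v w = 0) ->
  v \in U -> (forall u, u \in U -> tri a v u = 0) -> central v.
Proof.
by move=> hz abU vU; apply: (hpair_central quadL hz) => u w; apply: abU.
Qed.

Lemma dim6_cases z a U : hpair fullv z a U -> centerless U -> \dim U = 4%N ->
  (exists2 lam, lam != 0 & isometric_iso L (r62 lam)) \/ isometric_iso L (r63 F).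
Proof.
move=> hz clU dU4; have abU := rank5_abelian char2 quadL hz clU dU4.
have [cz aa az zz [_ nU dU [_ aU zU] _]] := hz.
have dL : \dim (fullv : {vspace L}) = 6%N by rewrite dU dU4.
have U0 : U != 0%VS by rewrite -dimv_eq0 dU4.
have [mu [x [xU x0 ax]]] := skew_eigenvector char2 quadL a nU U0.
have mu0 : mu != 0.
  apply: contraNneq x0 => mu0; apply/eqP/clU => //.
  by apply: (central_in_abelian hz) => // u uU; rewrite ax // mu0 mul0r.
have xx : phi x x = 0.
  by apply: (mulfI mu0); rewrite -ax // (triyy quadL) mulr0.
have [y [U2 [yU yx yy nU2 [dU2 /subvP UU2 orth dec]]]] :=
  hyper_split char2 quadL nU dU4 xU x0 xx.
have [p0 [q0 [pp0 qq0 pq0 eU2]]] :=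
  hyperbolic_basis char2 quadL nU2 (esym (eq_add_S _ _ (eq_add_S _ _ dU2))).
(* Exchanging [p] and [q] changes the sign of [nu], and mu + nu and mu - nu cannot both vanish since
   2 mu is nonzero; so mu + nu may be assumed nonzero. *)
suff main p q nu : phi p p = 0 -> phi q q = 0 -> phi p q = 1 ->
    p \in U2 -> q \in U2 -> U2 = <<[:: p; q]>>%VS -> tri a p q = nu ->
    mu + nu != 0 ->
    (exists2 lam, lam != 0 & isometric_iso L (r62 lam)) \/
    isometric_iso L (r63 F).
  have p0U : p0 \in U2 by rewrite eU2 memv_span ?inE ?eqxx.
  have q0U : q0 \in U2 by rewrite eU2 memv_span ?inE ?eqxx ?orbT.
  have [mn|mn] := eqVneq (mu + tri a p0 q0) 0.
    apply: (main q0 p0 (- tri a p0 q0)) => //.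
    - by rewrite (phiC quadL).
    - by rewrite eU2; apply: eq_span => u; rewrite !inE orbC.
    - by rewrite (triC23 quadL).
    - have -> : tri a p0 q0 = - mu by apply/eqP; rewrite -addr_eq0 addrC mn.
      by rewrite opprK -mulr2n -mulr_natl mulf_neq0.
  exact: (main p0 q0 (tri a p0 q0)).
move=> {p0 q0 pp0 qq0 pq0 eU2} pp qq pq pU2 qU2 eU2 anu mn.
have pU := UU2 p pU2; have qU := UU2 q qU2.
have [yp xp] := orth p pU2; have [yq xq] := orth q qU2.
have g := (sym aa, sym az, sym zz, sym xx, sym yx, sym yy, sym pp, sym qq,
  sym pq, sym yp, sym xp, sym yq, sym xq, sym (aU _ xU), sym (aU _ yU),
  sym (aU _ pU), sym (aU _ qU), (sym (zU _ xU), sym (zU _ yU),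
  sym (zU _ pU), sym (zU _ qU))).
have axy : tri a x y = mu by rewrite ax // g mulr1.
have axp : tri a x p = 0 by rewrite ax // g mulr0.
have axq : tri a x q = 0 by rewrite ax // g mulr0.
(* Chosen so that [q + be *: x] is an eigenvector of ad a modulo [z], for the eigenvalue [- nu]. *)
pose be := - (tri a q y / (mu + nu)).
have aqy : tri a q y = - be * (mu + nu) by rewrite /be opprK divfK.
clearbody be.
have xyp := abU x y p xU yU pU; have xyq := abU x y q xU yU qU.
have xpq := abU x p q xU pU qU; have ypq := abU y p q yU pU qU.
have t := (tri_central quadL cz, tri_perm quadL axy, tri_perm quadL axp,
  tri_perm quadL axq, tri_perm quadL aqy, tri_perm quadL anu,
  tri_perm quadL xyp, tri_perm quadL xyq, tri_perm quadL xpq,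
  tri_perm quadL ypq).
(* Under this equation [p + al *: x] is an eigenvector for [nu], so ad a is diagonalizable on [U]
   modulo [z]. The equation can be solved for [al] unless nu = mu and [tri a p y] is nonzero. *)
have diag al : tri a p y = al * (nu - mu) ->
    exists2 lam, lam != 0 & isometric_iso L (r62 lam).
  move=> apy; have t' := (t, tri_perm quadL apy).
  exists (nu / mu).
    rewrite mulf_eq0 invr_eq0 (negPf mu0) orbF; apply/negP => /eqP nu0.
    rewrite nu0 in t'.
    have p'0 : p + al *: x = 0.
      apply: clU; first by rewrite memvD ?memvZ.
      apply: (central_in_abelian hz) => //; first by rewrite memvD ?memvZ.
      move=> u uU; rewrite -(subrK (phi y u *: x + phi x u *: y) u).
      move: (dec u uU); rewrite eU2; move: (u - _) => w wU2.
      rewrite (triDr quadL); suff -> : tri a (p + al *: x) w = 0.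
        by rewrite !(triE quadL) ?t'; ring.
      apply: (mem_span_seq (P := fun w => tri a (p + al *: x) w = 0)) wU2.
      - exact: (tri0r quadL).
      - by move=> b c Hb Hc; rewrite (triDr quadL) Hb Hc addr0.
      - by move=> b c Hc; rewrite (triZr quadL) Hc mulr0.
      - move=> r; rewrite !inE => /orP[] /eqP->; rewrite !(triE quadL) ?t'; ring.
    have : phi (p + al *: x) q = 0 by rewrite p'0 (phi0l quadL).
    by rewrite !(phiE quadL) !g mulr0 addr0 => /eqP; rewrite oner_eq0.
  apply: (isometric_iso_seq (s := [:: mu^-1 *: a; x;
    y - al *: q - be *: p - (al * be) *: x; p + al *: x; q + be *: x; mu *: z])) => //.
  - exact: quad_r62.
  - by check_phi (phi_r62 char2) (phiE quadL) g.
  - by check_tri (tri_r62 char2) (triE quadL) t'.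
have [nm|nm] := eqVneq nu mu; last first.
  left; apply: (diag (tri a p y / (nu - mu))); rewrite divfK //.
  by rewrite subr_eq0.
have [apy|s0] := eqVneq (tri a p y) 0.
  by left; apply: (diag 0); rewrite apy mul0r.
(* What remains is a nontrivial Jordan block; the factors [mu / s] and [s / mu] bring its
   off-diagonal entry to 1. *)
right; move: s0; move apy : (tri a p y) => s s0.
rewrite nm in t; have t' := (t, tri_perm quadL apy).
apply: (isometric_iso_seq (s := [:: mu^-1 *: a; (mu / s) *: p; x;
    y - be *: p; (s / mu) *: (q + be *: x); mu *: z])) => //.
- exact: quad_r63.
- by check_phi (phi_r63 char2) (phiE quadL) g.
- by check_tri (tri_r63 char2) (triE quadL) t'.
Qed.

End Dim6.

(** * Double extensions by a skew map in dimension 7 *)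

Section Dim7.
Variable F : closedFieldType.
Hypothesis char2 : (2 : F) != 0.
Variables (L : quad_alg F).
Hypothesis quadL : is_quadratic_lie L.
Hypothesis iso : forall z : L, central z -> phi z z = 0.
Implicit Types (x y z u v : L) (U W K : {vspace L}).

Let lieL : is_lie L := proj1 quadL.
Let sym := phi_sym quadL.

(* The double extension of an abelian U + <x, w> (orthogonal sum) by a, where *)
(* w is central as well.                                                      *)
Lemma double_extension_cases z a w x U :
    \dim (fullv : {vspace L}) = 7%N -> central z -> central w ->
    [/\ phi a a = 0, phi a z = 1 & phi z z = 0] ->
    [/\ phi x x = 0, phi x w = 1 & phi w w = 0] ->
    [/\ phi a x = 0, phi a w = 0, phi z x = 0 & phi z w = 0] ->
    (forall u, u \in U -> [/\ phi a u = 0, phi z u = 0, phi x u = 0 & phi w u = 0]) ->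
    nondeg_on U -> \dim U = 3%N ->
    (forall u v w, u \in U -> v \in U -> w \in U -> tri u v w = 0) ->
    (forall u v, u \in U -> v \in U -> tri x u v = 0) ->
    (forall v, v \in U -> (forall u, u \in U -> tri a v u = 0) ->
       tri a x v = 0 -> v = 0) ->
  isometric_iso L (r71 F) \/ isometric_iso L (r72 F).
Proof.
move=> dL cz cw [aa az zz] [xx xw ww] [ax aw zx zw] orthU nU dU abU xU nc.
have [|p [pU p0 ap]] := skew_odd_kernel char2 quadL a nU; first by rewrite dU.
(* A nonzero skew map of a 3-space is nilpotent exactly when its kernel is isotropic; the two cases
   lead to r71 and r72. *)
have [pp|pp] := eqVneq (phi p p) 0.
  left; have w00 : tri a x p != 0 by apply: contraNneq p0 => w0; apply/eqP/nc.
  have [y [U' [yU yp yy nU' [dU' /subvP UU' orth dec]]]] :=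
    hyper_split char2 quadL nU dU pU p0 pp.
  have [s [ss os eU']] :=
    orthonormal_basis char2 quadL nU' (esym (eq_add_S _ _ (eq_add_S _ _ dU'))).
  case: s ss os eU' => [|e []] //= _ [ee _ _] eU'.
  (* In r71 the middle vector x_3 has norm -1, so the unit vector is multiplied by a square root of
     -1. *)
  have [i i2] := closed_sqrt (-1 : F).
  have eIn : e \in U' by rewrite eU' memv_span ?inE ?eqxx.
  pose f := i *: e; have fU' : f \in U' by rewrite memvZ.
  have ff : phi f f = -1 by rewrite !(phiE quadL) ee mulr1 -expr2.
  have i0 : i != 0.
    apply/eqP => i0; move/eqP: i2; rewrite i0 expr0n eq_sym oppr_eq0.
    by rewrite oner_eq0.
  have ef : e = i^-1 *: f by rewrite /f scalerA mulVf ?scale1r.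
  have {ef eIn ee i2 i0} Uf u : u \in U' -> exists c, u = c *: f.
    rewrite eU' span_seq1 => /vlineP[c ->]; exists (c * i^-1).
    by rewrite -scalerA -ef.
  clearbody f; have fU := UU' f fU'; have [yf pf] := orth f fU'.
  have apy := ap y yU; have apf := ap f fU.
  move: w00; move eaxp: (tri a x p) => w0 w00.
  move eayf: (tri a y f) => s; have s0 : s != 0.
    apply/negP => /eqP s0; rewrite s0 in eayf.
    have v0 : w0 *: f - tri a x f *: p = 0.
      apply: nc; first by rewrite memvB ?memvZ.
        move=> u uU; rewrite -(subrK (phi y u *: p + phi p u *: y) u).
        have [c ->] := Uf _ (dec u uU).
        by rewrite !(triE quadL) ?(tri_perm quadL eayf) ?(tri_perm quadL apy)
          ?(tri_perm quadL apf); ring.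
      by rewrite !(triE quadL) eaxp; ring.
    have : phi (w0 *: f - tri a x f *: p) f = 0 by rewrite v0 (phi0l quadL).
    rewrite !(phiE quadL) ff pf mulrN1 mulr0 subr0 => /eqP.
    by rewrite oppr_eq0 (negPf w00).
  (* The numbers [al] and [be] make [tri a (x + al *: y + be *: f)] vanish on [y] and [f]; the
     multiples of the central [w] in the basis below restore the orthogonality relations at no cost
     to [tri]. *)
  pose be := tri a x y / s; have axy : tri a x y = be * s by rewrite divfK.
  pose al := - (tri a x f / s).
  have axf : tri a x f = - al * s by rewrite opprK divfK.
  clearbody be al.
  have [ap' zp xp wp] := orthU _ pU; have [ay zy xy wy] := orthU _ yU.
  have [af zf xf wf] := orthU _ fU.
  have g := (sym aa, sym az, sym zz, sym xx, sym xw, sym ww, sym ax, sym aw,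
    sym zx, sym zw, sym ap', sym zp, sym xp, sym wp, sym ay, sym zy, sym xy,
    sym wy, (sym af, sym zf, sym xf, sym wf, sym ff, sym yf, sym pf, sym yp,
    sym yy, sym pp)).
  have t := (tri_central quadL cz, tri_central quadL cw, tri_perm quadL apy,
    tri_perm quadL apf, tri_perm quadL eaxp, tri_perm quadL eayf,
    tri_perm quadL axy, tri_perm quadL axf,
    tri_perm quadL (abU p y f pU yU fU), tri_perm quadL (xU p y pU yU),
    tri_perm quadL (xU p f pU fU), tri_perm quadL (xU y f yU fU)).
  apply: (isometric_iso_seq (s := [:: - s^-1 *: a;
    (- s / w0) *: (x + al *: y + be *: f + (be ^+ 2 / 2) *: w); y; f + be *: w;
    p - al *: w; (w0 / s) *: w; - s *: z])) => //.
  - exact: quad_r71.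
  - by check_phi (phi_r71 char2) (phiE quadL) g.
  - by check_tri (tri_r71 char2) (triE quadL) t.
right; have [c ff] := unit_vector_of quadL pp; set f := c *: p in ff.
have fU : f \in U by rewrite memvZ.
have af : forall u, u \in U -> tri a f u = 0.
  by move=> u uU; rewrite (triZl quadL) || rewrite (triZm quadL) ap ?mulr0.
have f0 : f != 0.
  by apply/eqP => f0; move/eqP: ff; rewrite f0 (phi0l quadL) eq_sym oner_eq0.
clearbody f => {c p pU p0 ap pp}.
have w00 : tri a x f != 0 by apply: contraNneq f0 => w0; apply/eqP/nc.
have ff0 : phi f f != 0 by rewrite ff oner_neq0.
have nU' := nondeg_cap1 quadL nU fU ff0.
have dU' : \dim (U :&: orthv f) = 2%N.
  by apply/eq_add_S; rewrite -(dim_cap_orthv quadL fU ff0) dU.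
have [g [h [gg hh gh eU']]] := hyperbolic_basis char2 quadL nU' dU'.
have : (g \in (U :&: orthv f)%VS) && (h \in (U :&: orthv f)%VS).
  by rewrite eU' !memv_span ?inE ?eqxx ?orbT.
rewrite !memv_cap !mem_orthv // => /andP[/andP[gU /eqP fg] /andP[hU /eqP fh]].
have afg := af g gU; have afh := af h hU.
move: w00; move eaxf: (tri a x f) => w0 w00.
move eagh: (tri a g h) => s; have s0 : s != 0.
  apply/negP => /eqP s0; rewrite s0 in eagh.
  have v0 : w0 *: g - tri a x g *: f = 0.
    apply: nc; first by rewrite memvB ?memvZ.
      move=> u uU; rewrite -(subrK (phi f u *: f) u) (triDr quadL).
      have : u - phi f u *: f \in (U :&: orthv f)%VS.
        by rewrite memv_cap memvB ?memvZ // mem_orthv // !(phiE quadL) ff mulr1 subrr eqxx.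
      rewrite eU' span_cons span_seq1 => /memv_addP[_ /vlineP[b ->] [_ /vlineP[d ->] ->]].
      by rewrite !(triE quadL) ?(tri_perm quadL eagh) ?(tri_perm quadL afg)
        ?(tri_perm quadL afh); ring.
    by rewrite !(triE quadL) eaxf; ring.
  have : phi (w0 *: g - tri a x g *: f) h = 0 by rewrite v0 (phi0l quadL).
  by rewrite !(phiE quadL) gh fh mulr1 mulr0 subr0 => /eqP; rewrite (negPf w00).
pose be := tri a x g / s; have axg : tri a x g = be * s by rewrite divfK.
pose al := - (tri a x h / s).
have axh : tri a x h = - al * s by rewrite opprK divfK.
clearbody be al.
have [ag zg xg wg] := orthU _ gU; have [ah zh xh wh] := orthU _ hU.
have [af' zf xf wf] := orthU _ fU.
have G := (sym aa, sym az, sym zz, sym xx, sym xw, sym ww, sym ax, sym aw,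
  sym zx, sym zw, sym ag, sym zg, sym xg, sym wg, sym ah, sym zh, sym xh,
  sym wh, (sym af', sym zf, sym xf, sym wf, sym ff, sym fg, sym fh, sym gg,
  sym gh, sym hh)).
have t := (tri_central quadL cz, tri_central quadL cw, tri_perm quadL afg,
  tri_perm quadL afh, tri_perm quadL eaxf, tri_perm quadL eagh,
  tri_perm quadL axg, tri_perm quadL axh,
  tri_perm quadL (abU f g h fU gU hU), tri_perm quadL (xU f g fU gU),
  tri_perm quadL (xU f h fU hU), tri_perm quadL (xU g h gU hU)).
apply: (isometric_iso_seq (s := [:: s^-1 *: a; g - be *: w; h - al *: w;
  (s / w0) *: (x + al *: g + be *: h - (al * be) *: w); f;
  - (w0 / s) *: w; s *: z])) => //.
- exact: quad_r72.
- by check_phi (phi_r72 char2) (phiE quadL) G.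
- by check_tri (tri_r72 char2) (triE quadL) t.
Qed.

End Dim7.

Lemma cross_zero_parallel (F : fieldType) (a1 a2 a3 b1 b2 b3 : F) :
  a1 * b2 = a2 * b1 -> a1 * b3 = a3 * b1 -> a2 * b3 = a3 * b2 ->
  [/\ a1 = 0, a2 = 0 & a3 = 0] \/
  exists k, [/\ b1 = k * a1, b2 = k * a2 & b3 = k * a3].
Proof.
move=> h12 h13 h23.
have [a10|a1_neq0] := eqVneq a1 0; last first.
  right; exists (b1 / a1); split; apply: (mulfI a1_neq0);
    by rewrite ?h12 ?h13; field.
have [a20|a2_neq0] := eqVneq a2 0; last first.
  right; exists (b2 / a2); split; apply: (mulfI a2_neq0);
    by rewrite -?h12 ?h23; field.
have [a30|a3_neq0] := eqVneq a3 0; first by left.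
right; exists (b3 / a3); split; apply: (mulfI a3_neq0);
    by rewrite -?h13 -?h23; field.
Qed.

(** * Dimension 7 with a centre of dimension 2 *)

Section Dim7.
Variable F : closedFieldType.
Hypothesis char2 : (2 : F) != 0.
Variables (L : quad_alg F).
Hypothesis quadL : is_quadratic_lie L.
Hypothesis solL : solvable_lie L.
Hypothesis iso : forall z : L, central z -> phi z z = 0.
Implicit Types (x y z u v : L) (U W K : {vspace L}).

Let lieL : is_lie L := proj1 quadL.
Let sym := phi_sym quadL.

Lemma tri_zero_on_span2 (s : seq L) x :
  (forall p q, p \in s -> q \in s -> tri x p q = 0) ->
  forall v w, v \in <<s>>%VS -> w \in <<s>>%VS -> tri x v w = 0.
Proof.
move=> s0 v w vs ws.
apply: (mem_span_seq (P := fun v => tri x v w = 0)) vs => [|y y' Hx Hy|c y Hx|q qs].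
- exact: (tri0m quadL).
- by rewrite (triDm quadL) Hx Hy addr0.
- by rewrite (triZm quadL) Hx mulr0.
apply: (mem_span_seq (P := fun w => tri x q w = 0)) ws => [|y y' Hx Hy|c y Hx|r rs].
- exact: (tri0r quadL).
- by rewrite (triDr quadL) Hx Hy addr0.
- by rewrite (triZr quadL) Hx mulr0.
exact: s0.
Qed.

(* If tri e1 e2 e3 were nonzero the e_i would span a copy of sl_2 modulo K.   *)
Lemma orthonormal3_tri_zero K (e1 e2 e3 : L) :
    (forall k k', k \in K -> k' \in K -> bracket k k' \in K) ->
    (forall k, k \in K ->
      [/\ bracket e1 k \in K, bracket e2 k \in K & bracket e3 k \in K]) ->
    (forall p q, p \in [:: e1; e2; e3] -> q \in [:: e1; e2; e3] ->
       bracket p q - \sum_(e <- [:: e1; e2; e3]) tri p q e *: e \in K) ->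
    e1 \notin K ->
  tri e1 e2 e3 = 0.
Proof.
move=> KK UK ex e1K; move et: (tri e1 e2 e3) => t.
have [//|t0] := eqVneq t 0.
have := ex e1 e2; have := ex e2 e3; have := ex e3 e1.
rewrite !inE !eqxx !orbT !big_cons !big_nil !(triE quadL) !(tri_perm quadL et).
rewrite !scale0r !addr0 !add0r => /(_ isT isT) b31 /(_ isT isT) b23 /(_ isT isT) b12.
by case/negP: e1K; apply: (solvable_no_sl2 lieL solL t0 KK UK b12 b23 b31).
Qed.

(** Once sl_2 is excluded, [tri] vanishes on [U], and [x1] and [x2] act on [U] by skew maps. These
    turn out to be proportional, so some vector of <x1, x2> acts by zero, which is the situation of
    a double extension by a single skew map. *)
Lemma dim7_rank5_cases z1 x1 U1 z2 x2 U : hpair fullv z1 x1 U1 ->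
    hpair U1 z2 x2 U -> z2 \in U1 -> centerless U -> \dim U = 3%N ->
  isometric_iso L (r71 F) \/ isometric_iso L (r72 F).
Proof.
move=> h1 h2 z2U1 clU dU3.
have [cz1 x11 xz1 z11 [_ nU1 dU1 [_ x1U z1U] _]] := h1.
have [cz2 x22 xz2 z22 [x2U1 nU dU [/subvP UU1 x2U z2U] _]] := h2.
have dL : \dim (fullv : {vspace L}) = 7%N by rewrite dU1 dU dU3.
have [s [ss os eU]] := orthonormal_basis char2 quadL nU dU3.
case: s ss os eU => [|e1 [|e2 [|e3 []]]] //= _ os eU.
have [e11 _ _] := os.
have [e1U e2U e3U] : [/\ e1 \in U, e2 \in U & e3 \in U].
  by rewrite eU; split; rewrite memv_span ?inE ?eqxx ?orbT.
have h2' := h2; rewrite eU in h2'.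
have ex := bracket_expands2 char2 quadL iso h1 h2' os.
have sp := hpair_spans2 quadL h1 h2'.
have t123 : tri e1 e2 e3 = 0.
  apply: (orthonormal3_tri_zero (K := centerv L)) => //.
  - by move=> k k' /(mem_centerP quadL) ck _; rewrite ck mem0v.
  - by move=> k /(mem_centerP quadL) ck; rewrite !(centralr lieL) ?mem0v.
  - apply/negP => /(mem_centerP quadL) /iso; rewrite e11 => /eqP.
    by rewrite oner_eq0.
have abU : forall u v w, u \in U -> v \in U -> w \in U -> tri u v w = 0.
  rewrite eU; apply: (tri_zero_on_span quadL) => p q r; rewrite !inE.
  by move=> /or3P[] /eqP-> /or3P[] /eqP-> /or3P[] /eqP->;
    rewrite ?(triE quadL) ?(tri_perm quadL t123) ?oppr0.
have nc v : v \in U -> (forall u, u \in U -> tri x1 v u = 0) ->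
    (forall u, u \in U -> tri x2 v u = 0) -> tri x1 x2 v = 0 -> v = 0.
  move=> vU v1 v2 v12; apply: clU => //; apply: (tri_span quadL sp) => p q.
  have sU r : r \in [:: e1; e2; e3] -> r \in U by move=> rs; rewrite eU memv_span.
  have t12 := tri_perm quadL v12.
  rewrite ![_ \in [:: x1, x2 & _]]inE ![_ \in x2 :: _]inE.
  move=> /or3P[/eqP->|/eqP->|/sU pU] /or3P[/eqP->|/eqP->|/sU qU];
    rewrite ?(triE quadL) ?t12 ?oppr0 //.
  - by rewrite (tri_perm quadL (v1 q qU)) oppr0.
  - by rewrite (tri_perm quadL (v2 q qU)) oppr0.
  - by rewrite (tri_perm quadL (v1 p pU)).
  - by rewrite (tri_perm quadL (v2 p pU)).
  - exact: abU.
have orthU u : u \in U ->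
    [/\ phi x1 u = 0, phi z1 u = 0, phi x2 u = 0 & phi z2 u = 0].
  by move=> uU; rewrite x1U ?z1U ?x2U ?z2U ?UU1.
have g := (sym x11, sym xz1, sym z11, sym x22, sym xz2, sym z22,
  sym (x1U _ x2U1), sym (x1U _ z2U1), sym (z1U _ x2U1), sym (z1U _ z2U1)).
(* Skew maps of a 3-space correspond to vectors, with the commutator as cross product. Since [tri]
   vanishes on [U], [x1, x2] acts on [U] by zero modulo the centre, so the Jacobi identity says that
   the cross product of the vectors of [x1] and [x2] is zero. *)
have rank1 : [/\ tri x1 e2 e3 = 0, tri x1 e3 e1 = 0 & tri x1 e1 e2 = 0] \/
    exists k, [/\ tri x2 e2 e3 = k * tri x1 e2 e3, tri x2 e3 e1 = k * tri x1 e3 e1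
      & tri x2 e1 e2 = k * tri x1 e1 e2].
  have J12 := jacobi4 quadL x1 x2 e1 e2; have J13 := jacobi4 quadL x1 x2 e1 e3.
  have J23 := jacobi4 quadL x1 x2 e2 e3; move: J12 J13 J23.
  rewrite !(jacobi_expand quadL _ _ _ _ ex) !big_cons !big_nil.
  move a1: (tri x1 e2 e3) => A1; move a2: (tri x1 e3 e1) => A2.
  move a3: (tri x1 e1 e2) => A3; move b1: (tri x2 e2 e3) => B1.
  move b2: (tri x2 e3 e1) => B2; move b3: (tri x2 e1 e2) => B3.
  have t := (tri_perm quadL t123, tri_perm quadL a1, tri_perm quadL a2,
    tri_perm quadL a3, tri_perm quadL b1, tri_perm quadL b2, tri_perm quadL b3).
  rewrite !(triE quadL) !t => J12 J13 J23.
  apply: cross_zero_parallel; apply/eqP; rewrite -subr_eq0; apply/eqP.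
  - by apply: oppr_inj; rewrite oppr0; apply: etrans J12; ring.
  - by apply: oppr_inj; rewrite oppr0; apply: etrans J13; ring.
  - by apply: oppr_inj; rewrite oppr0; apply: etrans J23; ring.
have zero_on_U x : tri x e2 e3 = 0 -> tri x e3 e1 = 0 -> tri x e1 e2 = 0 ->
    forall u v, u \in U -> v \in U -> tri x u v = 0.
  move=> a1 a2 a3; rewrite eU; apply: tri_zero_on_span2 => p q; rewrite !inE.
  move=> /or3P[] /eqP-> /or3P[] /eqP->;
  by rewrite ?(triE quadL) ?(tri_perm quadL a1) ?(tri_perm quadL a2)
    ?(tri_perm quadL a3) ?oppr0.
case: rank1 => [[a1 a2 a3] | [k [b1 b2 b3]]].
  apply: (double_extension_cases char2 quadL (z := z2) (a := x2) (w := z1) (x := x1)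
    dL cz2 cz1 _ _ _ _ nU dU3 abU (zero_on_U x1 a1 a2 a3)); rewrite ?g //.
    by move=> u /orthU[].
  move=> v vU v2 v21; apply: nc => // [u uU|].
    by rewrite (zero_on_U x1).
  by rewrite (triC12 quadL) v21 oppr0.
have x'U : forall u v, u \in U -> v \in U -> tri (x2 - k *: x1) u v = 0.
  by apply: zero_on_U; rewrite !(triE quadL) ?b1 ?b2 ?b3; ring.
(* Replacing [x2] by [x2 - k *: x1] forces [z1] to be replaced by [z1 + k *: z2], which is
   orthogonal to it. *)
apply: (double_extension_cases char2 quadL (z := z1 + k *: z2) (a := x1) (w := z2)
    (x := x2 - k *: x1) dL _ cz2 _ _ _ _ nU dU3 abU x'U).
- by apply: (centralD lieL) => //; apply: (centralZ lieL).
- by rewrite !(phiE quadL) !g; split; ring.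
- by rewrite !(phiE quadL) !g; split; ring.
- by rewrite !(phiE quadL) !g; split; ring.
- by move=> u /orthU[p1 p2 p3 p4]; rewrite !(phiE quadL) p1 p2 p3 p4; split; ring.
move=> v vU v1; rewrite !(triE quadL) mulr0 oppr0 addr0 => v12.
apply: nc => // u uU; have := x'U v u vU uU.
by rewrite !(triE quadL) v1 // mulr0 oppr0 addr0.
Qed.

End Dim7.

(** * Dimension 7 with a centre of dimension 1 *)

Section Dim7.
Variable F : closedFieldType.
Hypothesis char2 : (2 : F) != 0.
Variables (L : quad_alg F).
Hypothesis quadL : is_quadratic_lie L.
Implicit Types (x y z u v w : L) (U W K : {vspace L}).

Let lieL : is_lie L := proj1 quadL.
Let sym := phi_sym quadL.

(* w1 and w2 are eigenvectors of ad a for the eigenvalues mu and - mu; the    *)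
(* numbers al, be, ga are the components of the inner part of ad a.           *)
Lemma r75_of_frame z a x1 x2 y w1 w2 mu k n1 n2 al be ga
    (d := k ^+ 2 + n1 * n2) :
  \dim (fullv : {vspace L}) = 7%N -> central z -> mu != 0 -> d != 0 ->
  [/\ phi a a = 0, phi a z = 1 & phi z z = 0] ->
  [/\ phi a x1 = 0, phi a x2 = 0, phi a y = 0, phi a w1 = 0 & phi a w2 = 0] ->
  [/\ phi z x1 = 0, phi z x2 = 0, phi z y = 0, phi z w1 = 0 & phi z w2 = 0] ->
  [/\ phi x1 x1 = 0, phi x1 x2 = 0, phi x2 x2 = 0 & phi y y = 1] ->
  [/\ phi x1 y = 0, phi x2 y = 0, phi w1 y = 0 & phi w2 y = 0] ->
  [/\ phi w1 w1 = 0, phi w1 w2 = 0 & phi w2 w2 = 0] ->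
  [/\ phi w1 x1 = k, phi w1 x2 = n1, phi w2 x1 = n2 & phi w2 x2 = - k] ->
  [/\ tri x1 x2 y = 1, tri a x1 x2 = - ga, tri a x2 y = - al & tri a x1 y = be] ->
  [/\ tri a w1 x1 = mu * k, tri a w1 x2 = mu * n1, tri a w2 x1 = - mu * n2 &
      tri a w2 x2 = mu * k] ->
  [/\ tri a w1 y = 0, tri a w2 y = 0 & tri a w1 w2 = 0] ->
  [/\ tri w1 w2 x1 = 0, tri w1 w2 x2 = 0 & tri w1 w2 y = 0] ->
  [/\ tri w1 x1 x2 = 0, tri w1 x1 y = 0 & tri w1 x2 y = 0] ->
  [/\ tri w2 x1 x2 = 0, tri w2 x1 y = 0 & tri w2 x2 y = 0] ->
  isometric_iso L (r75 F).
Proof.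
move=> dL cz mu0 d0 [aa az zz] [ax1 ax2 ay aw1 aw2] [zx1 zx2 zy zw1 zw2].
move=> [x11 x12 x22 yy] [x1y x2y w1y w2y] [w11 w12 w22] [p11 p12 p21 p22].
move=> [t1 t2 t3 t4] [t5 t6 t7 t8] [t9 t10 t11] [t12 t13 t14].
move=> [t15 t16 t17] [t18 t19 t20]; rewrite /d in d0.
have g := (sym aa, sym az, sym zz, sym ax1, sym ax2, sym ay, sym aw1, sym aw2,
  sym zx1, sym zx2, sym zy, sym zw1, sym zw2, sym x11, sym x12, sym x22,
  sym yy, (sym x1y, sym x2y, sym w1y, sym w2y, sym w11, sym w12, sym w22,
  sym p11, sym p12, sym p21, sym p22)).
have t := (tri_central quadL cz, tri_perm quadL t1, tri_perm quadL t2,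
  tri_perm quadL t3, tri_perm quadL t4, tri_perm quadL t5, tri_perm quadL t6,
  tri_perm quadL t7, tri_perm quadL t8, tri_perm quadL t9, tri_perm quadL t10,
  (tri_perm quadL t11, tri_perm quadL t12, tri_perm quadL t13,
  tri_perm quadL t14, tri_perm quadL t15, tri_perm quadL t16,
  tri_perm quadL t17, tri_perm quadL t18, tri_perm quadL t19,
  tri_perm quadL t20)).
(* The correction of [a] cancels its action by inner derivations on x1, x2 and y. The second and
   third vectors form the basis of <x1, x2> dual, up to factors, to [w2] and [w1]; the multiples of
   [z] restore orthogonality to the corrected [a]. *)
apply: (isometric_iso_seq (s := [::
  mu^-1 *: (a + al *: x1 + be *: x2 + ga *: y - (ga ^+ 2 / 2) *: z);
  k *: x2 - n1 *: x1; - ((k / d) *: x1 + (n2 / d) *: x2); y - ga *: z;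
  w1 - (al * k + be * n1) *: z;
  - d^-1 *: w2 + ((al * n2 - be * k) / d) *: z; - mu *: z])) => //; rewrite ?/d.
- exact: quad_r75.
- by check_phi (phi_r75 char2) (phiE quadL) g.
- by check_tri (tri_r75 char2) (triE quadL) t.
Qed.

End Dim7.

Section Dim7.
Variable F : closedFieldType.
Hypothesis char2 : (2 : F) != 0.
Variables (L : quad_alg F).
Hypothesis quadL : is_quadratic_lie L.
Hypothesis solL : solvable_lie L.
Hypothesis iso : forall z : L, central z -> phi z z = 0.
Implicit Types (x y z u v w : L) (U W K : {vspace L}).

Let lieL : is_lie L := proj1 quadL.
Let sym := phi_sym quadL.

Lemma orthonormal_cons U f (s : seq L) : f \in U -> phi f f = 1 ->
  (U :&: orthv f)%VS = <<s>>%VS -> orthonormal_seq s ->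
  orthonormal_seq (f :: s) /\ U = <<f :: s>>%VS.
Proof.
move=> fU ff es os; split.
  split=> //; have : {subset s <= orthv f}.
    by move=> e /memv_span; rewrite -es memv_cap => /andP[].
  elim: s {es os} => //= e s IHs sub; split.
    by apply/eqP; rewrite -mem_orthv // sub ?inE ?eqxx.
  by apply: IHs => e' e's; rewrite sub ?inE ?e's ?orbT.
apply/vspaceP => u; rewrite span_cons -es; apply/idP/idP => [uU|].
  rewrite -(subrK (phi f u *: f) u) addrC memv_add ?memvZ ?memv_line //.
  rewrite memv_cap memvB ?memvZ // mem_orthv // !(phiE quadL) ff mulr1.
  by rewrite subrr eqxx.
case/memv_addP=> _ /vlineP[c ->] [w + ->]; rewrite memv_cap => /andP[wU _].
by rewrite memvD ?memvZ.
Qed.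

Variables (z a : L) (U : {vspace L}).
Hypothesis hz : hpair fullv z a U.
Hypothesis clU : centerless U.
Hypothesis dU : \dim U = 5%N.

Definition abelian_on U := forall u v w,
  u \in U -> v \in U -> w \in U -> tri u v w = 0.

(** [U] has odd dimension, so the skew map given by ad a kills a nonzero vector of [U]; if [tri]
    vanished on [U], this vector would be central. *)
Lemma rank6_not_abelian : ~ abelian_on U.
Proof.
move=> abU; have [_ _ _ _ [_ nU _ _ _]] := hz.
have [|x [xU x0 ax]] := skew_odd_kernel char2 quadL a nU; first by rewrite dU.
case/eqP: x0; apply: clU => //; apply: (hpair_central quadL hz) => // u w uU wU.
exact: abU.
Qed.

(** The centre of z^perp / <z>, found without forming the quotient. If [U, U], z and a spanned L,
    then [U] would lie in [U, U] + <z>, hence in <z> by absorption, against dim U = 5; a vector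
    orthogonal to that span is the required one. *)
Lemma rank6_center : exists b, [/\ b \in U, b != 0 &
  forall u v, u \in U -> v \in U -> tri b u v = 0].
Proof.
have [cz aa az zz [_ nU _ [_ aU zU] dec]] := hz.
pose W := (derived_alg U + (<[z]> + <[a]>))%VS.
have Wf : W != fullv.
  apply/eqP => Wf.
  have : (U <= <[z]>)%VS.
    apply: (solvable_absorb lieL solL).
    - by move=> u k _ /vlineP[c ->]; rewrite (brZr lieL) (centralr lieL) // scaler0 mem0v.
    - by move=> k k' /vlineP[c ->] _; rewrite (brZl lieL) cz scaler0 mem0v.
    apply/subvP => u uU; have : u \in W by rewrite Wf memvf.
    case/memv_addP=> d dD [_ /memv_addP[_ /vlineP[c ->] [_ /vlineP[e ->] ->]] eu].
    have zd : phi z d = 0.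
      apply/eqP; rewrite -mem_orthv //; apply: subvP dD.
      apply/(derived_algP _ _ lieL).1 => r t _ _.
      by rewrite mem_orthv // bracket_perp_center.
    have : phi z u = 0 by exact: zU.
    rewrite eu !(phiE quadL) zd zz (phiC quadL z a) az mulr0 mulr1 !add0r => e0.
    by rewrite e0 scale0r addr0 memv_add ?memvZ ?memv_line.
  by move/dimvS; rewrite dU dim_vline; case: (z != 0).
have [b b0 bW] := perp_exists quadL Wf.
have zW : z \in W by rewrite (subvP (addvSr _ _)) // (subvP (addvSl _ _)) ?memv_line.
have aW : a \in W by rewrite (subvP (addvSr _ _)) // (subvP (addvSr _ _)) ?memv_line.
have bU : b \in U.
  have := dec b (memvf b); rewrite [phi a b](phiC quadL) [phi z b](phiC quadL).
  by rewrite !bW // !scale0r addr0 subr0.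
exists b; split=> // u v uU vU; rewrite -(tri_cycle quadL) /tri (phiC quadL) bW //.
by rewrite (subvP (addvSl _ _)) // mem_derived.
Qed.

(** With two orthonormal vectors in the kernel, [tri] on [U] lives on a 3-space, where a nonzero
    value would give sl_2; so [U] would be abelian. *)
Lemma rank6_no_orthogonal_pair f g : f \in U -> g \in U ->
    phi f f = 1 -> phi g g = 1 -> phi f g = 0 ->
    (forall u v, u \in U -> v \in U -> tri f u v = 0) ->
    (forall u v, u \in U -> v \in U -> tri g u v = 0) -> False.
Proof.
move=> fU gU ff gg fg fT gT; apply: rank6_not_abelian.
have [cz _ _ _ [_ nU _ _ _]] := hz.
have ff0 : phi f f != 0 by rewrite ff oner_neq0.
have gg0 : phi g g != 0 by rewrite gg oner_neq0.
have nE := nondeg_cap1 quadL nU fU ff0.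
have gE : g \in (U :&: orthv f)%VS by rewrite memv_cap gU mem_orthv // fg eqxx.
have nE' := nondeg_cap1 quadL nE gE gg0.
have dE' : \dim ((U :&: orthv f) :&: orthv g) = 3%N.
  apply/eq_add_S; rewrite -(dim_cap_orthv quadL gE gg0).
  by apply/eq_add_S; rewrite -(dim_cap_orthv quadL fU ff0) dU.
have [s [ss os eE']] := orthonormal_basis char2 quadL nE' dE'.
have [os' eE] := orthonormal_cons gE gg eE' os.
have [os'' eU] := orthonormal_cons fU ff eE os'.
case: s ss os eE' os' eE os'' eU => [|e1 [|e2 [|e3 []]]] //= _ os _ _ _ os'' eU.
have sU e : e \in [:: f; g; e1; e2; e3] -> e \in U by rewrite eU; apply: memv_span.
have h := hz; rewrite eU in h; have ex := bracket_expands1 quadL h os''.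
have sub e : e \in [:: e1; e2; e3] -> e \in U.
  by move=> es; apply: sU; rewrite !(inE, in_cons) in es *; rewrite es !orbT.
have t123 : tri e1 e2 e3 = 0.
  apply: (orthonormal3_tri_zero quadL solL (K := centerv L)) => //.
  - by move=> k k' /(mem_centerP quadL) ck _; rewrite ck mem0v.
  - by move=> k /(mem_centerP quadL) ck; rewrite !(centralr lieL) ?mem0v.
  - move=> p q /sub pU /sub qU; have := ex p q; rewrite !big_cons.
    have -> : tri p q f = 0 by rewrite -(tri_cycle quadL) -(tri_cycle quadL) fT.
    have -> : tri p q g = 0 by rewrite -(tri_cycle quadL) -(tri_cycle quadL) gT.
    by rewrite !scale0r !add0r.
  - have [e11 _ _] := os; apply/negP => /(mem_centerP quadL) /iso.
    by rewrite e11 => /eqP; rewrite oner_eq0.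
rewrite /abelian_on {1 2 3}eU; apply: (tri_zero_on_span quadL) => p q r ps qs rs.
have pU := sU p ps; have qU := sU q qs; have rU := sU r rs.
move: ps qs rs; rewrite ![_ \in f :: _]inE ![_ \in g :: _]inE.
case/or3P=> [/eqP->|/eqP->|ps]; rewrite ?fT ?gT // => qs rs.
case/or3P: qs => [/eqP->|/eqP->|qs]; rewrite 1?(triC12 quadL) ?fT ?gT ?oppr0 //.
case/or3P: rs => [/eqP->|/eqP->|rs].
- by rewrite -(tri_cycle quadL) -(tri_cycle quadL) fT ?oppr0.
- by rewrite -(tri_cycle quadL) -(tri_cycle quadL) gT ?oppr0.
move: ps qs rs; rewrite !inE.
by move=> /or3P[] /eqP-> /or3P[] /eqP-> /or3P[] /eqP->;
    rewrite ?(triE quadL) ?(tri_perm quadL t123) ?oppr0.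
Qed.

(** Otherwise [tri] on [U] lives on the 4-space orthogonal to [b], and its kernel vector [c] there
    is a second kernel vector on [U]. If [c] is not isotropic, [b] and [c] form an excluded
    orthogonal pair. If it is isotropic, ad a kills it, so [c] is central and zero, and [U] is
    abelian; both are contradictory. *)
Lemma rank6_isotropic b : b \in U ->
  (forall u v, u \in U -> v \in U -> tri b u v = 0) -> phi b b = 0.
Proof.
move=> bU bT; have [//|bb] := eqVneq (phi b b) 0; exfalso.
have [al] := unit_vector_of quadL bb; move efb : (al *: b) => f ff.
have fU : f \in U by rewrite -efb memvZ.
have {bU bT bb efb} fT u v : u \in U -> v \in U -> tri f u v = 0.
  by move=> uU vU; rewrite -efb (triZl quadL) bT ?mulr0.
have [cz _ _ _ [_ nU _ _ _]] := hz.
have ff0 : phi f f != 0 by rewrite ff oner_neq0.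
have nE := nondeg_cap1 quadL nU fU ff0.
have dE : \dim (U :&: orthv f) = 4%N.
  by apply/eq_add_S; rewrite -(dim_cap_orthv quadL fU ff0) dU.
have [s [ss os eE]] := orthonormal_basis char2 quadL nE dE.
have [os' eU] := orthonormal_cons fU ff eE os.
case: s ss os eE os' eU => [|e1 [|e2 [|e3 [|e4 []]]]] //= _ os _ os' eU.
have sU e : e \in [:: f; e1; e2; e3; e4] -> e \in U by rewrite eU; apply: memv_span.
have h := hz; rewrite eU in h; have ex := bracket_expands1 quadL h os'.
have [fU' e1U e2U e3U e4U] : [/\ f \in U, e1 \in U, e2 \in U, e3 \in U & e4 \in U].
  by split; apply: sU; rewrite !inE eqxx ?orbT.
have sub e : e \in [:: e1; e2; e3; e4] -> e \in U.
  by move=> es; apply: sU; rewrite in_cons es orbT.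
have Tf p q : p \in U -> q \in U -> tri p q f = 0.
  by move=> pU qU; rewrite -(tri_cycle quadL) -(tri_cycle quadL) fT.
have ac := @jacobi_kernel4 F L quadL e1 e2 e3 e4 a.
have ct := @tri_kernel4 F L quadL e1 e2 e3 e4.
move: ac ct; set c := _ - tri e1 e2 e3 *: e4 => ac ct.
have {}ac p : p \in [:: e1; e2; e3; e4] -> tri a c p = 0.
  apply: ac => {}p q r /sub pU /sub qU _.
  by rewrite (jacobi_expand quadL _ _ _ _ ex) big_cons Tf // mul0r add0r.
have cU : c \in U.
  by apply: memvB; [apply: memvD; [apply: memvB|]|]; apply: memvZ.
have cT u v : u \in U -> v \in U -> tri c u v = 0.
  rewrite {1 2}eU; apply: (tri_zero_on_span2 quadL) => p q; rewrite ![_ \in f :: _]inE.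
  move=> /orP[/eqP->|ps] /orP[/eqP->|qs].
  - exact: (triyy quadL).
  - by rewrite (triC23 quadL) (Tf c q cU (sub q qs)) oppr0.
  - exact: Tf cU (sub p ps).
  - exact: ct.
have J12 := jacobi4 quadL f e1 e2 a; have J13 := jacobi4 quadL f e1 e3 a.
have J14 := jacobi4 quadL f e1 e4 a; have J23 := jacobi4 quadL f e2 e3 a.
have J24 := jacobi4 quadL f e2 e4 a; have J34 := jacobi4 quadL f e3 e4 a.
rewrite !(jacobi_expand quadL _ _ _ _ ex) !big_cons !big_nil in J12 J13 J14 J23 J24 J34.
have fc : phi f c = 0.
  have [_ [f1 [f2 [f3 [f4 _]]]] _] := os'.
  by rewrite /c !(phiE quadL) f1 f2 f3 f4; ring.
have cc : phi c c = tri e2 e3 e4 ^+ 2 + tri e1 e3 e4 ^+ 2 + tri e1 e2 e4 ^+ 2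
    + tri e1 e2 e3 ^+ 2.
  have [e11 [e12 [e13 [e14 _]]] [e22 [e23 [e24 _]] [e33 [e34 _] [e44 _ _]]]] := os.
  by rewrite /c !(phiE quadL) !(sym e11, sym e12, sym e13, sym e14, sym e22,
    sym e23, sym e24, sym e33, sym e34, sym e44); ring.
have acf : tri a c f = tri e2 e3 e4 * tri f a e1 - tri e1 e3 e4 * tri f a e2
   + tri e1 e2 e4 * tri f a e3 - tri e1 e2 e3 * tri f a e4.
  by rewrite /c !(triE quadL) -!(tri_cycle quadL f).
have c_neq0 : c != 0.
  apply/eqP => c0; apply: rank6_not_abelian => u v w; rewrite {1 2 3}eU => us vs ws.
  have co p : phi p c = 0 by rewrite c0 (phi0r quadL).
  have [e11 [e12 [e13 [e14 _]]] [e22 [e23 [e24 _]] [e33 [e34 _] [e44 _ _]]]] := os.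
  have g := (sym e11, sym e12, sym e13, sym e14, sym e22, sym e23, sym e24,
    sym e33, sym e34, sym e44).
  move: (co e1) (co e2) (co e3) (co e4); rewrite /c !(phiE quadL) !g.
  rewrite ?(mulr0, mulr1, addr0, add0r, oppr0).
  move=> t1 /eqP + t3 /eqP; rewrite !oppr_eq0 => /eqP t2 /eqP t4.
  have t := (tri_perm quadL t1, tri_perm quadL t2, tri_perm quadL t3,
    tri_perm quadL t4).
  apply: (tri_zero_on_span quadL) us vs ws => p q r ps qs rs.
  have pU := sU p ps; have qU := sU q qs; have rU := sU r rs; move: ps qs rs.
  rewrite ![_ \in f :: _]inE => /orP[/eqP->|ps]; first by rewrite fT.
  move=> /orP[/eqP->|qs]; first by rewrite (triC12 quadL) fT ?oppr0.
  move=> /orP[/eqP->|rs]; first by rewrite Tf.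
  move: ps qs rs; rewrite !inE.
  by move=> /or4P[] /eqP-> /or4P[] /eqP-> /or4P[] /eqP->;
    rewrite ?(triE quadL) ?t ?oppr0.
have [ccz|ccz] := eqVneq (phi c c) 0; last first.
  have [k kk] := unit_vector_of quadL ccz.
  apply: (rank6_no_orthogonal_pair fU _ ff kk) => //.
  - by rewrite memvZ.
  - by rewrite (phiZr quadL) fc mulr0.
  - by move=> u v uU vU; rewrite (triZl quadL) cT ?mulr0.
(* The Jacobi identities for [f], two of the [e_i] and [a] say that the coordinate vector t of [c]
   and the vector d representing [tri f a] on the [e_i] are parallel. Then t_i (t.d) = d_i (t.t) = 0
   because [c] is isotropic; so if t.d, which is [tri a c f], were nonzero, [c] would vanish. *)
have acf0 : tri a c f = 0.
  apply/eqP; apply: contraNT c_neq0; rewrite acf.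
  have t0 := (tri_perm quadL (fT _ _ e1U e2U), tri_perm quadL (fT _ _ e1U e3U),
    tri_perm quadL (fT _ _ e1U e4U), tri_perm quadL (fT _ _ e2U e3U),
    tri_perm quadL (fT _ _ e2U e4U), tri_perm quadL (fT _ _ e3U e4U)).
  move: J12 J13 J14 J23 J24 J34 ccz; rewrite cc /c.
  move E1: (tri f a e1) => d1; move E2: (tri f a e2) => d2.
  move E3: (tri f a e3) => d3; move E4: (tri f a e4) => d4.
  move E234: (tri e2 e3 e4) => t234; move E134: (tri e1 e3 e4) => t134.
  move E124: (tri e1 e2 e4) => t124; move E123: (tri e1 e2 e3) => t123.
  have t := (tri_perm quadL E123, tri_perm quadL E124, tri_perm quadL E134,
    tri_perm quadL E234).
  rewrite ?t0 ?t ?(triE quadL) ?E1 ?E2 ?E3 ?E4.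
  rewrite ?(mul0r, oppr0, addr0, add0r, mulr0) => J12 J13 J14 J23 J24 J34 Q0.
  move=> X0; have kill (x : F) : x * (t234 * d1 - t134 * d2 + t124 * d3 - t123 * d4) = 0 ->
      x = 0.
    by move/eqP; rewrite mulf_eq0 (negPf X0) orbF => /eqP.
  pose Q := t234 ^+ 2 + t134 ^+ 2 + t124 ^+ 2 + t123 ^+ 2; rewrite -/Q in Q0.
  have -> : t234 = 0.
    apply: kill; transitivity (d1 * Q - t134 * (t134 * d1 + t234 * d2)
      - t124 * (t124 * d1 + - t234 * d3) - t123 * (t123 * d1 + t234 * d4)).
      by rewrite /Q; ring.
    by rewrite Q0 J34 J24 J23; ring.
  have -> : t134 = 0.
    apply: kill; transitivity (- d2 * Q + t234 * (t134 * d1 + t234 * d2)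
      - t124 * (- t124 * d2 + - t134 * d3) - t123 * (- t123 * d2 + t134 * d4)).
      by rewrite /Q; ring.
    by rewrite Q0 J34 J14 J13; ring.
  have -> : t124 = 0.
    apply: kill; transitivity (d3 * Q + t234 * (t124 * d1 + - t234 * d3)
      + t134 * (- t124 * d2 + - t134 * d3) - t123 * (t123 * d3 + t124 * d4)).
      by rewrite /Q; ring.
    by rewrite Q0 J24 J14 J12; ring.
  have -> : t123 = 0.
    apply: kill; transitivity (- d4 * Q + t234 * (t123 * d1 + t234 * d4)
      + t134 * (- t123 * d2 + t134 * d4) + t124 * (t123 * d3 + t124 * d4)).
      by rewrite /Q; ring.
    by rewrite Q0 J23 J13 J12; ring.
  by rewrite !scale0r !(subr0, addr0).
have ac0 u : u \in U -> tri a c u = 0.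
  rewrite {1}eU; apply: (mem_span_seq (P := fun u => tri a c u = 0)).
  - exact: (tri0r quadL).
  - by move=> x y Hx Hy; rewrite (triDr quadL) Hx Hy addr0.
  - by move=> k x Hx; rewrite (triZr quadL) Hx mulr0.
  - by move=> p; rewrite in_cons => /orP[/eqP->|/ac].
by case/eqP: c_neq0; apply: clU cU _; apply: (hpair_central quadL hz).
Qed.
End Dim7.

Section Dim7.
Variable F : closedFieldType.
Hypothesis char2 : (2 : F) != 0.
Variables (L : quad_alg F).
Hypothesis quadL : is_quadratic_lie L.
Hypothesis solL : solvable_lie L.
Hypothesis iso : forall z : L, central z -> phi z z = 0.
Implicit Types (x y z u v w : L) (U W K : {vspace L}).

Let lieL : is_lie L := proj1 quadL.
Let sym := phi_sym quadL.

Variables (z a : L) (U : {vspace L}).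
Hypothesis hz : hpair fullv z a U.
Hypothesis clU : centerless U.
Hypothesis dU : \dim U = 5%N.

(* Modulo z, U is the algebra r5.                                             *)
Lemma rank6_frame : exists c1 x1 c2 x2 y, [/\
  [/\ c1 \in U, c2 \in U, x1 \in U, x2 \in U & y \in U],
  [/\ phi c1 c1 = 0, phi c1 c2 = 0, phi c2 c2 = 0, phi c1 y = 0 & phi c2 y = 0],
  [/\ phi x1 x1 = 0, phi x1 x2 = 0, phi x2 x2 = 0, phi x1 y = 0 & phi x2 y = 0],
  [/\ phi c1 x1 = 1, phi c1 x2 = 0, phi c2 x1 = 0, phi c2 x2 = 1 & phi y y = 1] &
  [/\ forall u v, u \in U -> v \in U -> tri c1 u v = 0,
      forall u v, u \in U -> v \in U -> tri c2 u v = 0,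
      tri x1 x2 y = 1 &
      forall u, u \in U -> u = phi x1 u *: c1 + phi c1 u *: x1
        + phi x2 u *: c2 + phi c2 u *: x2 + phi y u *: y]].
Proof.
have [cz _ _ _ [_ nU _ _ _]] := hz.
have [b [bU b0 bT]] := rank6_center quadL solL hz dU.
have bb := rank6_isotropic char2 quadL solL iso hz clU dU bU bT.
have [x1 [U3 [x1U x1b x11 nU3 [dU3 /subvP U3U orth3 dec3]]]] :=
  hyper_split char2 quadL nU dU bU b0 bb.
have [s [ss os eU3]] := orthonormal_basis char2 quadL nU3
  (esym (eq_add_S _ _ (eq_add_S _ _ dU3))).
case: s ss os eU3 => [|e1 [|e2 [|e3 []]]] //= _ os eU3.
have sU3 e : e \in [:: e1; e2; e3] -> e \in U3 by rewrite eU3; apply: memv_span.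
have Tb p q : p \in U -> q \in U -> tri p q b = 0.
  by move=> pU qU; rewrite -(tri_cycle quadL) -(tri_cycle quadL) bT.
(* Brackets of vectors of [U3] can have a component along [b], so sl_2 is excluded modulo the sum of
   the centre and <b> rather than modulo the centre alone. *)
have t123 : tri e1 e2 e3 = 0.
  have [e11 _ _] := os.
  have br_b u : u \in U -> bracket u b \in centerv L.
    move=> uU.
    have [c cc [mem orth]] :=
      hpair_bracket quadL hz (memvf _) (bracket_perp_center quadL u b cz).
    suff -> : bracket u b = c by apply/(mem_centerP quadL).
    apply/eqP; rewrite -subr_eq0; apply/eqP/nU => // v vU.
    rewrite !(phiE quadL) orth // subr0 -/(tri _ _ _).
    by rewrite (triC12 quadL) bT ?oppr0.
  apply: (orthonormal3_tri_zero quadL solL (K := (centerv L + <[b]>)%VS)).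
  - move=> k k' /memv_addP[c /(mem_centerP quadL) cc [_ /vlineP[m ->] ->]].
    move=> /memv_addP[c' /(mem_centerP quadL) cc' [_ /vlineP[m' ->] ->]].
    rewrite (brDl lieL) cc (brZl lieL) (brDr lieL) (centralr lieL) //.
    by rewrite (brZr lieL) (brxx lieL) scaler0 addr0 scaler0 addr0 mem0v.
  - move=> k /memv_addP[c /(mem_centerP quadL) cc [_ /vlineP[m ->] ->]].
    have step e : e \in [:: e1; e2; e3] ->
        bracket e (c + m *: b) \in (centerv L + <[b]>)%VS.
      move=> es; rewrite (brDr lieL) (centralr lieL) // add0r (brZr lieL).
      by rewrite memvZ // (subvP (addvSl _ _)) // br_b // U3U // sU3.
    by split; apply: step; rewrite !inE eqxx ?orbT.
  - move=> p q ps qs; have pU := U3U _ (sU3 p ps); have qU := U3U _ (sU3 q qs).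
    have [c cc [mem orth]] :=
      hpair_bracket quadL hz (memvf _) (bracket_perp_center quadL p q cz).
    have tq e : e \in U -> phi (bracket p q - c) e = tri p q e.
      by move=> eU; rewrite !(phiE quadL) orth // subr0.
    have := dec3 _ mem; rewrite [phi b _](phiC quadL) tq // Tb // scale0r addr0.
    set r := bracket p q - c => rU3.
    have := span_expand quadL eU3 os rU3.
    have -> : \sum_(e <- [:: e1; e2; e3]) phi e (r - phi x1 r *: b) *: e
            = \sum_(e <- [:: e1; e2; e3]) tri p q e *: e.
      apply: eq_big_seq => e es; congr (_ *: _); have eU := U3U _ (sU3 e es).
      rewrite (phiC quadL) (phiDl quadL) tq // (phiNl quadL) (phiZl quadL).
      by have [_ ->] := orth3 e (sU3 e es); rewrite mulr0 subr0.
    move=> <-; have -> : bracket p q - (r - phi x1 r *: b) = c + phi x1 r *: b.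
      by have br_r : bracket p q - r = c; [rewrite /r subKr | rewrite opprB addrCA br_r addrC].
    by rewrite memv_add ?memvZ ?memv_line //; apply/(mem_centerP quadL).
  - apply/negP => /memv_addP[c /(mem_centerP quadL) cc [_ /vlineP[m ->] ee]].
    have e1U := U3U _ (sU3 e1 (mem_head _ _)).
    have c0 : c = 0.
      apply: clU cc; have -> : c = e1 - m *: b by rewrite ee addrK.
      by rewrite memvB ?memvZ.
    move: e11; rewrite ee c0 add0r !(phiE quadL) bb !mulr0 => /eqP.
    by rewrite eq_sym oner_eq0.
have abU3 : forall u v w, u \in U3 -> v \in U3 -> w \in U3 -> tri u v w = 0.
  rewrite eU3; apply: (tri_zero_on_span quadL) => p q r; rewrite !inE.
  by move=> /or3P[] /eqP-> /or3P[] /eqP-> /or3P[] /eqP->;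
    rewrite ?(triE quadL) ?(tri_perm quadL t123) ?oppr0.
(* The odd dimension of [U3] gives a vector killed by [x1] there. As [b] and the restriction of
   [tri] to [U3] contribute nothing, [p] is a second kernel vector of [tri] on [U], isotropic like
   [b]. *)
have [|p [pU3 p0 x1p]] := skew_odd_kernel char2 quadL x1 nU3.
  by rewrite (_ : \dim U3 = 3%N) //; case: dU3.
have pU := U3U p pU3.
have pT u v : u \in U -> v \in U -> tri p u v = 0.
  move=> uU vU; rewrite -(subrK (phi x1 u *: b + phi b u *: x1) u).
  rewrite -(subrK (phi x1 v *: b + phi b v *: x1) v).
  move: (dec3 u uU) (dec3 v vU); move: (u - _) (v - _) => u' v' u'U v'U.
  have u'U' := U3U _ u'U; have v'U' := U3U _ v'U.
  rewrite !(triE quadL) abU3 // !(Tb p _ pU) // [tri p b v'](triC12 quadL).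
  rewrite [tri p b x1](triC12 quadL) !bT // [tri p x1 v'](triC12 quadL) x1p //.
  by rewrite -[tri p u' x1](tri_cycle quadL) -(tri_cycle quadL) x1p //; ring.
have pp := rank6_isotropic char2 quadL solL iso hz clU dU pU pT.
have [x2 [U1 [x2U3 x2p x22 nU1 [dU1 /subvP U1U3 orth1 dec1]]]] :=
  hyper_split char2 quadL nU3 (esym (eq_add_S _ _ (eq_add_S _ _ dU3))) pU3 p0 pp.
have [s [ss {}os eU1]] := orthonormal_basis char2 quadL nU1
  (esym (eq_add_S _ _ (eq_add_S _ _ dU1))).
case: s ss os eU1 => [|y []] //= _ [yy _ _] eU1.
have yU1 : y \in U1 by rewrite eU1 memv_span ?inE ?eqxx.
have yU3 := U1U3 y yU1; have yU := U3U y yU3; have x2U := U3U x2 x2U3.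
have [x1x2 bx2] := orth3 x2 x2U3; have [x1p' bp] := orth3 p pU3.
have [x1y b_y] := orth3 y yU3; have [x2y py] := orth1 y yU1.
have expU u : u \in U -> u = phi x1 u *: b + phi b u *: x1
    + phi x2 u *: p + phi p u *: x2 + phi y u *: y.
  move=> uU; have u3 := dec3 u uU; have := dec1 _ u3.
  set u' := u - _ in u3 *; rewrite eU1 span_seq1 => /vlineP[c ec].
  have eu' : u' = phi x2 u' *: p + phi p u' *: x2 + c *: y by rewrite -ec addrC subrK.
  have eu : u = u' + (phi x1 u *: b + phi b u *: x1) by rewrite subrK.
  have px2 : phi x2 u = phi x2 u'.
    by rewrite eu !(phiE quadL) !(sym bx2, sym x1x2) !mulr0 !addr0.
  have pp' : phi p u = phi p u'.
    by rewrite eu !(phiE quadL) !(sym bp, sym x1p') !mulr0 !addr0.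
  have py' : phi y u = c.
    rewrite eu eu' !(phiE quadL) !(sym b_y, sym x1y, sym x2y, sym py) yy.
    by rewrite !mulr0 mulr1 !addr0 add0r.
  by rewrite px2 pp' py' {1}eu {1}eu' addrC !addrA.
have t0 : tri x1 x2 y != 0.
  apply/negP => /eqP t0; apply: (rank6_not_abelian char2 quadL hz clU dU).
  have eU : U = <<[:: b; p; x1; x2; y]>>%VS.
    apply/eqP; rewrite eqEsubv; apply/andP; split.
      apply/subvP => u uU; rewrite (expU u uU).
      by rewrite !memvD ?memvZ ?memv_span ?inE ?eqxx ?orbT.
    by apply/span_subvP => u; rewrite !inE;
      case/or4P=> [||| /orP[]] /eqP->.
  rewrite /abelian_on {1 2 3}eU; apply: (tri_zero_on_span quadL) => q r t qs rs ts.
  have mem v : v \in [:: b; p; x1; x2; y] -> v \in U by rewrite eU; apply: memv_span.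
  have qU := mem q qs; have rU := mem r rs; have tU := mem t ts; move: qs rs ts.
  have Tp v w : v \in U -> w \in U -> tri v w p = 0.
    by move=> vU wU; rewrite -(tri_cycle quadL) -(tri_cycle quadL) pT.
  rewrite ![_ \in b :: _]inE ![_ \in p :: _]inE.
  move=> /or3P[/eqP->|/eqP->|qs]; [by rewrite bT | by rewrite pT |].
  move=> /or3P[/eqP->|/eqP->|rs];
    [by rewrite (triC12 quadL) bT ?oppr0 | by rewrite (triC12 quadL) pT ?oppr0 |].
  move=> /or3P[/eqP->|/eqP->|ts]; [by rewrite Tb | by rewrite Tp |].
  move: qs rs ts; rewrite !inE.
  by move=> /or3P[] /eqP-> /or3P[] /eqP-> /or3P[] /eqP->;
    rewrite ?(triE quadL) ?(tri_perm quadL t0) ?oppr0.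
(* Opposite scalings of the dual vectors [b] and [x1] bring the remaining value of [tri] to 1. *)
exists (tri x1 x2 y *: b), ((tri x1 x2 y)^-1 *: x1), p, x2, y.
rewrite !(phiE quadL) !(sym bb, sym bp, sym pp, sym b_y, sym py, sym x11, sym x1x2,
  sym x22, sym x1y, sym x2y, sym x1b, sym bx2, sym x1p', sym x2p, yy) !mulr0 mulr1.
split=> //; first by rewrite !memvZ.
  by split=> //; field.
split=> // [u v uU vU||u uU].
- by rewrite (triZl quadL) bT ?mulr0.
- by rewrite (triZl quadL) mulVf.
rewrite !(phiZl quadL) !scalerA [_^-1 * phi x1 u]mulrC divfK //.
by rewrite [tri _ _ _ * _]mulrC mulfK // -expU.
Qed.

Lemma dim7_rank6 : isometric_iso L (r75 F).
Proof.
have [cz aa az zz [_ nU dimL [_ aU zU] _]] := hz.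
have [c1 [x1 [c2 [x2 [y [mem gc gx gcx [c1T c2T t12y expU]]]]]]] := rank6_frame.
have [c1U c2U x1U x2U yU] := mem; have [c11 c12 c22 c1y c2y] := gc.
have [x11 x12 x22 x1y x2y] := gx; have [cx11 cx12 cx21 cx22 yy] := gcx.
(* Parseval's identity again, in a basis made of two hyperbolic pairs and a unit vector instead of
   an orthonormal one. *)
have J p q r t : phi (bracket p q) (bracket r t) =
    tri p q x1 * tri r t c1 + tri p q c1 * tri r t x1 + tri p q x2 * tri r t c2
    + tri p q c2 * tri r t x2 + tri p q y * tri r t y.
  have [c cc [mc oc]] :=
    hpair_bracket quadL hz (memvf _) (bracket_perp_center quadL p q cz).
  have [d cd [md od]] :=
    hpair_bracket quadL hz (memvf _) (bracket_perp_center quadL r t cz).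
  have cu e : e \in U -> phi e (bracket p q - c) = tri p q e.
    by move=> eU; rewrite (phiC quadL) !(phiE quadL) oc // subr0.
  have -> : phi (bracket p q) (bracket r t) = phi (bracket p q - c) (bracket r t).
    by rewrite !(phiE quadL) (bracket_perp_center quadL r t cc) subr0.
  rewrite (expU _ mc) !(cu _ c1U, cu _ c2U, cu _ x1U, cu _ x2U, cu _ yU).
  by rewrite !(phiE quadL) ![phi _ (bracket r t)](phiC quadL) -!/(tri _ _ _); ring.
have J1 := jacobi4 quadL c1 x1 x2 a; have J2 := jacobi4 quadL c1 x1 y a.
have J3 := jacobi4 quadL c2 x1 x2 a; have J4 := jacobi4 quadL x1 x2 y a.
move: J1 J2 J3 J4; rewrite !J.
move Em: (tri a c1 x1) => m; move Em': (tri a c2 x2) => m'.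
move En1: (tri a c1 x2) => n1; move En2: (tri a c2 x1) => n2.
have t := (tri_perm quadL t12y,
  (tri_perm quadL (c1T _ _ c2U x1U), tri_perm quadL (c1T _ _ c2U x2U),
   tri_perm quadL (c1T _ _ c2U yU), tri_perm quadL (c1T _ _ x1U x2U),
   tri_perm quadL (c1T _ _ x1U yU), tri_perm quadL (c1T _ _ x2U yU),
   tri_perm quadL (c2T _ _ x1U x2U), tri_perm quadL (c2T _ _ x1U yU),
   tri_perm quadL (c2T _ _ x2U yU)),
  tri_perm quadL Em, tri_perm quadL Em', tri_perm quadL En1, tri_perm quadL En2).
rewrite ?(triE quadL) ?t ?(mul0r, mulr0, oppr0, addr0, add0r, mul1r, mulr1, mulN1r).
(* [D1], [D2] and [D3] say that ad a preserves <c1, c2> modulo [z]; the last identity says that its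
   matrix there has trace zero. *)
move=> /(tri_perm quadL) D1 /eqP; rewrite oppr_eq0 => /eqP /(tri_perm quadL) D2.
move=> /(tri_perm quadL) D3 mm'.
have {mm'} em' : m' = - m by apply/eqP; rewrite -addr_eq0 addrC mm'.
(* A kernel vector of the 2 x 2 matrix would be central in L, so the matrix is invertible. *)
have indep al be : al * m + be * n2 = 0 -> al * n1 - be * m = 0 -> al = 0 /\ be = 0.
  move=> e1 e2; have v0 : al *: c1 + be *: c2 = 0.
    apply: clU; first by rewrite memvD ?memvZ.
    apply: (hpair_central quadL hz) => [u w uU wU|u uU].
      by rewrite !(triE quadL) c1T ?c2T // !mulr0 addr0.
    rewrite (expU u uU) !(triE quadL) ?t ?D1 ?D2 ?D3 em'.
    transitivity (phi c1 u * (al * m + be * n2) + phi c2 u * (al * n1 - be * m)).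
      by ring.
    by rewrite e1 e2; ring.
  have p v : phi (al *: c1 + be *: c2) v = 0 by rewrite v0 (phi0l quadL).
  by move: (p x1) (p x2); rewrite !(phiE quadL) cx11 cx12 cx21 cx22
    !mulr0 !mulr1 addr0 add0r.
have det0 : m ^+ 2 + n1 * n2 != 0.
  apply/eqP => det0; have [||m0 n10] := indep m n1; [by rewrite -det0; ring | by ring |].
  have [||/eqP] := indep 1 0; rewrite ?m0 ?n10 ?oner_eq0 //; ring.
(* The eigenvalues are mu and - mu. The sign is chosen so that the eigenvectors [w1] and [w2] below
   are independent: their determinant is, up to sign, 2 mu (mu + m). *)
have [mu [mu2 k0]] : exists mu, mu ^+ 2 = m ^+ 2 + n1 * n2 /\ mu + m != 0.
  have [mu mu2] := closed_sqrt (m ^+ 2 + n1 * n2).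
  have [k0|k0] := eqVneq (mu + m) 0; last by exists mu.
  exists (- mu); rewrite sqrrN; split=> //.
  have em : m = - mu by apply/eqP; rewrite -addr_eq0 addrC k0.
  rewrite em -opprD oppr_eq0 -mulr2n -mulr_natl mulf_neq0 //.
  by apply: contraNneq det0 => mu0; rewrite -mu2 mu0 expr0n.
have mu0 : mu != 0 by apply: contraNneq det0 => mu0; rewrite -mu2 mu0 expr0n.
have en : n1 * n2 = mu ^+ 2 - m ^+ 2 by rewrite mu2 addrAC subrr add0r.
have g := (sym c11, sym c12, sym c22, sym c1y, sym c2y, sym cx11, sym cx12,
  sym cx21, sym cx22).
apply: (r75_of_frame char2 quadL (z := z) (a := a) (x1 := x1) (x2 := x2) (y := y)
  (w1 := (mu + m) *: c1 + n1 *: c2) (w2 := n2 *: c1 - (mu + m) *: c2) (mu := mu)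
  (k := mu + m) (n1 := n1) (n2 := n2) (al := - tri a x2 y) (be := tri a x1 y)
  (ga := - tri a x1 x2)) => //.
- by rewrite dimL dU.
- have -> : (mu + m) ^+ 2 + n1 * n2 = 2 * mu * (mu + m) by rewrite en; ring.
  by rewrite !mulf_neq0.
- by rewrite !(phiE quadL) !aU // !mulr0 oppr0 addr0.
- by rewrite !(phiE quadL) !zU // !mulr0 oppr0 addr0.
- by rewrite !(phiE quadL) !g !mulr0 oppr0 addr0.
- by rewrite !(phiE quadL) !g; split; ring.
- by rewrite !(phiE quadL) !g; split; ring.
- by rewrite !opprK.
- rewrite !(triE quadL) ?t em'; split; try by ring.
    transitivity (mu * m + m ^+ 2 + n1 * n2); [by ring | by rewrite en; ring].
  transitivity (n1 * n2 + mu * m + m ^+ 2); [by ring | by rewrite en; ring].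
- by rewrite !(triE quadL) ?D1 ?D2 ?D3; split; ring.
- by rewrite !(triE quadL) ?t; split; ring.
- by rewrite !(triE quadL) ?t; split; ring.
- by rewrite !(triE quadL) ?t; split; ring.
Qed.

End Dim7.

(** * Case analysis on the centre *)

Section Classification.
Variable F : closedFieldType.
Hypothesis char2 : (2 : F) != 0.
Variables (L : quad_alg F).
Hypothesis quadL : is_quadratic_lie L.
Hypothesis solL : solvable_lie L.
Implicit Types (U : {vspace L}).

Lemma centerless_or U :
  centerless U \/ exists z : L, [/\ z \in U, z != 0 & central z].
Proof.
have [UZ|UZ] := eqVneq (U :&: centerv L)%VS 0%VS; last first.
  right; exists (vpick (U :&: centerv L)%VS); rewrite vpick0 UZ.
  have := memv_pick (U :&: centerv L)%VS; rewrite memv_cap => /andP[zU zZ].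
  by split=> //; apply/(mem_centerP quadL).
left=> u uU /(mem_centerP quadL) uZ; apply/eqP.
by rewrite -memv0 -UZ memv_cap uU uZ.
Qed.

Lemma span_small_orthonormal U n : nondeg_on U -> \dim U = n ->
  exists2 s : seq L, size s = n & U = <<s>>%VS.
Proof.
move=> nU dU; have [s [ss _ eU]] := orthonormal_basis char2 quadL nU dU.
by exists s.
Qed.

Lemma iso_r1 : \dim (fullv : {vspace L}) = 1%N -> isometric_iso L (r1 F).
Proof.
move=> dL; have [|v _ vv] := nondeg_anisotropic char2 quadL (nondeg_full quadL).
  by rewrite -dimv_eq0 dL.
have [c cv] := unit_vector_of quadL vv.
apply: (isometric_iso_seq (s := [:: c *: v])) => //; first exact: quad_r1.
  move=> i j _; rewrite (ord1 i) (ord1 j) cv; symmetry.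
  by apply: (etrans (phi_r1 char2 'e_0 'e_0)); rewrite !mxE eqxx mulr1.
by move=> i j k; rewrite (ord1 i) (ord1 j).
Qed.

(** Pairs are split off until the rest contains no central vector. With k pairs and a rest of
    dimension n, the centre has dimension k, dim L = 2k + n and the rank of [tri] is k + n; the
    bound 7 leaves k at most 3, and each pair (k, n) calls one earlier lemma. *)
Lemma isotropic_center_cases : (forall z : L, central z -> phi z z = 0) ->
  (1 <= \dim (fullv : {vspace L}) <= 7)%N ->
  exists k : label F, listed k /\ isometric_iso L (alg_of k).
Proof.
move=> iso /andP[dim_gt0 dim7].
have [z1 z1_neq0 cz1] := center_neq0 quadL solL dim_gt0.
have [x1 [U1 h1]] :=
  hpair_exists char2 quadL iso (nondeg_full quadL) (memvf z1) z1_neq0 cz1.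
have [_ _ _ _ [_ nU1 dU1 _ _]] := h1.
have x1_nc := hpair_not_central char2 quadL iso h1.
have [cl1|[z2 [z2U1 z2_neq0 cz2]]] := centerless_or U1.
  move dU: (\dim U1) dU1 => n dU1.
  case: n dU dU1 => [|[|[|[|[|[|n]]]]]] dU dU1.
  - have [[|//] _ eU] := span_small_orthonormal nU1 dU; case: x1_nc.
    rewrite eU in h1.
    by apply: (central_of_rank2 quadL (hpair_spans1 quadL h1)); rewrite ?inE.
  - have [[|e []] // _ eU] := span_small_orthonormal nU1 dU; case: x1_nc.
    rewrite eU in h1.
    by apply: (central_of_rank2 quadL (hpair_spans1 quadL h1)); rewrite ?inE ?eqxx.
  - by exists R41; split=> //; apply: (hyperbolic_r41 char2 quadL iso h1).
  - by case: (rank4_k1 char2 quadL iso h1 cl1 dU).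
  - have [[lam lam0 isoL]|isoL] := dim6_cases char2 quadL h1 cl1 dU.
      by exists (R62 lam).
    by exists R63.
  - by exists R75; split=> //; apply: (dim7_rank6 char2 quadL solL iso h1 cl1 dU).
  - by move: dim7; rewrite dU1.
have [x2 [U2 h2]] := hpair_exists char2 quadL iso nU1 z2U1 z2_neq0 cz2.
have [_ _ _ _ [_ nU2 dU2 _ _]] := h2.
have [cl2|[z3 [z3U2 z3_neq0 cz3]]] := centerless_or U2.
  move dU: (\dim U2) dU2 => n dU2.
  case: n dU dU2 => [|[|[|[|n]]]] dU dU2.
  - have [[|//] _ eU] := span_small_orthonormal nU2 dU; case: x1_nc.
    rewrite eU in h2.
    by apply: (central_of_rank2 quadL (hpair_spans2 quadL h1 h2)); rewrite ?inE ?eqxx.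
  - by exists R5; split=> //; apply: (rank3_r5 char2 quadL iso h1 h2).
  - by case: (rank4_k2 char2 quadL iso h1 h2 cl2 z2U1 dU).
  - have [isoL|isoL] := dim7_rank5_cases char2 quadL solL iso h1 h2 z2U1 cl2 dU.
      by exists R71.
    by exists R72.
  - by move: dim7; rewrite dU1 dU2.
have [x3 [U3 h3]] := hpair_exists char2 quadL iso nU2 z3U2 z3_neq0 cz3.
have [_ _ _ _ [_ nU3 dU3 _ _]] := h3.
move dU: (\dim U3) dU3 => n dU3.
case: n dU dU3 => [|[|n]] dU dU3.
- by exists R61; split=> //; apply: (rank3_r61 char2 quadL iso h1 h2 h3).
- have [cl3|[z4 [z4U3 z4_neq0 cz4]]] := centerless_or U3.
    by case: (rank4_k3 char2 quadL iso h1 h2 h3 cl3 z2U1 z3U2 dU).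
  have [x4 [U4 [_ _ _ _ [_ _ dU4 _ _]]]] :=
    hpair_exists char2 quadL iso nU3 z4U3 z4_neq0 cz4.
  by rewrite dU in dU4.
- by move: dim7; rewrite dU1 dU2 dU3.
Qed.

End Classification.

Theorem theorem4p2 (F : closedFieldType) (char_not2 : 2%N \notin [pchar F]) :
  [/\ forall k : label F, listed k ->
        [/\ is_quadratic_lie (alg_of k), ~ decomposable (alg_of k),
            solvable_lie (alg_of k)
          & (1 <= \dim (fullv : {vspace alg_of k}) <= 7)%N],
      forall L : quad_alg F,
        is_quadratic_lie L -> ~ decomposable L -> solvable_lie L ->
        (1 <= \dim (fullv : {vspace L}) <= 7)%N ->
        exists k : label F, listed k /\ isometric_iso L (alg_of k),
      forall k k' : label F, listed k -> listed k' ->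
        isometric_iso (alg_of k) (alg_of k') ->
        k = k' \/ exists lam mu : F, k = R62 lam /\ k' = R62 mu
    & forall lam mu : F, lam != 0 -> mu != 0 ->
        isometric_iso (r62 lam) (r62 mu) <->
        mu \in [:: lam; - lam; lam^-1; - lam^-1]].
Proof.
have char2 : (2 : F) != 0 by move: char_not2; rewrite inE.
split.
- move=> k lk; split.
  + exact: quad_alg_of.
  + exact: indecomposable_alg_of.
  + exact: solvable_alg_of.
  + by rewrite dim_alg_of; case: k {lk}.
- move=> L quadL indL solL dimL.
  (* In dimension 1 the line spanned by a central vector is not a proper ideal, so isotropy of the
     centre fails and this case is settled directly. *)
  have [dL1|dL1] := eqVneq (\dim (fullv : {vspace L})) 1%N.
    by exists R1; split=> //; apply: iso_r1.
  apply: isotropic_center_cases => // z cz; apply: central_isotropic => //.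
  by move: dimL dL1; case: (\dim _) => [|[|n]].
- exact: iso_label.
- move=> lam mu lam0 mu0; split; first exact: iso_r62_cond.
  exact: iso_r62.
Qed.
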